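(* Let $\alpha>0$ and let $\mu$ be a positive Borel measure on $(0,\infty)$. (a) If $\sum_{n=0}^\infty \mu_n<\infty$, then $\mathcal{H}_\mu(F^{\infty}_{\alpha})\subset F^{1}_\alpha$. (b) If $\mathcal{H}_\mu(F^{\infty}_{\alpha})\subset F^{1}_\alpha$, then $\sum_{n=0}^\infty\mu_n (n+1)^{-\frac{1}{2}}<\infty$.
   Context: For $\alpha>0$, $F^1_\alpha$ is the space of entire functions $f$ with $\|f\|_{1,\alpha}=\frac{\alpha}{2\pi}\int_{\mathbb C}|f(z)|e^{-\frac{\alpha}{2}|z|^2}\,dA(z)<\infty$ ($dA$ is area measure) and $F^\infty_\alpha$ is the space of entire functions $f$ with $\|f\|_{\infty,\alpha}=\sup_{z\in\mathbb C}|f(z)|e^{-\frac{\alpha}{2}|z|^2}<\infty$. The Hausdorff operator is $\mathcal{H}_\mu(f)(z)=\int_0^\infty f\left(\frac{z}{t}\right)\frac{d\mu(t)}{t}$ for entire $f$, and $\mu_n=\int_0^\infty\frac{d\mu(t)}{t^{n+1}}$ for $n=0,1,2,\dots$. The notation $\mathcal{H}_\mu(X)\subset Y$ means that $\mathcal{H}_\mu:X\to Y$ is a well defined and bounded operator. *)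

(* Defs.v *)
From HB Require Import structures.
From mathcomp Require Import all_boot all_order all_algebra.
From mathcomp Require Import complex.
From mathcomp Require Import all_classical all_reals all_analysis.
Set Implicit Arguments.
Unset Strict Implicit.
Unset Printing Implicit Defensive.
Import Order.TTheory GRing.Theory Num.Theory.
Import numFieldNormedType.Exports.
Local Open Scope classical_set_scope.
Local Open Scope ring_scope.
Local Open Scope complex_scope.

Section FockSpaces.
Context {R : realType}.
Implicit Types (f : R[i] -> R[i]) (alpha : R).

(* The scalar field of the normed module R[i]^o is R[i], so this is complex
   differentiability. *)
Definition entire f : Prop :=
  forall z : R[i], derivable (f : R[i]^o -> R[i]^o) z 1.

Definition weighted_modulus alpha f (z : R[i]) : R :=
  Normc.normc (f z) * expR (- (alpha / 2) * Normc.normc z ^+ 2).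

Definition area_measure :
    {measure set (measurableTypeR R * measurableTypeR R) -> \bar R} :=
  ((@lebesgue_measure R) \x (@lebesgue_measure R))%E.

Definition fock1_norm alpha f : \bar R :=
  ((alpha / (2 * pi))%:E *
   \int[area_measure]_p (weighted_modulus alpha f (p.1 +i* p.2))%:E)%E.

Definition fockoo_norm alpha f : \bar R :=
  ereal_sup (range (fun z => (weighted_modulus alpha f z)%:E)).

Definition fock1 alpha : set (R[i] -> R[i]) :=
  [set f | entire f /\ (fock1_norm alpha f < +oo)%E].

Definition fockoo alpha : set (R[i] -> R[i]) :=
  [set f | entire f /\ (fockoo_norm alpha f < +oo)%E].

End FockSpaces.

Section ComplexIntegral.
Context {d : measure_display} {T : measurableType d} {R : realType}.
Variables (mu : {measure set T -> \bar R}) (D : set T).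
Implicit Types g : T -> R[i].

Definition cintegrable g : Prop :=
  mu.-integrable D (EFin \o (fun t => complex.Re (g t))) /\
  mu.-integrable D (EFin \o (fun t => complex.Im (g t))).

Definition cintegral g : R[i] :=
  (\int[mu]_(t in D) complex.Re (g t)) +i* (\int[mu]_(t in D) complex.Im (g t)).

End ComplexIntegral.

Section Hausdorff.
Context {R : realType}.

(* A Borel measure on (0, +oo) is given by a Borel measure on R of which only
   the restriction to `]0, +oo[ is ever used. *)
Variable mu : {measure set (measurableTypeR R) -> \bar R}.
Implicit Types f : R[i] -> R[i].

Definition hausdorff_moment (n : nat) : \bar R :=
  (\int[mu]_(t in `]0%R, +oo[) (t ^- n.+1)%:E)%E.

Definition hausdorff_integrand f (z : R[i]) (t : R) : R[i] :=
  f (z / t%:C) / t%:C.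

Definition hausdorff f (z : R[i]) : R[i] :=
  cintegral mu `]0, +oo[ (hausdorff_integrand f z).

(* [cintegral] is total, with a junk value outside of
   [cintegrable]; being well defined therefore includes the (absolute)
   convergence of the integral at every point. *)
Definition hausdorff_bounded (X : set (R[i] -> R[i]))
    (normX : (R[i] -> R[i]) -> \bar R) (Y : set (R[i] -> R[i]))
    (normY : (R[i] -> R[i]) -> \bar R) : Prop :=
  (forall f, X f ->
     (forall z, cintegrable mu `]0, +oo[ (hausdorff_integrand f z)) /\
     Y (hausdorff f)) /\
  (exists M : R, forall f, X f ->
     (normY (hausdorff f) <= M%:E * normX f)%E).

End Hausdorff.

(* Main.v *)
(* (a) If the sum of the moments is finite, then [mu] vanishes on ]0, 1] and
   [1 / (t - 1)] is [mu]-integrable on ]1, +oo[.  Since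
   [|f(z / t)| <= ||f|| e^(alpha |z|^2 / (2 t^2))], Tonelli and a Gaussian
   integral bound [||H f||_1] by a multiple of
   [int t^-1 / (1 - t^-2) dmu <= int 1 / (t - 1) dmu].  That [H f] is entire
   follows by dominated convergence once [f] is known to be locally Lipschitz,
   which is read off Cauchy's formula on a square.

   (b) For [f = z^(2m)] one has [H f = mu_(2m) f], and comparing the two norms of
   a monomial shows that [mu_(2m)] grows at most linearly in [m]; hence
   [mu] vanishes on ]0, 1[.  For [f = e^(alpha z^2 / 2)] and [z = x + i y] with
   [alpha y^2 <= 1], the number
   [Re (e^(-i alpha x y) H f(z)) e^(-alpha |z|^2 / 2)],
   integrated over [0 <= x <= n], is at least a constant times
   [int_t t^-1 int_0^n e^(-a x^2) dx dmu] with [a = alpha (1 - t^-2) / 2], and the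
   inner integral dominates [sum_(k < n) t^-k (k + 1)^(-1/2)]. *)
Require Import Defs.
From HB Require Import structures.
From mathcomp Require Import all_boot all_order all_algebra.
From mathcomp Require Import complex.
From mathcomp Require Import all_classical all_reals all_analysis.
From mathcomp Require Import measurable_realfun.
From mathcomp Require Import ring lra.
Import Order.TTheory GRing.Theory Num.Theory.
Import numFieldNormedType.Exports.
Set Implicit Arguments.
Unset Strict Implicit.
Unset Printing Implicit Defensive.
Local Open Scope classical_set_scope.
Local Open Scope ring_scope.
Local Open Scope complex_scope.
Local Notation normc := Normc.normc.

(** * Complex derivatives and the complex exponential *)

Section ComplexModulus.
Context {R : realType}.
Implicit Types (z w : R[i]) (f : R[i] -> R[i]).

(** [mu] is not assumed sigma-finite, so Tonelli's theorem does not apply to it directly. In both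
    directions the finite integral of [1 / t] over the relevant set makes the restriction of [mu]
    sigma-finite, and the integrals are moved to that restriction. The point 1 is treated
    differently in the two halves: summable moments exclude an atom there, whereas the monomial test
    cannot see one. So (a) works on []1, +oo[] and (b) on [[1, +oo[]. At [t = 1] the Gaussian rate
    [a] vanishes, which is why (b) cuts the [x]-range at [n] and compares with [n] terms of the
    series. The exponent [-1/2] arises because the full Gaussian integral and
    [sum_k w^k (k + 1)^(-1/2)] both grow like [(1 - w)^(-1/2)] as [w = 1 / t] tends to 1. The
    rotated integrand still takes both signs. Adding [w] makes it nonnegative, and what is added
    integrates to the finite number [n mu_0], which is cancelled at the end. Differentiating under
    the integral needs a Lipschitz constant uniform in [t]; since [|z / t| <= |z|] for [t > 1], one
    constant on one disc serves every [t]. *)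

Lemma normcE z : normc z = Num.sqrt (complex.Re z ^+ 2 + complex.Im z ^+ 2).
Proof. by case: z. Qed.

Lemma normc_ge0 z : 0 <= normc z.
Proof. by rewrite normcE sqrtr_ge0. Qed.

Lemma normc_eq0 z : (normc z == 0) = (z == 0).
Proof.
by apply/eqP/eqP => [/Normc.eq0_normc//|->]; rewrite Normc.normc0.
Qed.

Lemma normc_gt0 z : (0 < normc z) = (z != 0).
Proof. by rewrite lt_def normc_ge0 andbT normc_eq0. Qed.

Lemma sqr_normc z : normc z ^+ 2 = complex.Re z ^+ 2 + complex.Im z ^+ 2.
Proof. by rewrite normcE sqr_sqrtr// addr_ge0// sqr_ge0. Qed.

Lemma ler_normc_Re z : `|complex.Re z| <= normc z.
Proof. by rewrite normcE -sqrtr_sqr ler_sqrt ?addr_ge0 ?sqr_ge0// lerDl sqr_ge0. Qed.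

Lemma ler_normc_Im z : `|complex.Im z| <= normc z.
Proof. by rewrite normcE -sqrtr_sqr ler_sqrt ?addr_ge0 ?sqr_ge0// lerDr sqr_ge0. Qed.

Lemma ler_normc_ReIm z : normc z <= `|complex.Re z| + `|complex.Im z|.
Proof.
rewrite -(@ler_pXn2r _ 2) ?nnegrE ?normc_ge0 ?addr_ge0//.
by rewrite sqr_normc sqrrD !real_normK ?num_real// addrAC lerDl mulrn_wge0// mulr_ge0.
Qed.

Lemma normc_real (x : R) : normc x%:C = `|x|.
Proof. by rewrite normcE/= expr0n addr0 sqrtr_sqr. Qed.

Lemma normc_i : normc ('i : R[i]) = 1.
Proof. by rewrite normcE/= expr0n expr1n add0r sqrtr1. Qed.

Lemma normcX z n : normc (z ^+ n) = normc z ^+ n.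
Proof.
elim: n => [|n IH]; first by rewrite !expr0 -[1]/(1 +i* 0) Normc.normc1.
by rewrite !exprS Normc.normcM IH.
Qed.

Lemma normcB z w : normc (z - w) = normc (w - z).
Proof. by rewrite -normcN opprB. Qed.

Lemma ler_normcB z w : normc (z - w) <= normc z + normc w.
Proof. by rewrite -(normcN w) le_normcD. Qed.

Lemma ler_normc_sub z w : normc z <= normc (z - w) + normc w.
Proof. by rewrite -{1}(subrK w z) le_normcD. Qed.

(** Little-o form of differentiability: there is no division by [h], and [e], [d] and all moduli are
    real, so estimates reduce to real arithmetic. *)
Definition cderiv f z (D : R[i]) := forall e : R, 0 < e ->
  exists2 d : R, 0 < d & forall h, normc h < d ->
    normc (f (z + h) - f z - D * h) <= e * normc h.

(** A positive element of [R[i]] has zero imaginary part, so the radii and errors in the topology of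
    [R[i]^o] are real numbers in disguise. The case [h = 0], which the difference quotient excludes,
    is trivial in the little-o form. *)
Lemma derivable_cderiv f z :
  derivable (f : R[i]^o -> R[i]^o) z 1 <-> exists D, cderiv f z D.
Proof.
rewrite /derivable; split.
- move=> /cvg_ex[D]; move=> /cvgrPdist_le fD; exists D => e e0.
  have := fD e%:C; rewrite ltcR => /(_ e0).
  rewrite near_withinE => /nbhs_ballP[d/=]; rewrite ltcE/= => /andP[/eqP d2 d0] H.
  exists (complex.Re d) => // h hd.
  have [->|h0] := eqVneq h 0.
    by rewrite addr0 subrr mulr0 subrr Normc.normc0 mulr0.
  have := H h; rewrite /ball/= sub0r normrN => /(_ _ h0).
  have -> : d = (complex.Re d)%:C by rewrite [LHS]complexE d2 mulr0 addr0.
  rewrite [X in (X < _ -> _)%O](_ : _ = (normc h)%:C)// ltcR => /(_ hd).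
  rewrite [X in (X <= _)%O](_ : _ =
    (normc (D - h^-1 * (f (h * 1 + z) - f z)))%:C)// lecR => K.
  rewrite -ler_pdivrMr ?normc_gt0// -Normc.normcV -Normc.normcM.
  apply: le_trans K; rewrite normcB le_eqVlt; apply/orP; left; apply/eqP; congr normc.
  by rewrite mulr1 (addrC h) [LHS]mulrBl mulfK// mulrC.
- move=> [D fD]; apply/cvg_ex; exists D; apply/cvgrPdist_le => e.
  rewrite ltcE/= => /andP[/eqP e2 e0].
  have [d d0 H] := fD _ e0.
  rewrite near_withinE; apply/nbhs_ballP; exists d%:C; first by rewrite /= ltcR.
  move=> h; rewrite /ball/= sub0r normrN.
  rewrite [X in (X < _ -> _)%O](_ : _ = (normc h)%:C)// ltcR => /H{}H h0.
  have -> : e = (complex.Re e)%:C by rewrite [LHS]complexE e2 mulr0 addr0.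
  rewrite [X in (X <= _)%O](_ : _ =
    (normc (D - h^-1 * (f (h * 1 + z) - f z)))%:C)// lecR.
  rewrite -(ler_pM2r (x := normc h)) ?normc_gt0// mulrC; apply: le_trans H.
  rewrite mulrC -Normc.normcM normcB le_eqVlt; apply/orP; left; apply/eqP; congr normc.
  by rewrite mulr1 (addrC h) mulrBl (mulrC h^-1) divfK.
Qed.

End ComplexModulus.

Section ComplexDerivative.
Context {R : realType}.
Implicit Types (z w D : R[i]) (f g : R[i] -> R[i]).

Lemma cderiv_dist f z D : cderiv f z D -> forall e : R, 0 < e ->
  exists2 d : R, 0 < d & forall h, normc h < d -> normc (f (z + h) - f z) <= e.
Proof.
move=> fD e e0; have [d d0 H] := fD 1 ltr01.
pose C := 1 + normc D.
have C0 : 0 < C by rewrite ltr_wpDr ?normc_ge0.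
exists (Num.min d (e / C)) => [|h]; first by rewrite lt_min d0 divr_gt0.
rewrite lt_min => /andP[/H hd he].
apply: (le_trans (ler_normc_sub _ (D * h))).
apply: (@le_trans _ _ (normc h * C)).
  by rewrite mulrDr mulr1 Normc.normcM (mulrC (normc D)) lerD2r -[leRHS]mul1r.
by rewrite -ler_pdivlMr// ltW.
Qed.

Lemma cderiv_cst (c z : R[i]) : cderiv (fun=> c) z 0.
Proof.
move=> e e0; exists 1 => // h _.
by rewrite subrr mul0r subrr Normc.normc0 mulr_ge0 ?normc_ge0// ltW.
Qed.

Lemma cderiv_id z : cderiv id z 1.
Proof.
move=> e e0; exists 1 => // h _.
rewrite (_ : z + h - z - 1 * h = 0); last by ring.
by rewrite Normc.normc0 mulr_ge0 ?normc_ge0// ltW.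
Qed.

Lemma cderivD f g z D D' : cderiv f z D -> cderiv g z D' ->
  cderiv (fun w => f w + g w) z (D + D').
Proof.
move=> fD gD e e0; have [d d0 H] := fD _ (divr_gt0 e0 (ltr0n _ 2)).
have [d' d'0 H'] := gD _ (divr_gt0 e0 (ltr0n _ 2)).
exists (Num.min d d') => [|h]; first by rewrite lt_min d0.
rewrite lt_min => /andP[/H {}H /H' {}H'].
rewrite (_ : _ - _ = (f (z + h) - f z - D * h) + (g (z + h) - g z - D' * h)); last by ring.
by apply: (le_trans (le_normcD _ _)); apply: (le_trans (lerD H H')); lra.
Qed.

Lemma cderivM f g z D D' : cderiv f z D -> cderiv g z D' ->
  cderiv (fun w => f w * g w) z (D * g z + f z * D').
Proof.
move=> fD gD e e0.
pose C := 1 + normc (g z) + normc D + normc (f z).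
have C1 : 1 <= C by rewrite /C -!addrA lerDl !addr_ge0// normc_ge0.
have C0 : 0 < C by apply: lt_le_trans C1.
have eC : 0 < e / (3 * C) by rewrite divr_gt0// mulr_gt0.
have [d d0 H] := fD _ eC.
have [d' d'0 H'] := gD _ eC.
have m0 : 0 < Num.min 1 (e / (3 * C)) by rewrite lt_min ltr01.
have [d2 d20 H2] := cderiv_dist gD m0.
exists (Num.min d (Num.min d' d2)) => [|h]; first by rewrite !lt_min d0 d'0.
rewrite !lt_min => /andP[/H {}H /andP[/H' {}H' /H2]].
rewrite le_min => /andP[H21 H2e].
(* Three errors, each with one small factor; [C] bounds the cofactors, the first one because the
   increment of [g] is at most 1. Hence the 3 in [e / (3 * C)]. *)
rewrite (_ : _ - _ = (f (z + h) - f z - D * h) * (g z + (g (z + h) - g z))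
  + f z * (g (z + h) - g z - D' * h) + D * h * (g (z + h) - g z)); last by ring.
apply: (le_trans (le_normcD _ _)).
apply: (@le_trans _ _ (e / (3 * C) * normc h * C + C * (e / (3 * C) * normc h) +
   C * normc h * (e / (3 * C)))).
  apply: lerD.
    apply: (le_trans (le_normcD _ _)); rewrite !Normc.normcM; apply: lerD.
      apply: ler_pM; rewrite ?normc_ge0//.
      apply: (le_trans (le_normcD _ _)).
      rewrite /C (addrC 1) -!addrA lerD2l (le_trans H21)// lerDl.
      by rewrite addr_ge0// normc_ge0.
    apply: ler_pM; rewrite ?normc_ge0// /C lerDr !addr_ge0// normc_ge0//.
  rewrite !Normc.normcM.
  apply: ler_pM; rewrite ?mulr_ge0 ?normc_ge0//.
  rewrite ler_wpM2r ?normc_ge0// /C -addrA addrCA lerDl.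
  by rewrite !addr_ge0// normc_ge0.
rewrite le_eqVlt; apply/orP; left; apply/eqP; field.
by rewrite gt_eqF.
Qed.

Lemma cderivV f z D : f z != 0 -> cderiv f z D ->
  cderiv (fun w => (f w)^-1) z (- D / f z ^+ 2).
Proof.
move=> fz0 fD e e0.
pose m := normc (f z).
have m0 : 0 < m by rewrite normc_gt0.
have [d1 d10 H1] := cderiv_dist fD (divr_gt0 m0 (ltr0n _ 2)).
have [d2 d20 H2] := fD _ (mulr_gt0 e0 (divr_gt0 (exprn_gt0 2 m0) (ltr0n _ 4))).
(* Both constants are tuned to [|f (z + h)| >= m / 2]: the two summands of the split below then
   carry factors [2 / m^2] and [2 / m^3], and each is at most half of [e |h|]. *)
pose c := e * m ^+ 3 / (4 * (1 + normc D)).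
have c0 : 0 < c.
  by rewrite /c divr_gt0 ?mulr_gt0 ?exprn_gt0// ltr_wpDr ?normc_ge0.
have [d3 d30 H3] := cderiv_dist fD c0.
exists (Num.min d1 (Num.min d2 d3)) => [|h]; first by rewrite !lt_min d10 d20.
rewrite !lt_min => /andP[/H1 {}H1 /andP[/H2 {}H2 /H3 {}H3]].
have mE : normc (f z) = m by [].
move: fz0 mE H1 H2 H3; move: (f z) (f (z + h)) @m m0 @c c0 => a b m m0 c c0.
move=> a0 mE H1 H2 H3.
have mb : m / 2 <= normc b.
  by have := ler_normc_sub a b; rewrite (normcB a b) mE; lra.
have b0 : b != 0 by rewrite -normc_gt0 (lt_le_trans _ mb)// divr_gt0.
rewrite (_ : _ - _ = - (b - a - D * h) / (a * b) + D * h * (b - a) / (a ^+ 2 * b)); last first.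
  by field; rewrite a0 b0.
apply: (le_trans (le_normcD _ _)).
rewrite (Normc.normcM (- _)) (Normc.normcM (D * h * _)) !Normc.normcV (Normc.normcM a).
rewrite (Normc.normcM (_ ^+ 2)) normcX normcN (Normc.normcM (D * h)) (Normc.normcM D) mE.
have h0 := normc_ge0 h; have D0 := normc_ge0 D.
have V : (normc b)^-1 <= 2 / m.
  by rewrite -[leRHS]invrK lef_pV2 ?posrE ?normc_gt0 ?invr_gt0 ?divr_gt0// invf_div.
apply: (@le_trans _ _ (e * (m ^+ 2 / 4) * normc h * (m^-1 * (2 / m)) +
   normc D * normc h * c * (m ^- 2 * (2 / m)))).
  have mi : 0 <= m^-1 by rewrite invr_ge0 ltW.
  have mi2 : 0 <= m ^- 2 by rewrite invr_ge0 exprn_ge0// ltW.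
  have bi : 0 <= (normc b)^-1 by rewrite invr_ge0 normc_ge0.
  rewrite !invfM; apply: lerD; apply: ler_pM; rewrite ?normc_ge0 ?mulr_ge0 ?normc_ge0//;
    by rewrite ?ler_wpM2l ?mulr_ge0.
apply: (@le_trans _ _ (e / 2 * normc h + e / 2 * normc h * (normc D / (1 + normc D)))).
  rewrite /c le_eqVlt; apply/orP; left; apply/eqP; field.
  by rewrite !gt_eqF// ltr_wpDr.
have x1 : normc D / (1 + normc D) <= 1 by rewrite ler_pdivrMr ?ltr_wpDr// mul1r lerDr.
have A : 0 <= e / 2 * normc h by rewrite mulr_ge0// divr_ge0// ltW.
have := ler_wpM2l A x1; lra.
Qed.

End ComplexDerivative.

Section ComplexExponential.
Context {R : realType}.
Implicit Types (z w D : R[i]) (f g : R[i] -> R[i]).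

Lemma cderiv_comp f g z D D' : cderiv f (g z) D -> cderiv g z D' ->
  cderiv (f \o g) z (D * D').
Proof.
move=> fD gD e e0 /=.
pose C := 1 + normc D + normc D'.
have C0 : 0 < C by rewrite /C -addrA ltr_wpDr ?addr_ge0 ?normc_ge0.
have eC : 0 < e / (2 * C) by rewrite divr_gt0// mulr_gt0.
have [d d0 H] := fD _ eC.
have [d1 d10 H1] := cderiv_dist gD (divr_gt0 d0 (ltr0n _ 2)).
have m0 : 0 < Num.min 1 (e / (2 * C)) by rewrite lt_min ltr01.
have [d2 d20 H2] := gD _ m0.
exists (Num.min d1 d2) => [|h]; first by rewrite lt_min d10.
rewrite lt_min => /andP[/H1{}H1 /H2{}H2].
set k := g (z + h) - g z in H1 H2 *.
have -> : g (z + h) = g z + k by rewrite /k [RHS]addrC subrK.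
rewrite (_ : _ - _ = (f (g z + k) - f (g z) - D * k) + D * (k - D' * h)); last by ring.
apply: (le_trans (le_normcD _ _)).
have kh : normc k <= C * normc h.
  apply: (le_trans (ler_normc_sub _ (D' * h))); rewrite Normc.normcM.
  have := normc_ge0 h; have := normc_ge0 D; have := normc_ge0 D'.
  have : normc (k - D' * h) <= normc h.
    apply: (le_trans H2); rewrite -[leRHS]mul1r ler_wpM2r ?normc_ge0//.
    by rewrite ge_min lexx.
  by rewrite /C; nra.
have kd : normc k < d by apply: le_lt_trans H1 _; lra.
have A := H _ kd.
have B : normc (k - D' * h) <= e / (2 * C) * normc h.
  by apply: (le_trans H2); rewrite ler_wpM2r ?normc_ge0// ge_min lexx orbT.
apply: (@le_trans _ _ (e / (2 * C) * (C * normc h) + C * (e / (2 * C) * normc h))).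
  apply: lerD; first by apply: (le_trans A); rewrite ler_wpM2l// ltW.
  rewrite Normc.normcM; apply: ler_pM; rewrite ?normc_ge0//.
  by rewrite /C addrAC lerDr addr_ge0 ?normc_ge0.
by rewrite le_eqVlt; apply/orP; left; apply/eqP; field; rewrite gt_eqF.
Qed.

Lemma is_derive_littleo (g : R -> R) (x dg : R) : is_derive x 1 g dg ->
  forall e : R, 0 < e -> exists2 d : R, 0 < d & forall h, `|h| < d ->
    `|g (x + h) - g x - dg * h| <= e * `|h|.
Proof.
move=> [gx <-] e e0; move: gx; rewrite /derivable => /cvg_ex[l] gl.
have -> : 'D_1 g x = l by apply: cvg_lim => //.
move/cvgrPdist_le : gl => /(_ _ e0).
rewrite near_withinE => /nbhs_ballP[d/= d0 H]; exists d => // h hd.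
have [->|h0] := eqVneq h 0.
  by rewrite addr0 subrr mulr0 subrr normr0 mulr0.
have := H h; rewrite /ball/= sub0r normrN => /(_ hd h0).
rewrite -ler_pdivrMr ?normr_gt0// -normfV -normrM => K.
apply: le_trans K; rewrite distrC le_eqVlt; apply/orP; left; apply/eqP; congr `|_|.
by rewrite scaler1 (addrC h) [LHS]mulrBl mulfK// mulrC.
Qed.

Definition cexp z : R[i] :=
  (expR (complex.Re z))%:C * (cos (complex.Im z) +i* sin (complex.Im z)).

Lemma cexpD z w : cexp (z + w) = cexp z * cexp w.
Proof.
case: z w => [a b] [c d]; rewrite /cexp/= expRD cosD sinD.
by apply/eqP; rewrite eq_complex/=; apply/andP; split; apply/eqP; ring.
Qed.

Lemma cexp0 : cexp 0 = 1.
Proof. by rewrite /cexp/= expR0 cos0 sin0; apply/eqP; rewrite eq_complex/=; apply/andP; split; apply/eqP; ring. Qed.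

Lemma cderiv_cexp0 : cderiv cexp 0 1.
Proof.
move=> e e0.
(* Eight error terms appear below, three in the real part and five in the imaginary part, each at
   most [m |h|]. *)
pose m := Num.min 1 (e / 8).
have m0 : 0 < m by rewrite lt_min ltr01 divr_gt0.
have [m1 me] : m <= 1 /\ 8 * m <= e.
  split; first by rewrite ge_min lexx.
  rewrite mulrC -ler_pdivlMr//.
  by rewrite ge_min lexx orbT.
clearbody m.
have [d1 d10 H1] := is_derive_littleo (is_derive_expR 0) m0.
have [d2 d20 H2] := is_derive_littleo (is_derive_cos 0) m0.
have [d3 d30 H3] := is_derive_littleo (is_derive_sin 0) m0.
exists (Num.min m (Num.min d1 (Num.min d2 d3))) => [|h].
  by rewrite !lt_min m0 d10 d20.
rewrite !lt_min => /and4P[hm h1 h2 h3].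
have ha := ler_normc_Re h; have hb := ler_normc_Im h.
have := H1 _ (le_lt_trans ha h1); have := H2 _ (le_lt_trans hb h2).
have := H3 _ (le_lt_trans hb h3).
rewrite !add0r expR0 sin0 cos0 oppr0 mul0r !subr0 !mul1r cexp0.
have := ler_normc_ReIm (cexp h - 1 - h).
case: h {h1 h2 h3} ha hb hm => a b; set h := a +i* b; rewrite /cexp/= => ha hb hm.
have c1 : `|cos b| <= 1 by rewrite ler_norml cos_geN1 cos_le1.
set n := normc h in ha hb hm *.
set x := expR a; set c := cos b in c1 *; set s := sin b.
rewrite !(mul0r, oppr0, addr0, subr0, add0r) => T K3 K2 K1.
apply: (le_trans T).
have -> : x * c - 1 - a = (x - 1 - a) * c + (c - 1) + a * (c - 1) by ring.
have -> : x * s - b = (x - 1 - a) * (s - b) + (s - b) + a * (s - b) + (x - 1 - a) * b + a * b by ring.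
have n0 : 0 <= n by exact: normc_ge0.
have P1 : `|x - 1 - a| <= m * n by apply: (le_trans K1); rewrite ler_pM2l.
have P2 : `|c - 1| <= m * n by apply: (le_trans K2); rewrite ler_pM2l.
have P3 : `|s - b| <= m * n by apply: (le_trans K3); rewrite ler_pM2l.
have mn1 : m * n <= m by rewrite -[leRHS]mulr1 ler_pM2l// (le_trans (ltW hm)).
have mn0 : 0 <= m * n by rewrite mulr_ge0// ltW.
have mul (u v p q : R) : `|u| <= p -> `|v| <= q -> `|u * v| <= p * q.
  by move=> *; rewrite normrM ler_pM.
have am : `|a| <= m by apply: (le_trans ha); exact: ltW.
have Q1 := mul _ _ _ _ P1 c1.
have Q2 := mul _ _ _ _ am P2.
have Q3 := mul _ _ _ _ (le_trans P1 mn1) P3.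
have Q4 := mul _ _ _ _ am P3.
have Q5 := mul _ _ _ _ (le_trans P1 mn1) hb.
have Q6 := mul _ _ _ _ am hb.
have mmn : m * (m * n) <= m * n by rewrite ler_pM2l// -[leRHS]mul1r ler_wpM2r.
apply: (@le_trans _ _ (8 * (m * n))); last by rewrite mulrA ler_wpM2r.
rewrite -/h -/n in Q5 Q6.
have := ler_normD ((x - 1 - a) * c + (c - 1)) (a * (c - 1)).
have := ler_normD ((x - 1 - a) * c) (c - 1).
have := ler_normD ((x - 1 - a) * (s - b) + (s - b) + a * (s - b) + (x - 1 - a) * b) (a * b).
have := ler_normD ((x - 1 - a) * (s - b) + (s - b) + a * (s - b)) ((x - 1 - a) * b).
have := ler_normD ((x - 1 - a) * (s - b) + (s - b)) (a * (s - b)).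
have := ler_normD ((x - 1 - a) * (s - b)) (s - b).
move: Q5 Q6; rewrite -[Num.ExtraDef.sqrtr _]/n => Q5 Q6.
lra.
Qed.

(** The identity [cexp w = cexp z * cexp (w - z)] carries the derivative at 0 to any point. *)
Lemma cderiv_cexp z : cderiv cexp z (cexp z).
Proof.
have H : cderiv (fun w => cexp z * cexp (w - z)) z (0 * cexp (z - z) + cexp z * (1 * (1 + 0))).
  apply: (cderivM (cderiv_cst _ _)).
  apply: (@cderiv_comp cexp (fun w => w - z)).
    by rewrite subrr; exact: cderiv_cexp0.
  by apply: cderivD; [exact: cderiv_id|exact: cderiv_cst].
move: H; rewrite mul0r add0r addr0 !mulr1.
congr cderiv; apply/funext => w.
by rewrite -cexpD addrC subrK.
Qed.

End ComplexExponential.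

(** * Line integrals and Goursat's theorem *)

Section ComplexIntegration.
Context {d : measure_display} {T : measurableType d} {R : realType}.
Variables (mu : {measure set T -> \bar R}) (D : set T) (mD : measurable D).
Implicit Types (f g : T -> R[i]) (c : R[i]).

Lemma eq_cintegral f g : {in D, f =1 g} -> cintegral mu D f = cintegral mu D g.
Proof.
by move=> fg; rewrite /cintegral; congr (_ +i* _); apply: eq_Rintegral => x /fg ->.
Qed.

Lemma cintegrableD f g : cintegrable mu D f -> cintegrable mu D g ->
  cintegrable mu D (fun t => f t + g t).
Proof.
move=> [f1 f2] [g1 g2]; split.
- rewrite (_ : _ \o _ = ((EFin \o (fun t => complex.Re (f t))) \+
    (EFin \o (fun t => complex.Re (g t))))%E); first exact: integrableD.
  by apply/funext => t /=; case: (f t) (g t) => [? ?] [? ?].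
- rewrite (_ : _ \o _ = ((EFin \o (fun t => complex.Im (f t))) \+
    (EFin \o (fun t => complex.Im (g t))))%E); first exact: integrableD.
  by apply/funext => t /=; case: (f t) (g t) => [? ?] [? ?].
Qed.

Lemma cintegralD f g : cintegrable mu D f -> cintegrable mu D g ->
  cintegral mu D (fun t => f t + g t) = cintegral mu D f + cintegral mu D g.
Proof.
move=> [f1 f2] [g1 g2]; rewrite /cintegral.
apply/eqP; rewrite eq_complex/=; apply/andP; split; apply/eqP.
- by rewrite -RintegralD//; apply: eq_Rintegral => t _; case: (f t) (g t) => [? ?] [? ?].
- by rewrite -RintegralD//; apply: eq_Rintegral => t _; case: (f t) (g t) => [? ?] [? ?].
Qed.

Lemma integrable_lincomb (u v : T -> R) (a b : R) :
  mu.-integrable D (EFin \o u) -> mu.-integrable D (EFin \o v) ->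
  mu.-integrable D (EFin \o (fun t => a * u t + b * v t)).
Proof.
move=> iu iv.
rewrite (_ : _ \o _ = ((fun t => a%:E * (u t)%:E) \+ (fun t => b%:E * (v t)%:E))%E)//.
by apply: integrableD => //; apply: integrableZl.
Qed.

Lemma Rintegral_lincomb (u v : T -> R) (a b : R) :
  mu.-integrable D (EFin \o u) -> mu.-integrable D (EFin \o v) ->
  \int[mu]_(t in D) (a * u t + b * v t) =
  a * \int[mu]_(t in D) u t + b * \int[mu]_(t in D) v t.
Proof.
move=> iu iv; rewrite RintegralD//; last 2 first.
- by apply: (@integrableZl _ _ _ _ _ mD a (EFin \o u)).
- by apply: (@integrableZl _ _ _ _ _ mD b (EFin \o v)).
by rewrite !RintegralZl.
Qed.

Lemma cintegrableZ c f : cintegrable mu D f -> cintegrable mu D (fun t => c * f t).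
Proof.
case: c => a b [f1 f2]; split.
- rewrite (_ : _ \o _ = EFin \o (fun t => a * complex.Re (f t) + (- b) * complex.Im (f t))).
    exact: integrable_lincomb.
  by apply/funext => t /=; case: (f t) => x y /=; rewrite mulNr.
- rewrite (_ : _ \o _ = EFin \o (fun t => a * complex.Im (f t) + b * complex.Re (f t))).
    exact: integrable_lincomb.
  by apply/funext => t /=; case: (f t) => x y /=.
Qed.

Lemma cintegralZ c f : cintegrable mu D f ->
  cintegral mu D (fun t => c * f t) = c * cintegral mu D f.
Proof.
case: c => a b [f1 f2]; rewrite /cintegral.
apply/eqP; rewrite eq_complex/=; apply/andP; split; apply/eqP.
- rewrite -mulNr -Rintegral_lincomb//; apply: eq_Rintegral => t _.
  by case: (f t) => x y /=; rewrite mulNr.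
- rewrite -Rintegral_lincomb//; apply: eq_Rintegral => t _.
  by case: (f t) => x y /=.
Qed.

(** The factor 2 comes from bounding real and imaginary parts separately. It only enters
    multiplicative constants later on. *)
Lemma normc_cintegral_le f (k : T -> R) : cintegrable mu D f ->
  mu.-integrable D (EFin \o k) -> (forall t, D t -> normc (f t) <= k t) ->
  normc (cintegral mu D f) <= 2 * \int[mu]_(t in D) k t.
Proof.
move=> [f1 f2] ik fk; apply: (le_trans (ler_normc_ReIm _)).
rewrite mulrDl !mul1r /cintegral/=; apply: lerD.
- apply: (le_trans (le_normr_Rintegral _ f1)) => //; apply: le_Rintegral => //.
    exact: (integrable_abse f1).
  by move=> t Dt; apply: (le_trans (ler_normc_Re _)); exact: fk.
- apply: (le_trans (le_normr_Rintegral _ f2)) => //; apply: le_Rintegral => //.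
    exact: (integrable_abse f2).
  by move=> t Dt; apply: (le_trans (ler_normc_Im _)); exact: fk.
Qed.

End ComplexIntegration.

Section LineIntegrals.
Context {R : realType}.
Implicit Types (z w p v : R[i]) (f g : R[i] -> R[i]) (a b c : R).
Local Notation leb := (@lebesgue_measure R).

Definition ccont g z := forall e : R, 0 < e ->
  exists2 d : R, 0 < d & forall h, normc h < d -> normc (g (z + h) - g z) <= e.

Lemma ccont_continuous (g : R -> R[i]) (t : R) :
  (forall e : R, 0 < e -> exists2 d : R, 0 < d &
    forall h : R, `|h| < d -> normc (g (t + h) - g t) <= e) ->
  {for t, continuous (fun s : R => complex.Re (g s))} /\
  {for t, continuous (fun s : R => complex.Im (g s))}.
Proof.
move=> gt; split; apply/cvgrPdist_le => e /gt[d0 d00 H];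
  apply/nbhs_ballP; exists d0 => // s; rewrite /ball/= distrC => /H;
  rewrite (addrC t) subrK normcB => H'.
- apply: le_trans H'; apply: le_trans (ler_normc_Re _).
  by case: (g t) (g s) => [? ?] [? ?].
- apply: le_trans H'; apply: le_trans (ler_normc_Im _).
  by case: (g t) (g s) => [? ?] [? ?].
Qed.

Lemma ccont_line g p v t : ccont g (p + t%:C * v) -> forall e : R, 0 < e ->
  exists2 d : R, 0 < d & forall h : R, `|h| < d ->
    normc (g (p + (t + h)%:C * v) - g (p + t%:C * v)) <= e.
Proof.
move=> gc e /gc[d d0 H].
have v0 : 0 < 1 + normc v by rewrite ltr_wpDr ?normc_ge0.
exists (d / (1 + normc v)); first by rewrite divr_gt0.
move=> h hd; rewrite rmorphD mulrDl addrA; apply: H.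
rewrite Normc.normcM normc_real; move: hd; rewrite ltr_pdivlMr//; apply: le_lt_trans.
by rewrite ler_wpM2l// lerDr.
Qed.

Definition cline g p v : R -> R[i] := fun t => g (p + t%:C * v).

Lemma cintegrable_continuous (g : R -> R[i]) a b :
  continuous (fun s : R => complex.Re (g s)) -> continuous (fun s : R => complex.Im (g s)) ->
  cintegrable leb `[a, b] g.
Proof.
by move=> c1 c2; split; apply: continuous_compact_integrable;
  [exact: segment_compact|exact: continuous_subspaceT|exact: segment_compact|exact: continuous_subspaceT].
Qed.

Lemma cintegrable_cline g p v a b : (forall t : R, ccont g (p + t%:C * v)) ->
  cintegrable leb `[a, b] (cline g p v).
Proof.
move=> gc; apply: cintegrable_continuous => t.
  by have [] := @ccont_continuous (cline g p v) _ (ccont_line (gc t)).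
by have [] := @ccont_continuous (cline g p v) _ (ccont_line (gc t)).
Qed.

(** Integral along the path [t |-> p + t v]; the factor [v] is the velocity of the path. Keeping [p]
    and [v] fixed while [a] and [b] vary lets a path be cut by cutting a real interval. *)
Definition lint g p v a b : R[i] := v * cintegral leb `[a, b] (cline g p v).

Lemma Rintegral_split (u : R -> R) a b c : leb.-integrable `[a, c] (EFin \o u) ->
  a <= b -> b <= c ->
  \int[leb]_(t in `[a, c]) u t = \int[leb]_(t in `[a, b]) u t + \int[leb]_(t in `[b, c]) u t.
Proof.
move=> iu ab bc; apply/eqP; rewrite addrC -subr_eq; apply/eqP.
rewrite Rintegral_itvB// ?bnd_simp// Rintegral_itv_obnd_cbnd//.
apply: integrableS iu => //.
by apply: subset_itv => //; rewrite bnd_simp.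
Qed.

Lemma lint_split g p v a b c : (forall t : R, ccont g (p + t%:C * v)) ->
  a <= b -> b <= c -> lint g p v a c = lint g p v a b + lint g p v b c.
Proof.
move=> gc ab bc; rewrite /lint -mulrDr; congr (_ * _).
have [i1 i2] := cintegrable_cline a c gc.
rewrite /cintegral; apply/eqP; rewrite eq_complex/=; apply/andP; split; apply/eqP.
  exact: Rintegral_split.
exact: Rintegral_split.
Qed.

Lemma lintD f g p v a b : (forall t : R, ccont f (p + t%:C * v)) ->
  (forall t : R, ccont g (p + t%:C * v)) ->
  lint (fun w => f w + g w) p v a b = lint f p v a b + lint g p v a b.
Proof.
move=> fc gc; rewrite /lint -mulrDr; congr (_ * _).
by rewrite -cintegralD//; exact: cintegrable_cline.
Qed.

Lemma lintZ (k : R[i]) f p v a b : (forall t : R, ccont f (p + t%:C * v)) ->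
  lint (fun w => k * f w) p v a b = k * lint f p v a b.
Proof.
move=> fc; rewrite /lint mulrCA; congr (_ * _).
by rewrite -cintegralZ//; exact: cintegrable_cline.
Qed.

Lemma eq_lint f g p v a b :
  (forall t : R, a <= t <= b -> f (p + t%:C * v) = g (p + t%:C * v)) ->
  lint f p v a b = lint g p v a b.
Proof.
move=> fg; rewrite /lint; congr (_ * _); apply: eq_cintegral => t.
by rewrite inE/= in_itv/= => /fg.
Qed.

Lemma normc_lint_le g p v a b (M : R) : (forall t : R, ccont g (p + t%:C * v)) ->
  a <= b -> (forall t : R, a <= t <= b -> normc (g (p + t%:C * v)) <= M) ->
  normc (lint g p v a b) <= normc v * (2 * (M * (b - a))).
Proof.
move=> gc ab gM; rewrite /lint Normc.normcM ler_wpM2l ?normc_ge0//.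
apply: (le_trans (@normc_cintegral_le _ _ _ _ _ _ _ (fun=> M) _ _ _)) => //.
- exact: cintegrable_cline.
- by apply: continuous_compact_integrable;
   [exact: segment_compact|apply: continuous_subspaceT => ?; exact: cvg_cst].
rewrite Rintegral_cst//= lebesgue_measure_itv/= lte_fin.
by case: ltgtP ab => //= -> _; rewrite subrr.
Qed.

Lemma Rintegral_FTC (F f : R -> R) a b : (forall x : R, is_derive x (1 : R) F (f x)) ->
  continuous f -> a <= b -> \int[leb]_(t in `[a, b]) f t = F b - F a.
Proof.
move=> dF cf; rewrite le_eqVlt => /predU1P[->|ab].
  by rewrite subrr set_itv1 Rintegral_set1.
have cF x : {for x, continuous F}.
  by apply: differentiable_continuous; apply/derivable1_diffP; case: (dF x).
rewrite /Rintegral (continuous_FTC2 (F := F) ab) //=.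
- exact: continuous_subspaceT.
- split.
  + by move=> x _; case: (dF x).
  + by apply: cvg_at_right_filter; exact: cF.
  + by apply: cvg_at_left_filter; exact: cF.
- by move=> x _; rewrite derive1E; apply: derive_val.
Qed.

Lemma Rintegral_id a b : a <= b -> \int[leb]_(t in `[a, b]) t = (b ^+ 2 - a ^+ 2) / 2.
Proof.
have H (x : R) : is_derive x (1 : R) (fun t : R => t ^+ 2 / 2) x.
  by apply: is_derive_eq; rewrite /GRing.scale/=; field.
by move=> ab; rewrite (Rintegral_FTC H) ?mulrBl// => x; exact: cvg_id.
Qed.

Lemma lint_affine (k l : R[i]) p v a b : a <= b ->
  lint (fun w => k + l * w) p v a b =
  (k * (p + b%:C * v) + l / 2 * (p + b%:C * v) ^+ 2) -
  (k * (p + a%:C * v) + l / 2 * (p + a%:C * v) ^+ 2).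
Proof.
move=> ab; rewrite /lint.
have c0 (u : R[i]) : cintegrable leb `[a, b] (fun _ : R => u).
  by apply: cintegrable_continuous => x; exact: cvg_cst.
have c1 : cintegrable leb `[a, b] (fun t : R => t%:C).
  by apply: cintegrable_continuous => x; [exact: cvg_id|exact: cvg_cst].
rewrite (_ : cline _ _ _ = fun t => (k + l * p) * 1%:C + l * v * t%:C); last first.
  by apply/funext => t; rewrite /cline rmorph1; ring.
rewrite cintegralD//; last exact: cintegrableZ.
rewrite !cintegralZ// /cintegral/= Rintegral_id// !Rintegral_cst//=.
rewrite lebesgue_measure_itv/= lte_fin.
have -> : fine (if (a < b)%R then b%:E + (- a)%:E else 0)%E = b - a.
  by case: ltgtP ab => //= -> _; rewrite subrr.
rewrite mul1r mul0r !complexr0.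
rewrite rmorphM/= fmorphV/= !rmorphB/= !rmorphXn/= rmorph_nat.
by field.
Qed.

End LineIntegrals.

Section Goursat.
Context {R : realType}.
Implicit Types (z w p v : R[i]) (f g : R[i] -> R[i]) (a b c d : R).

Lemma cderiv_ccont g z D : cderiv g z D -> ccont g z.
Proof. by move=> gD e /(cderiv_dist gD). Qed.

(** Counterclockwise boundary integral of [[a, b] x [c, d]]. Each edge is parametrised by the
    coordinate that varies along it, so the common edge of two adjacent rectangles is literally the
    same [lint] and cancels. *)
Definition rect g a b c d : R[i] :=
  lint g ('i%C * c%:C) 1 a b + lint g b%:C 'i%C c d
  - lint g ('i%C * d%:C) 1 a b - lint g a%:C 'i%C c d.

Lemma rect_splitx g a m b c d : (forall w, ccont g w) -> a <= m -> m <= b ->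
  rect g a b c d = rect g a m c d + rect g m b c d.
Proof.
move=> gc am mb; rewrite /rect !(@lint_split _ _ _ _ a m b)//.
have E (A1 A2 B1 B2 Va Vm Vb : R[i]) :
  A1 + A2 + Vb - (B1 + B2) - Va = A1 + Vm - B1 - Va + (A2 + Vb - B2 - Vm) by ring.
exact: E.
Qed.

Lemma rect_splity g a b c m d : (forall w, ccont g w) -> c <= m -> m <= d ->
  rect g a b c d = rect g a b c m + rect g a b m d.
Proof.
move=> gc cm md; rewrite /rect !(@lint_split _ _ _ _ c m d)//.
have E (A1 A2 B1 B2 Hc Hm Hd : R[i]) :
  Hc + (B1 + B2) - Hd - (A1 + A2) = Hc + B1 - Hm - A1 + (Hm + B2 - Hd - A2) by ring.
exact: E.
Qed.

Lemma rectD f g a b c d : (forall w, ccont f w) -> (forall w, ccont g w) ->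
  rect (fun w => f w + g w) a b c d = rect f a b c d + rect g a b c d.
Proof.
move=> fc gc; rewrite /rect !lintD//.
have E (x1 x2 x3 x4 y1 y2 y3 y4 : R[i]) :
  x1 + y1 + (x2 + y2) - (x3 + y3) - (x4 + y4) = x1 + x2 - x3 - x4 + (y1 + y2 - y3 - y4).
  by ring.
exact: E.
Qed.

(** The primitive [k w + l w^2 / 2] telescopes around the four corners. *)
Lemma rect_affine (k l : R[i]) a b c d : a <= b -> c <= d ->
  rect (fun w => k + l * w) a b c d = 0.
Proof.
move=> ab cd; rewrite /rect !lint_affine//.
by move: (a%:C) (b%:C) (c%:C) (d%:C) => *; field.
Qed.

Lemma normc_rect_le g a b c d (M : R) : (forall w, ccont g w) -> a <= b -> c <= d ->
  (forall x y : R, a <= x <= b -> c <= y <= d -> normc (g (x +i* y)) <= M) ->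
  normc (rect g a b c d) <= 4 * (M * ((b - a) + (d - c))).
Proof.
move=> gc ab cd gM.
have xy (x y : R) : x%:C + y%:C * 'i%C = x +i* y.
  by apply/eqP; rewrite eq_complex/=; apply/andP; split; apply/eqP; ring.
have yx (x y : R) : 'i%C * y%:C + x%:C * 1 = x +i* y.
  by rewrite mulr1 addrC mulrC xy.
have N1 (y : R) : c <= y <= d -> normc (lint g ('i%C * y%:C) 1 a b) <= 2 * (M * (b - a)).
  move=> ycd; have := @normc_lint_le _ g ('i%C * y%:C) 1 a b M (fun=> gc _) ab.
  rewrite (_ : normc 1 = 1) ?mul1r; last exact: Normc.normc1.
  by apply=> t tab; rewrite yx; apply: gM.
have N2 (x : R) : a <= x <= b -> normc (lint g x%:C 'i%C c d) <= 2 * (M * (d - c)).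
  move=> xab; have := @normc_lint_le _ g x%:C 'i%C c d M (fun=> gc _) cd.
  rewrite normc_i mul1r.
  by apply=> t tcd; rewrite xy; apply: gM.
rewrite /rect; apply: (le_trans (ler_normcB _ _)).
have H1 : normc (lint g a%:C 'i%C c d) <= 2 * (M * (d - c)) by apply: N2; rewrite lexx.
have H2 : normc (lint g b%:C 'i%C c d) <= 2 * (M * (d - c)) by apply: N2; rewrite lexx ab.
have H3 : normc (lint g ('i%C * c%:C) 1 a b) <= 2 * (M * (b - a)) by apply: N1; rewrite lexx.
have H4 : normc (lint g ('i%C * d%:C) 1 a b) <= 2 * (M * (b - a)) by apply: N1; rewrite lexx cd.
have H5 := ler_normcB (lint g ('i%C * c%:C) 1 a b + lint g b%:C 'i%C c d) (lint g ('i%C * d%:C) 1 a b).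
have H6 := le_normcD (lint g ('i%C * c%:C) 1 a b) (lint g b%:C 'i%C c d).
lra.
Qed.

(** In each coordinate the lower corners increase and the upper ends [u n + r / 2^n] decrease, so
    the supremum of the lower corners lies in every interval. [B] depends on [n] so that it can
    carry a bound that shrinks with the generation. *)
Lemma nested_bisection (B : nat -> R -> R -> Prop) (w h x0 y0 : R) :
  0 <= w -> 0 <= h -> B 0%N x0 y0 ->
  (forall n x y, B n x y -> exists x' y' : R,
    [/\ B n.+1 x' y', x' = x \/ x' = x + w / 2 ^+ n.+1 &
        y' = y \/ y' = y + h / 2 ^+ n.+1]) ->
  exists px py : R, forall n, exists x y : R,
    [/\ B n x y, x <= px <= x + w / 2 ^+ n & y <= py <= y + h / 2 ^+ n].
Proof.
move=> w0 h0 B0 Bstep.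
(* Packing generation, corner and proof of [B] together lets the choice of a successor be
   iterated. *)
pose T := {q : nat * (R * R) | B q.1 q.2.1 q.2.2}.
have next (q : T) : exists q' : T, [/\ (sval q').1 = (sval q).1.+1,
    (sval q').2.1 = (sval q).2.1 \/ (sval q').2.1 = (sval q).2.1 + w / 2 ^+ (sval q).1.+1 &
    (sval q').2.2 = (sval q).2.2 \/ (sval q').2.2 = (sval q).2.2 + h / 2 ^+ (sval q).1.+1].
  case: q => [[n [x y]] /= Bq]; have [x' [y' [B' xx yy]]] := Bstep _ _ _ Bq.
  by exists (exist _ (n.+1, (x', y')) B').
have [F HF] := choice next.
pose s n : T := iter n F (exist _ (0%N, (x0, y0)) B0).
have s1 n : (sval (s n)).1 = n.
  by elim: n => //= n IH; have [-> _ _] := HF (s n); rewrite IH.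
have half (r : R) n : r / 2 ^+ n = r / 2 ^+ n.+1 + r / 2 ^+ n.+1.
  by rewrite exprS; field; rewrite expf_neq0.
have mono (r : R) (u : nat -> R) : 0 <= r ->
    (forall n, u n.+1 = u n \/ u n.+1 = u n + r / 2 ^+ n.+1) ->
    exists l, forall n, u n <= l <= u n + r / 2 ^+ n.
  move=> r0 us.
  have rn n : 0 <= r / 2 ^+ n by rewrite divr_ge0// exprn_ge0.
  have um m k : u m <= u (k + m)%N /\ u (k + m)%N + r / 2 ^+ (k + m) <= u m + r / 2 ^+ m.
    elim: k => [//|k [IH1 IH2]]; rewrite addSn.
    have := half r (k + m)%N; have := rn (k + m).+1.
    by have [->|->] := us (k + m)%N; lra.
  have ub m n : u n <= u m + r / 2 ^+ m.
    have [mn|/ltnW nm] := leqP m n.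
      by have [_] := um m (n - m)%N; rewrite subnK//; have := rn n; lra.
    have [+ _] := um n (m - n)%N; rewrite subnK// => /le_trans; apply.
    by rewrite lerDl.
  have hs : has_sup (range u).
    split; first by exists (u 0%N); exists 0%N.
    by exists (u 0%N + r / 2 ^+ 0) => _ [n _ <-].
  exists (sup (range u)) => n; apply/andP; split.
    by apply: ub_le_sup; [case: hs|exists n].
  by apply: ge_sup => [|_ [k _ <-]]; [case: hs|].
have sx n : (sval (s n.+1)).2.1 = (sval (s n)).2.1 \/
    (sval (s n.+1)).2.1 = (sval (s n)).2.1 + w / 2 ^+ n.+1.
  by have [_ + _] := HF (s n); rewrite s1.
have sy n : (sval (s n.+1)).2.2 = (sval (s n)).2.2 \/
    (sval (s n.+1)).2.2 = (sval (s n)).2.2 + h / 2 ^+ n.+1.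
  by have [_ _ +] := HF (s n); rewrite s1.
have [px Hx] := mono w (fun n => (sval (s n)).2.1) w0 sx.
have [py Hy] := mono h (fun n => (sval (s n)).2.2) h0 sy.
exists px, py => n; exists (sval (s n)).2.1, (sval (s n)).2.2; split => //.
by have := svalP (s n); rewrite s1.
Qed.

(** If the integral had modulus [eta > 0], some quarter would keep at least [eta / 4], and so on
    down to a point [p]. Near [p], subtracting the tangent affine function changes no integral and
    leaves a remainder of at most [e] times the side sum; times the perimeter this is of order
    [e L^2 / 4^n], too small when [e] is small. *)
Lemma Goursat g a b c d : (forall w, ccont g w) -> a <= b -> c <= d ->
  (forall x y : R, a <= x <= b -> c <= y <= d -> exists D, cderiv g (x +i* y) D) ->
  rect g a b c d = 0.
Proof.
move=> gc ab cd gD; apply/eqP; rewrite -normc_eq0; apply/negPn/negP => /negP r0.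
pose eta := normc (rect g a b c d).
have eta0 : 0 < eta by rewrite lt_def normc_ge0 andbT; apply/negP.
pose w := b - a; pose h := d - c.
have w0 : 0 <= w by rewrite subr_ge0.
have h0 : 0 <= h by rewrite subr_ge0.
pose Q n (x y : R) := rect g x (x + w / 2 ^+ n) y (y + h / 2 ^+ n).
pose B n (x y : R) := [/\ eta / 4 ^+ n <= normc (Q n x y),
  a <= x, x + w / 2 ^+ n <= b, c <= y & y + h / 2 ^+ n <= d].
have half (r : R) n : r / 2 ^+ n = r / 2 ^+ n.+1 + r / 2 ^+ n.+1.
  by rewrite exprS; field; rewrite expf_neq0.
have [px [py P]] : exists px py : R, forall n, exists x y : R,
    [/\ B n x y, x <= px <= x + w / 2 ^+ n & y <= py <= y + h / 2 ^+ n].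
  apply: (@nested_bisection _ _ _ a c w0 h0).
    rewrite /B /Q !expr0 !divr1 /w /h !(addrC _ (_ - _)) !subrK.
    by rewrite lexx.
  move=> n x y [Bn ax xb cy yd].
  set w' := w / 2 ^+ n.+1; set h' := h / 2 ^+ n.+1.
  have w'0 : 0 <= w' by rewrite divr_ge0// exprn_ge0.
  have h'0 : 0 <= h' by rewrite divr_ge0// exprn_ge0.
  move: Bn xb yd; rewrite /Q (half w) (half h) -/w' -/h' !addrA => Bn xb yd.
  rewrite (@rect_splitx _ _ (x + w')) ?lerDl// in Bn.
  rewrite (@rect_splity _ x _ y (y + h')) ?lerDl// in Bn.
  rewrite (@rect_splity _ (x + w') _ y (y + h')) ?lerDl// in Bn.
  have e4 : eta / 4 ^+ n = 4 * (eta / 4 ^+ n.+1).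
    by rewrite exprS; field; rewrite expf_neq0.
  rewrite e4 in Bn.
  have [H|H1] := leP (eta / 4 ^+ n.+1) (normc (Q n.+1 x y)).
    exists x, y; split; [|by left|by left].
    by split => //; rewrite -?/w' -?/h'; lra.
  have [H|H2] := leP (eta / 4 ^+ n.+1) (normc (Q n.+1 x (y + h'))).
    exists x, (y + h'); split; [|by left|by right].
    by split => //; rewrite -?/w' -?/h'; lra.
  have [H|H3] := leP (eta / 4 ^+ n.+1) (normc (Q n.+1 (x + w') y)).
    exists (x + w'), y; split; [|by right|by left].
    by split => //; rewrite -?/w' -?/h'; lra.
  have [H|H4] := leP (eta / 4 ^+ n.+1) (normc (Q n.+1 (x + w') (y + h'))).
    exists (x + w'), (y + h'); split; [|by right|by right].
    by split => //; rewrite -?/w' -?/h'; lra.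
  exfalso; move: Bn; apply/negP; rewrite -ltNge.
  move: H1 H2 H3 H4; rewrite /Q -/w' -/h'.
  set q1 := rect _ _ _ _ _; set q2 := rect _ _ _ _ _; set q3 := rect _ _ _ _ _; set q4 := rect _ _ _ _ _.
  move=> H1 H2 H3 H4.
  have := le_normcD (q1 + q2) (q3 + q4); have := le_normcD q1 q2; have := le_normcD q3 q4.
  lra.
pose L := w + h; have L0 : 0 <= L by rewrite addr_ge0.
(* The final comparison is [4 e L^2 < eta]; the [+ 1] keeps [e] defined and the inequality strict
   for a degenerate rectangle with [L = 0]. *)
pose e := eta / (8 * (L ^+ 2 + 1)).
have L21 : 0 < L ^+ 2 + 1 by rewrite ltr_wpDl ?sqr_ge0.
have e0 : 0 < e by rewrite divr_gt0// mulr_gt0.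
have [D gDp] : exists D, cderiv g (px +i* py) D.
  have [x [y [[_ ax xb cy yd] /andP[x1 x2] /andP[y1 y2]]]] := P 0%N.
  by apply: gD; apply/andP; split; lra.
have [dl dl0 H] := gDp _ e0.
have [n nL] : exists n, L / 2 ^+ n < dl.
  exists (Num.truncn (L / dl)).+1.
  rewrite ltr_pdivrMr ?exprn_gt0// mulrC -ltr_pdivrMr//.
  by apply: (lt_le_trans (truncnS_gt _)); rewrite -natrX ler_nat ltnW// ltn_expl.
have [x [y [[Bn ax xb cy yd] /andP[x1 x2] /andP[y1 y2]]]] := P n.
set w' := w / 2 ^+ n in x2 xb; set h' := h / 2 ^+ n in y2 yd.
have w'0 : 0 <= w' by rewrite divr_ge0// exprn_ge0.
have h'0 : 0 <= h' by rewrite divr_ge0// exprn_ge0.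
have Lwh : L / 2 ^+ n = w' + h' by rewrite mulrDl.
set p := px +i* py in gDp H.
(* This is [g u - g p - D (u - p)], arranged as [g] plus an affine function so that [rectD] and
   [rect_affine] apply. *)
pose r u := g u + ((D * p - g p) + (- D) * u).
have Qr : Q n x y = rect r x (x + w') y (y + h').
  rewrite rectD//; last first.
    move=> u; apply: (@cderiv_ccont _ _ (0 + (0 * u + - D * 1))).
    by apply: cderivD; [exact: cderiv_cst|apply: cderivM; [exact: cderiv_cst|exact: cderiv_id]].
  by rewrite rect_affine ?addr0// lerDl.
have rc u : ccont r u.
  move=> e1 e10; have [d1 d10 H1] := gc u (e1 / 2) ltac:(by rewrite divr_gt0).
  have e2 : 0 < e1 / 2 / (1 + normc D) by rewrite !divr_gt0// ltr_wpDr ?normc_ge0.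
  exists (Num.min d1 (e1 / 2 / (1 + normc D))); first by rewrite lt_min d10.
  move=> k; rewrite lt_min => /andP[/H1 {}H1 k2].
  rewrite (_ : _ - _ = (g (u + k) - g u) - D * k); last by rewrite /r; ring.
  apply: (le_trans (ler_normcB _ _)); rewrite Normc.normcM.
  move: k2; rewrite ltr_pdivlMr ?ltr_wpDr ?normc_ge0//.
  have := normc_ge0 k; have := normc_ge0 D; nra.
have rM (X Y : R) : x <= X <= x + w' -> y <= Y <= y + h' ->
    normc (r (X +i* Y)) <= e * (w' + h').
  move=> /andP[X1 X2] /andP[Y1 Y2]; set u := X +i* Y.
  have un : normc (u - p) <= w' + h'.
    apply: (le_trans (ler_normc_ReIm _)); apply: lerD => /=; rewrite ler_norml; apply/andP; split; lra.
  have := H (u - p); rewrite (le_lt_trans un) -?Lwh// => /(_ isT).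
  rewrite (_ : g (p + (u - p)) - g p - D * (u - p) = r u); last first.
    by rewrite (addrC p) subrK /r; ring.
  by move=> /le_trans; apply; rewrite ler_pM2l// Lwh.
have := normc_rect_le rc _ _ rM; rewrite !lerDl => /(_ w'0 h'0).
rewrite -Qr => /(le_trans Bn); apply/negP; rewrite -ltNge.
have -> : x + w' - x + (y + h' - y) = L / 2 ^+ n by rewrite Lwh; ring.
have q0 : 0 < (2 : R) ^+ n by rewrite exprn_gt0.
have -> : (4 : R) ^+ n = 2 ^+ n * 2 ^+ n by rewrite -exprMn; congr (_ ^+ n); ring.
rewrite -Lwh (_ : 4 * _ = 4 * e * L ^+ 2 / (2 ^+ n * 2 ^+ n)); last first.
  by field; rewrite gt_eqF.
rewrite ltr_pM2r ?invr_gt0 ?mulr_gt0//.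
have -> : eta = 8 * (e * L ^+ 2) + 8 * e by rewrite /e; field; rewrite gt_eqF.
have : 0 <= e * L ^+ 2 by rewrite mulr_ge0 ?sqr_ge0// ltW.
lra.
Qed.
End Goursat.

(** * Entire functions are locally Lipschitz *)

Section LocalLipschitz.
Context {R : realType}.
Implicit Types (z w p v : R[i]) (f g : R[i] -> R[i]) (a b c d : R).

Lemma cderiv_local f g z D (d0 : R) : 0 < d0 ->
  (forall h, normc h < d0 -> f (z + h) = g (z + h)) -> cderiv f z D -> cderiv g z D.
Proof.
move=> d00 fg fD e /fD[d1 d10 H]; exists (Num.min d0 d1); first by rewrite lt_min d00.
move=> h; rewrite lt_min => /andP[h0 /H]; rewrite fg// -[X in f X]addr0 fg ?addr0//.
by rewrite Normc.normc0.
Qed.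

Lemma cderiv_kernel z w : w != z -> cderiv (fun w => (w - z)^-1) w (- (1 + 0) / (w - z) ^+ 2).
Proof.
move=> wz; apply: cderivV; first by rewrite subr_eq0.
by apply: cderivD; [exact: cderiv_id|exact: cderiv_cst].
Qed.

(** The value [D] fills the removable singularity, which makes the function continuous everywhere,
    as the splitting lemmas and [Goursat] ask. *)
Definition diffquot f z (D : R[i]) w := if w == z then D else (f w - f z) / (w - z).

Lemma cderiv_diffquot f z D w D' : w != z -> cderiv f w D' ->
  exists E, cderiv (diffquot f z D) w E.
Proof.
move=> wz fD'; eexists.
apply: (@cderiv_local (fun u => (f u + - f z) * (u - z)^-1) _ _ _ (normc (w - z))).
- by rewrite normc_gt0 subr_eq0.
- move=> h hw; rewrite /diffquot; case: eqP => // wh.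
  by move: hw; rewrite -wh opprD addrA subrr sub0r normcN ltxx.
- by apply: cderivM; [apply: cderivD; [exact: fD'|exact: cderiv_cst]|exact: cderiv_kernel].
Qed.

Lemma ccont_diffquot f z D : cderiv f z D -> (forall w, exists D', cderiv f w D') ->
  forall w, ccont (diffquot f z D) w.
Proof.
move=> fz fD w; have [->|wz] := eqVneq w z; last first.
  by have [D' /(cderiv_diffquot D wz)[E /cderiv_ccont]] := fD w.
move=> e e0; have [d0 d00 H] := fz _ e0; exists d0 => // h /H.
rewrite /diffquot eqxx; have [->|h0] := eqVneq h 0.
  by move=> _; rewrite addr0 eqxx subrr Normc.normc0 ltW.
rewrite -subr_eq0 (addrC z) addrK (negbTE h0).
rewrite (_ : f (h + z) - f z - D * h = ((f (h + z) - f z) / h - D) * h); last by field.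
by rewrite Normc.normcM ler_pM2r ?normc_gt0.
Qed.

(* Goursat's theorem disposes of everything outside a small square around [z], on
   which the difference quotient is bounded. *)
Lemma rect_diffquot f (zx zy r : R) D : let z := zx +i* zy in
  cderiv f z D -> (forall w, exists D', cderiv f w D') ->
  - r < zx < r -> - r < zy < r -> rect (diffquot f z D) (- r) r (- r) r = 0.
Proof.
move=> z fz fD /andP[x1 x2] /andP[y1 y2].
have gc := ccont_diffquot fz fD.
set g := diffquot f z D in gc *.
have gD x y : (x != zx) || (y != zy) -> exists E, cderiv g (x +i* y) E.
  move=> xy; have [D' fD'] := fD (x +i* y); apply: cderiv_diffquot fD'.
  by rewrite eq_complex /= negb_and.
have [d1 d10 H1] := gc z 1 ltr01.
pose M := normc D + 1.
have M0 : 0 < M by rewrite ltr_wpDl ?normc_ge0.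
have gM w : normc (w - z) < d1 -> normc (g w) <= M.
  move=> /H1; rewrite (addrC z) subrK {2}/g /diffquot eqxx => H.
  by apply: (le_trans (ler_normc_sub _ D)); rewrite addrC lerD2l.
have small (dl : R) : 0 < dl -> dl < r - zx -> dl < zx + r -> dl < r - zy -> dl < zy + r ->
    dl + dl < d1 -> normc (rect g (- r) r (- r) r) <= 16 * M * dl.
  move=> dl0 l1 l2 l3 l4 l5.
  rewrite (@rect_splitx _ _ _ (zx - dl)) //; [|lra..].
  rewrite (@rect_splitx _ _ (zx - dl) (zx + dl)) //; [|lra..].
  rewrite (@rect_splity _ _ (zx - dl) _ _ (zy - dl)) //; [|lra..].
  rewrite (@rect_splity _ _ (zx - dl) _ (zy - dl) (zy + dl)) //; [|lra..].
  rewrite (Goursat gc (a := - r) (b := zx - dl)); [|lra|lra|]; last first.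
    by move=> x y /andP[? ?] _; apply: gD; apply/orP; left; rewrite lt_eqF//; lra.
  rewrite (Goursat gc (a := zx + dl) (b := r)); [|lra|lra|]; last first.
    by move=> x y /andP[? ?] _; apply: gD; apply/orP; left; rewrite gt_eqF//; lra.
  rewrite (Goursat gc (c := - r) (d := zy - dl)); [|lra|lra|]; last first.
    by move=> x y _ /andP[? ?]; apply: gD; apply/orP; right; rewrite lt_eqF//; lra.
  rewrite (Goursat gc (c := zy + dl) (d := r)); [|lra|lra|]; last first.
    by move=> x y _ /andP[? ?]; apply: gD; apply/orP; right; rewrite gt_eqF//; lra.
  rewrite !add0r !addr0.
  have H x y : zx - dl <= x <= zx + dl -> zy - dl <= y <= zy + dl -> normc (g (x +i* y)) <= M.
    move=> /andP[? ?] /andP[? ?]; apply: gM; apply: le_lt_trans l5.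
    apply: (le_trans (ler_normc_ReIm _)); rewrite /= lerD//= ler_norml; apply/andP; split; lra.
  have := normc_rect_le gc _ _ H; have -> : zx - dl <= zx + dl by lra.
  have -> : zy - dl <= zy + dl by lra.
  move=> /(_ isT isT) /le_trans; apply; rewrite le_eqVlt; apply/orP; left; apply/eqP; ring.
apply/eqP; rewrite -normc_eq0; apply/eqP/le_anti; rewrite normc_ge0 andbT.
apply/ler_addgt0Pl => e e0; rewrite addr0.
pose m := Num.min (Num.min (Num.min (r - zx) (zx + r)) (Num.min (r - zy) (zy + r)))
   (Num.min (d1 / 2) (e / (16 * M))).
have m0 : 0 < m by rewrite !lt_min !divr_gt0 ?mulr_gt0//; lra.
have : m <= m by [].
rewrite {2}/m !le_min => /andP[/andP[/andP[m1 m2] /andP[m3 m4]] /andP[m5 m6]].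
have := @small (m / 2) ltac:(lra) ltac:(lra) ltac:(lra) ltac:(lra) ltac:(lra) ltac:(lra).
move=> /le_trans; apply.
have : 16 * M * m <= e by rewrite mulrC -ler_pdivlMr ?mulr_gt0.
have : 0 <= 16 * M * m by rewrite !mulr_ge0 ?ltW//.
lra.
Qed.

Definition kernel f z w := f w * (w - z)^-1.

Lemma ccont_kernel f z w : (forall w, exists D', cderiv f w D') -> w != z ->
  ccont (kernel f z) w.
Proof.
move=> fD wz; have [D' fD'] := fD w.
exact: (cderiv_ccont (cderivM fD' (cderiv_kernel wz))).
Qed.

Lemma lint_diffquot f z D p v a b : (forall w, exists D', cderiv f w D') ->
  (forall t : R, p + t%:C * v != z) ->
  lint (diffquot f z D) p v a b =
  lint (kernel f z) p v a b - f z * lint (kernel (fun=> 1) z) p v a b.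
Proof.
move=> fD pz; rewrite -mulNr -lintZ; last first.
  by move=> t; apply: ccont_kernel => // w; exists 0; exact: cderiv_cst.
rewrite -lintD.
- by apply: eq_lint => t _; rewrite /diffquot (negbTE (pz t)) /kernel mul1r mulrBl mulNr.
- by move=> t; exact: ccont_kernel.
- move=> t; apply: (@cderiv_ccont _ _ _ (0 * kernel (fun=> 1) z (p + t%:C * v) + - f z *
     (0 * (p + t%:C * v - z)^-1 + 1 * (- (1 + 0) / (p + t%:C * v - z) ^+ 2)))).
  apply: cderivM; first exact: cderiv_cst.
  by apply: cderivM; [exact: cderiv_cst|exact: cderiv_kernel].
Qed.

Lemma edgeE (x y : R) : x%:C + y%:C * 'i%C = x +i* y.
Proof. by apply/eqP; rewrite eq_complex/=; apply/andP; split; apply/eqP; ring. Qed.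

Lemma edge1E (x y : R) : 'i%C * y%:C + x%:C * 1 = x +i* y.
Proof. by rewrite mulr1 addrC mulrC edgeE. Qed.

Lemma edge_neq (x y zx zy : R) : (x != zx) || (y != zy) -> x +i* y != zx +i* zy.
Proof. by rewrite eq_complex /= negb_and. Qed.

(** Cauchy's formula with the factor [2 pi i] left as the unevaluated integral of [1 / (w - z)]. Of
    this integral only a lower bound and a Lipschitz bound in [z] are used, so no winding number is
    computed. *)
Lemma cauchy_square f (zx zy r : R) : let z := zx +i* zy in
  (forall w, exists D', cderiv f w D') ->
  - r < zx < r -> - r < zy < r ->
  rect (kernel f z) (- r) r (- r) r = f z * rect (kernel (fun=> 1) z) (- r) r (- r) r.
Proof.
move=> z fD zxr zyr; have [D fz] := fD z.
have := rect_diffquot fz fD zxr zyr; rewrite -/z.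
move: zxr zyr => /andP[x1 x2] /andP[y1 y2].
rewrite /rect !lint_diffquot//.
- move=> H; apply/eqP; rewrite -subr_eq0 -H; apply/eqP.
  have E (p1 p2 p3 p4 q1 q2 q3 q4 k : R[i]) : p1 + p2 - p3 - p4 - k * (q1 + q2 - q3 - q4) =
    p1 - k * q1 + (p2 - k * q2) - (p3 - k * q3) - (p4 - k * q4) by ring.
  exact: E.
- by move=> t; rewrite edgeE edge_neq// lt_eqF.
- by move=> t; rewrite edge1E edge_neq// (gt_eqF y2) orbT.
- by move=> t; rewrite edgeE edge_neq// gt_eqF.
- by move=> t; rewrite edge1E edge_neq// (lt_eqF y1) orbT.
Qed.

End LocalLipschitz.

(** * Dependence of the Cauchy integrals on the pole *)

Section KernelEstimates.
Context {R : realType}.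
Implicit Types (z w p v : R[i]) (f g : R[i] -> R[i]) (a b c d : R).

Lemma normc_kernelB f z z' w (r M : R) : 0 < r -> normc (f w) <= M ->
  r / 2 <= normc (w - z) -> r / 2 <= normc (w - z') ->
  normc (kernel f z w - kernel f z' w) <= 4 * M / r ^+ 2 * normc (z - z').
Proof.
move=> r0 fM wz wz'.
have r20 : 0 < r / 2 by rewrite divr_gt0.
have n0 := lt_le_trans r20 wz; have n0' := lt_le_trans r20 wz'.
have wz0 : w - z != 0 by rewrite -normc_gt0.
have wz0' : w - z' != 0 by rewrite -normc_gt0.
rewrite (_ : _ - _ = f w * (z - z') * ((w - z)^-1 * (w - z')^-1)); last first.
  by rewrite /kernel; field; rewrite wz0 wz0'.
rewrite (Normc.normcM (_ * (z - z'))) (Normc.normcM (f w)) (Normc.normcM _^-1) !Normc.normcV.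
rewrite (_ : 4 * M / r ^+ 2 * normc (z - z') = M * normc (z - z') * ((r / 2)^-1 * (r / 2)^-1)); last first.
  by field; rewrite gt_eqF.
apply: ler_pM; rewrite ?mulr_ge0 ?invr_ge0 ?normc_ge0//.
  by rewrite ler_wpM2r ?normc_ge0.
by apply: ler_pM; rewrite ?invr_ge0 ?normc_ge0// lef_pV2.
Qed.

Lemma normc_lint_kernelB f z z' p v (r M : R) : 0 < r -> normc v = 1 ->
  (forall w, exists D', cderiv f w D') ->
  (forall t : R, - r <= t <= r -> normc (f (p + t%:C * v)) <= M) ->
  (forall t : R, r / 2 <= normc (p + t%:C * v - z)) ->
  (forall t : R, r / 2 <= normc (p + t%:C * v - z')) ->
  normc (lint (kernel f z) p v (- r) r - lint (kernel f z') p v (- r) r) <=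
  16 * M / r * normc (z - z').
Proof.
move=> r0 v1 fD fM pz pz'.
have r20 : 0 < r / 2 by rewrite divr_gt0.
have kc (u : R[i]) : (forall t : R, r / 2 <= normc (p + t%:C * v - u)) ->
    forall t : R, ccont (kernel f u) (p + t%:C * v).
  move=> pu t; apply: ccont_kernel => //.
  by rewrite -subr_eq0 -normc_gt0 (lt_le_trans r20).
have kcN t : ccont (fun w => -1 * kernel f z' w) (p + t%:C * v).
  have [D' fD'] := fD (p + t%:C * v).
  have pw : p + t%:C * v != z' by rewrite -subr_eq0 -normc_gt0 (lt_le_trans r20).
  exact: (cderiv_ccont (cderivM (cderiv_cst (-1) _) (cderivM fD' (cderiv_kernel pw)))).
rewrite -(mulN1r (lint _ _ _ _ _)) -lintZ; last exact: kc.
rewrite -lintD//; last exact: kc.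
apply: (le_trans (@normc_lint_le _ _ _ _ _ _ (4 * M / r ^+ 2 * normc (z - z')) _ _ _)).
- move=> t e e0; have [d1 d10 H1] := kc z pz t (e / 2) ltac:(lra).
  have [d2 d20 H2] := kcN t (e / 2) ltac:(lra).
  exists (Num.min d1 d2); first by rewrite lt_min d10.
  move=> h; rewrite lt_min => /andP[/H1 {}H1 /H2 {}H2].
  rewrite opprD addrACA; apply: (le_trans (le_normcD _ _)); lra.
- lra.
- by move=> t tr; rewrite mulN1r; apply: normc_kernelB => //; exact: fM.
rewrite v1 mul1r le_eqVlt; apply/orP; left; apply/eqP; field.
by rewrite gt_eqF.
Qed.

(** Poles in the square of half the size stay at distance at least [r / 2] from the lines carrying
    the edges, so the difference of kernels [(z - z') / ((w - z) (w - z'))] is controlled; each of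
    the four edges costs [16 M / r]. *)
Lemma rect_kernelB f (zx zy zx' zy' r M : R) :
  let z := zx +i* zy in let z' := zx' +i* zy' in
  0 < r -> (forall w, exists D', cderiv f w D') ->
  (forall x y : R, - r <= x <= r -> - r <= y <= r -> normc (f (x +i* y)) <= M) ->
  `|zx| <= r / 2 -> `|zy| <= r / 2 -> `|zx'| <= r / 2 -> `|zy'| <= r / 2 ->
  normc (rect (kernel f z) (- r) r (- r) r - rect (kernel f z') (- r) r (- r) r) <=
  64 * M / r * normc (z - z').
Proof.
move=> z z' r0 fD fM; rewrite !ler_norml => /andP[? ?] /andP[? ?] /andP[? ?] /andP[? ?].
have rr : - r <= r by lra.
have far (x y ux uy : R) : r / 2 <= `|x - ux| \/ r / 2 <= `|y - uy| ->
    r / 2 <= normc (x +i* y - (ux +i* uy)).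
  by case=> /le_trans; apply; [apply: le_trans (ler_normc_Re _)|apply: le_trans (ler_normc_Im _)].
have E1 : normc (lint (kernel f z) ('i%C * (- r)%:C) 1 (- r) r -
    lint (kernel f z') ('i%C * (- r)%:C) 1 (- r) r) <= 16 * M / r * normc (z - z').
  apply: normc_lint_kernelB => //; first exact: Normc.normc1.
  - by move=> t tr; rewrite edge1E fM// lexx rr.
  - by move=> t; rewrite edge1E; apply: far; right; rewrite ler_normr; apply/orP; right; lra.
  - by move=> t; rewrite edge1E; apply: far; right; rewrite ler_normr; apply/orP; right; lra.
have E2 : normc (lint (kernel f z) r%:C 'i%C (- r) r -
    lint (kernel f z') r%:C 'i%C (- r) r) <= 16 * M / r * normc (z - z').
  apply: normc_lint_kernelB => //; first exact: normc_i.
  - by move=> t tr; rewrite edgeE fM// lexx rr.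
  - by move=> t; rewrite edgeE; apply: far; left; rewrite ler_normr; apply/orP; left; lra.
  - by move=> t; rewrite edgeE; apply: far; left; rewrite ler_normr; apply/orP; left; lra.
have E3 : normc (lint (kernel f z) ('i%C * r%:C) 1 (- r) r -
    lint (kernel f z') ('i%C * r%:C) 1 (- r) r) <= 16 * M / r * normc (z - z').
  apply: normc_lint_kernelB => //; first exact: Normc.normc1.
  - by move=> t tr; rewrite edge1E fM// lexx rr.
  - by move=> t; rewrite edge1E; apply: far; right; rewrite ler_normr; apply/orP; left; lra.
  - by move=> t; rewrite edge1E; apply: far; right; rewrite ler_normr; apply/orP; left; lra.
have E4 : normc (lint (kernel f z) (- r)%:C 'i%C (- r) r -
    lint (kernel f z') (- r)%:C 'i%C (- r) r) <= 16 * M / r * normc (z - z').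
  apply: normc_lint_kernelB => //; first exact: normc_i.
  - by move=> t tr; rewrite edgeE fM// lexx rr.
  - by move=> t; rewrite edgeE; apply: far; left; rewrite ler_normr; apply/orP; right; lra.
  - by move=> t; rewrite edgeE; apply: far; left; rewrite ler_normr; apply/orP; right; lra.
rewrite /rect.
have E (p1 p2 p3 p4 q1 q2 q3 q4 : R[i]) : p1 + p2 - p3 - p4 - (q1 + q2 - q3 - q4) =
    (p1 - q1) + (p2 - q2) - (p3 - q3) - (p4 - q4) by ring.
rewrite E; apply: (le_trans (ler_normcB _ _)).
have -> : 64 * M / r * normc (z - z') = 16 * M / r * normc (z - z') + 16 * M / r * normc (z - z')
  + 16 * M / r * normc (z - z') + 16 * M / r * normc (z - z') by ring.
apply: lerD => //; apply: (le_trans (ler_normcB _ _)).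
apply: lerD => //; apply: (le_trans (le_normcD _ _)).
exact: (lerD E1 E2).
Qed.

End KernelEstimates.

Section EntireLipschitz.
Context {R : realType}.
Implicit Types (z w p v : R[i]) (f g : R[i] -> R[i]) (a b c d : R).
Local Notation leb := (@lebesgue_measure R).

Lemma kernel1E (x y zx zy : R) : let q := (x - zx) ^+ 2 + (y - zy) ^+ 2 in
  kernel (fun=> 1) (zx +i* zy) (x +i* y) = ((x - zx) / q) +i* (- (y - zy) / q).
Proof. by rewrite /kernel mul1r /= mulNr. Qed.

(* All four edges contribute nonnegatively to the imaginary part; the bottom one
   alone gives [1 / 5]. *)
Lemma rect_kernel1_ge (zx zy r : R) : 0 < r -> `|zx| <= r / 2 -> `|zy| <= r / 2 ->
  5^-1 <= normc (rect (kernel (fun=> 1) (zx +i* zy)) (- r) r (- r) r).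
Proof.
move=> r0; rewrite !ler_norml => /andP[x1 x2] /andP[y1 y2].
set z := zx +i* zy; set k := kernel _ z.
have kc (x y : R) : (x != zx) || (y != zy) -> ccont k (x +i* y).
  move=> xy; apply: ccont_kernel; first by move=> w; exists 0; exact: cderiv_cst.
  exact: edge_neq.
have q0 (x y : R) : 0 <= (x - zx) ^+ 2 + (y - zy) ^+ 2 by rewrite addr_ge0 ?sqr_ge0.
have clineH (y : R) : cline k ('i%C * y%:C) 1 = fun t : R =>
    ((t - zx) / ((t - zx) ^+ 2 + (y - zy) ^+ 2)) +i* (- (y - zy) / ((t - zx) ^+ 2 + (y - zy) ^+ 2)).
  by apply/funext => t; rewrite /cline edge1E /k kernel1E.
have clineV (x : R) : cline k x%:C 'i%C = fun t : R =>
    ((x - zx) / ((x - zx) ^+ 2 + (t - zy) ^+ 2)) +i* (- (t - zy) / ((x - zx) ^+ 2 + (t - zy) ^+ 2)).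
  by apply/funext => t; rewrite /cline edgeE /k kernel1E.
apply: le_trans (ler_normc_Im _); apply: le_trans (ler_norm _).
have B : 5^-1 <= complex.Im (lint k ('i%C * (- r)%:C) 1 (- r) r).
  have cc t : ccont k ('i%C * (- r)%:C + t%:C * 1).
    by rewrite edge1E; apply: kc; apply/orP; right; rewrite lt_eqF//; lra.
  have := cintegrable_cline (- r) r cc; rewrite clineH => -[_ iI]; rewrite /= in iI.
  rewrite /lint clineH mul1r /=.
  apply: (@le_trans _ _ (\int[leb]_(t in `[- r, r]) (10 * r)^-1)).
    rewrite Rintegral_cst//= lebesgue_measure_itv/= lte_fin ifT; last by lra.
    by rewrite /= opprK le_eqVlt; apply/orP; left; apply/eqP; field; rewrite gt_eqF.
  apply: le_Rintegral => //.
    by apply: continuous_compact_integrable;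
      [exact: segment_compact|apply: continuous_subspaceT => ?; exact: cvg_cst].
  move=> t; rewrite /= in_itv/= => /andP[t1 t2].
  (* Both differences are at most [3 r / 2] in modulus and [r + zy >= r / 2], so the integrand is at
     least [1 / (10 r)] on an edge of length [2 r]. *)
  have ql : (t - zx) ^+ 2 + (- r - zy) ^+ 2 <= 5 * r ^+ 2 by nra.
  have q1 : 0 < (t - zx) ^+ 2 + (- r - zy) ^+ 2 by rewrite ltr_wpDl ?sqr_ge0//; nra.
  rewrite ler_pdivlMr// mulrC ler_pdivrMr ?mulr_gt0//; nra.
have C : 0 <= complex.Im (lint k r%:C 'i%C (- r) r).
  rewrite /lint clineV mulrC ImiRe /=; apply: Rintegral_ge0 => t _.
  by rewrite divr_ge0//; lra.
have D : complex.Im (lint k ('i%C * r%:C) 1 (- r) r) <= 0.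
  rewrite /lint clineH mul1r /= -oppr_ge0.
  have cc t : ccont k ('i%C * r%:C + t%:C * 1).
    by rewrite edge1E; apply: kc; apply/orP; right; rewrite gt_eqF//; lra.
  have := cintegrable_cline (- r) r cc; rewrite clineH => -[_ iI]; rewrite /= in iI.
  rewrite -mulN1r -RintegralZl//; apply: Rintegral_ge0 => t _.
  by rewrite mulN1r -mulNr opprK divr_ge0//; lra.
have E : complex.Im (lint k (- r)%:C 'i%C (- r) r) <= 0.
  rewrite /lint clineV mulrC ImiRe /= -oppr_ge0.
  have cc t : ccont k ((- r)%:C + t%:C * 'i%C).
    by rewrite edgeE; apply: kc; apply/orP; left; rewrite lt_eqF//; lra.
  have := cintegrable_cline (- r) r cc; rewrite clineV => -[iI _]; rewrite /= in iI.
  rewrite -mulN1r -RintegralZl//; apply: Rintegral_ge0 => t _.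
  by rewrite mulN1r -mulNr divr_ge0//; lra.
rewrite /rect; move: B C D E.
case: (lint _ _ _ _ _) => [? ?]; case: (lint _ _ _ _ _) => [? ?].
case: (lint _ _ _ _ _) => [? ?]; case: (lint _ _ _ _ _) => [? ?] /=; lra.
Qed.

(** With [W] the integral of [1 / (w - z)] around the square, [(f z - f w) Wz = (f z Wz - f w Ww) -
    f w (Wz - Ww)]. By [cauchy_square] the first bracket is a difference of Cauchy integrals; each
    term is at most [64 M / r] times [|z - w|]. Dividing by [|Wz| >= 1 / 5] gives 640. *)
Lemma entire_lipschitz f (r M : R) : 0 < r -> 0 <= M -> (forall w, exists D, cderiv f w D) ->
  (forall x y : R, `|x| <= r -> `|y| <= r -> normc (f (x +i* y)) <= M) ->
  exists2 C : R, 0 <= C & forall z w, normc z <= r / 2 -> normc w <= r / 2 ->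
    normc (f z - f w) <= C * normc (z - w).
Proof.
move=> r0 M0 fD fM; exists (640 * M / r); first exact: (divr_ge0 (mulr_ge0 (ler0n _ _) M0) (ltW r0)).
move=> [zx zy] [wx wy] zr wr; set z := zx +i* zy in zr *; set w := wx +i* wy in wr *.
have zx2 : `|zx| <= r / 2 := le_trans (ler_normc_Re z) zr.
have zy2 : `|zy| <= r / 2 := le_trans (ler_normc_Im z) zr.
have wx2 : `|wx| <= r / 2 := le_trans (ler_normc_Re w) wr.
have wy2 : `|wy| <= r / 2 := le_trans (ler_normc_Im w) wr.
have half (x : R) : `|x| <= r / 2 -> - r < x < r.
  by rewrite ler_norml => /andP[? ?]; apply/andP; split; lra.
have Nz := cauchy_square fD (half _ zx2) (half _ zy2).
have Nw := cauchy_square fD (half _ wx2) (half _ wy2).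
rewrite -/z in Nz; rewrite -/w in Nw.
have c1 u : exists D, cderiv (fun _ : R[i] => 1 : R[i]) u D.
  by exists 0; exact: cderiv_cst.
have K1 : normc (rect (kernel f z) (- r) r (- r) r - rect (kernel f w) (- r) r (- r) r) <=
    64 * M / r * normc (z - w).
  by apply: rect_kernelB => // x y xr yr; apply: fM; rewrite ler_norml.
have K2 : normc (rect (kernel (fun=> 1) z) (- r) r (- r) r -
    rect (kernel (fun=> 1) w) (- r) r (- r) r) <= 64 * 1 / r * normc (z - w).
  by apply: rect_kernelB => // x y _ _; rewrite le_eqVlt; apply/orP; left; apply/eqP; exact: Normc.normc1.
have W := rect_kernel1_ge r0 zx2 zy2.
rewrite -/z in W.
move: W K1 K2; rewrite Nz Nw.
move: (rect (kernel (fun=> 1) z) _ _ _ _) (rect (kernel (fun=> 1) w) _ _ _ _) => Wz Ww W K1 K2.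
have fw : normc (f w) <= M.
  apply: fM; [apply: (le_trans wx2)|apply: (le_trans wy2)]; lra.
have E : (f z - f w) * Wz = (f z * Wz - f w * Ww) - f w * (Wz - Ww) by ring.
have : normc ((f z - f w) * Wz) <= 128 * M / r * normc (z - w).
  rewrite E; apply: (le_trans (ler_normcB _ _)); rewrite Normc.normcM.
  have -> : 128 * M / r * normc (z - w) = 64 * M / r * normc (z - w) + M * (64 * 1 / r * normc (z - w)).
    by ring.
  by apply: lerD => //; apply: ler_pM; rewrite ?normc_ge0.
rewrite Normc.normcM => H.
have : normc (f z - f w) * 5^-1 <= 128 * M / r * normc (z - w).
  by apply: le_trans H; rewrite ler_wpM2l ?normc_ge0.
by rewrite ler_pdivrMr// => /le_trans; apply; rewrite le_eqVlt; apply/orP; left; apply/eqP; ring.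
Qed.

End EntireLipschitz.

(** * Integrals with respect to the Hausdorff measure *)

Section HausdorffEntire.
Context {R : realType}.
Variable mu : {measure set (measurableTypeR R) -> \bar R}.
Implicit Types (z w : R[i]) (f : R[i] -> R[i]).
Local Notation D1 := (`]1, +oo[%classic : set R).

Lemma measurable_ccont (A : set R) (g : R -> R[i]) : open A ->
  (forall t : R, A t -> forall e : R, 0 < e -> exists2 d : R, 0 < d &
    forall h : R, `|h| < d -> normc (g (t + h) - g t) <= e) ->
  measurable_fun A (fun t => complex.Re (g t)) /\
  measurable_fun A (fun t => complex.Im (g t)).
Proof.
move=> oA gA; split; apply: open_continuous_measurable_fun => // t; rewrite inE => /gA gt.
  by have [] := ccont_continuous gt.
by have [] := ccont_continuous gt.
Qed.

Lemma cderiv_integrand f z w : (forall w, exists D, cderiv f w D) -> w != 0 ->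
  exists D, cderiv (fun w => f (z / w) / w) w D.
Proof.
move=> fD w0; have V := cderivV w0 (@cderiv_id _ w).
have [D fz] := fD (z / w); eexists.
apply: cderivM; last exact: V.
exact: (@cderiv_comp _ f (fun u => z / u) w _ _ fz (cderivM (cderiv_cst z w) V)).
Qed.

Lemma measurable_integrand f z : (forall w, exists D, cderiv f w D) ->
  measurable_fun (`]0, +oo[%classic : set R) (fun t => complex.Re (hausdorff_integrand f z t)) /\
  measurable_fun (`]0, +oo[%classic : set R) (fun t => complex.Im (hausdorff_integrand f z t)).
Proof.
move=> fD; apply: measurable_ccont; first exact: interval_open.
move=> t; rewrite /= in_itv/= andbT => t0.
have t0' : 0 + t%:C * 1 != 0 :> R[i].
  by rewrite add0r mulr1 eq_complex /= negb_and gt_eqF.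
have [D /cderiv_ccont/ccont_line gD] := cderiv_integrand z fD t0'.
move=> e /gD[d d0 H]; exists d => // h /H.
by rewrite !add0r !mulr1.
Qed.

Lemma subset_D1 : D1 `<=` `]0, +oo[%classic.
Proof. by move=> t; rewrite /= !in_itv/= !andbT => /(lt_trans ltr01). Qed.

(** For functions in [fockoo] this is read off the growth bound, see [fockoo_bounded_on_balls]; it
    supplies the constant [M] of [entire_lipschitz]. *)
Definition bounded_on_balls f := forall r : R, exists2 M : R, 0 <= M &
  forall w, normc w <= r -> normc (f w) <= M.

Lemma normc_ratio_le z (t : R) : 1 < t -> normc (z / t%:C) <= normc z.
Proof.
move=> t1; have t0 := lt_trans ltr01 t1.
rewrite Normc.normcM Normc.normcV normc_real (ger0_norm (ltW t0)).
by rewrite ler_pdivrMr// ler_peMr ?normc_ge0// ltW.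
Qed.

Hypothesis imu : mu.-integrable D1 (EFin \o (fun t => t^-1)).

Lemma measurable_D1 : measurable (D1 : set (measurableTypeR R)).
Proof. exact: measurable_itv. Qed.

Lemma integrable_cinv (C : R) : mu.-integrable D1 (EFin \o (fun t => C * t^-1)).
Proof.
rewrite (_ : _ \o _ = fun t => (C%:E * (t^-1)%:E)%E)//.
by apply: (integrableZl measurable_D1).
Qed.

Lemma cintegrable_le (g : R -> R[i]) (C : R) :
  measurable_fun D1 (fun t => complex.Re (g t)) ->
  measurable_fun D1 (fun t => complex.Im (g t)) ->
  (forall t, 1 < t -> normc (g t) <= C * t^-1) -> cintegrable mu D1 g.
Proof.
move=> m1 m2 gC.
have iC : mu.-integrable D1 (EFin \o (fun t => C * t^-1)).
  exact: integrable_cinv.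
have aC t : 1 < t -> normc (g t) <= `|C * t^-1| by move=> /gC/le_trans; apply; exact: ler_norm.
split; (apply: le_integrable iC => //; first exact/measurable_EFinP) => t;
  rewrite /= in_itv/= andbT lee_fin => /aC; apply: le_trans.
- exact: ler_normc_Re.
- exact: ler_normc_Im.
Qed.

Lemma cintegrable_integrand f z : (forall w, exists D, cderiv f w D) ->
  bounded_on_balls f -> cintegrable mu D1 (hausdorff_integrand f z).
Proof.
move=> fD fB; have [m1 m2] := measurable_integrand z fD.
have [M M0 H] := fB (normc z).
apply: (@cintegrable_le _ M).
- by apply: measurable_funS m1 => //; exact: subset_D1.
- by apply: measurable_funS m2 => //; exact: subset_D1.
move=> t t1; have t0 := lt_trans ltr01 t1.
rewrite /hausdorff_integrand Normc.normcM Normc.normcV normc_real (ger0_norm (ltW t0)).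
rewrite ler_pM2r ?invr_gt0//; apply: H; exact: normc_ratio_le.
Qed.

Lemma cvg_complex (q : nat -> R[i]) (l : R[i]) :
  (forall e : R, 0 < e -> \forall n \near \oo, normc (q n - l) <= e) ->
  (complex.Re (q n) @[n --> \oo] --> complex.Re l) /\
  (complex.Im (q n) @[n --> \oo] --> complex.Im l).
Proof.
move=> H; split; apply/cvgrPdist_le => e /H He; apply: filterS He => n; rewrite normcB;
  apply: le_trans.
- by apply: le_trans (ler_normc_Re _); case: (q n) l {H} => [? ?] [? ?].
- by apply: le_trans (ler_normc_Im _); case: (q n) l {H} => [? ?] [? ?].
Qed.

Lemma dominated_cvg (q : nat -> R -> R) (l : R -> R) (C : R) :
  (forall n, measurable_fun D1 (q n)) ->
  (forall t, 1 < t -> q n t @[n --> \oo] --> l t) ->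
  (forall n t, 1 < t -> `|q n t| <= C * t^-1) ->
  mu.-integrable D1 (EFin \o l) /\
  \int[mu]_(t in D1) q n t @[n --> \oo] --> \int[mu]_(t in D1) l t.
Proof.
move=> mq ql qC.
have iC : mu.-integrable D1 (EFin \o (fun t => C * t^-1)).
  exact: integrable_cinv.
have mq' n : measurable_fun D1 (EFin \o q n) by exact/measurable_EFinP.
have ql' t : D1 t -> (EFin \o q n) t @[n --> \oo] --> (EFin \o l) t.
  by rewrite /= in_itv/= andbT => /ql t1; apply: cvg_EFin => //; exact: nearW.
have ml : measurable_fun D1 (EFin \o l) by apply: emeasurable_fun_cvg ql'.
have qC' t n : D1 t -> (`|(EFin \o q n) t| <= (C * t^-1)%R%:E)%E.
  by rewrite /= in_itv/= andbT => /qC; rewrite lee_fin.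
have [il _ H] := dominated_convergence measurable_D1 mq' ml
   (aeW mu ql') iC (aeW mu qC').
by split => //; apply: fine_cvg; rewrite fineK//; apply: integrable_fin_num.
Qed.

(** The difference quotient in [z] of [f (z / t) / t] is a difference quotient of [f] divided by
    [t^2]. The local Lipschitz constant [C] bounds it by [C / t], an integrable majorant. *)
Lemma cderiv_cintegral f : (forall w, exists D, cderiv f w D) -> bounded_on_balls f ->
  forall z, exists D, cderiv (fun z => cintegral mu D1 (hausdorff_integrand f z)) z D.
Proof.
move=> fD fB z; have [F' fF'] := choice fD.
pose l (t : R) := F' (z / t%:C) / t%:C / t%:C.
set H := fun z => cintegral _ _ _.
(* The square of half side [2 (|z| + 1)] lies in this disc, and [entire_lipschitz] then covers the
   disc of radius [|z| + 1], which contains [z + h] for [|h| <= 1]. *)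
have [M M0 fM] := fB (4 * (normc z + 1)).
have z10 : 0 < normc z + 1 by rewrite ltr_wpDl ?normc_ge0.
have [C C0 fC] : exists2 C : R, 0 <= C & forall u w, normc u <= normc z + 1 ->
    normc w <= normc z + 1 -> normc (f u - f w) <= C * normc (u - w).
  have r0 : 0 < 2 * (normc z + 1) by rewrite mulr_gt0.
  have [|C C0 HC] := @entire_lipschitz _ f _ M r0 M0 fD.
    move=> x y xr yr; apply: fM; apply: (le_trans (ler_normc_ReIm _)) => /=; lra.
  exists C => // u w ur wr; apply: HC; lra.
exists (cintegral mu D1 l); apply: contrapT => nD.
(* Dominated convergence is a statement about sequences, so failure of differentiability is turned
   into increments [h n] of modulus below [1 / (n + 1)] that violate the estimate for one fixed
   [e]. *)
have [e e0 He] : exists2 e : R, 0 < e & forall d : R, 0 < d -> exists h,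
    normc h < d /\ e * normc h < normc (H (z + h) - H z - cintegral mu D1 l * h).
  apply: contrapT => nE; apply: nD => e e0; apply: contrapT => nd.
  apply: nE; exists e => // d d0; apply: contrapT => nh; apply: nd; exists d => // h hd.
  by rewrite leNgt; apply/negP => hh; apply: nh; exists h.
have inv0 n : 0 < n.+1%:R^-1 :> R by rewrite invr_gt0.
have [h Hh] := choice (fun n : nat => He _ (inv0 n)).
have h0 n : h n != 0.
  apply/eqP => hn; have [_] := Hh n.
  by rewrite hn addr0 subrr mulr0 subrr Normc.normc0 mulr0 ltxx.
have h1 n : normc (h n) <= 1.
  have [/ltW/le_trans + _] := Hh n; apply.
  by rewrite invf_le1// ler1n.
pose q n (t : R) := (h n)^-1 * (hausdorff_integrand f (z + h n) t + -1 * hausdorff_integrand f z t).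
have iq n : cintegrable mu D1 (q n).
  apply: cintegrableZ => //; apply: cintegrableD => //; first exact: cintegrable_integrand.
  by apply: cintegrableZ => //; exact: cintegrable_integrand.
have Hq n : cintegral mu D1 (q n) = (H (z + h n) - H z) / h n.
  have i1 := cintegrable_integrand (z + h n) fD fB.
  have i2 := cintegrable_integrand z fD fB.
  rewrite cintegralZ//; last by apply: cintegrableD => //; exact: cintegrableZ.
  rewrite cintegralD//; last exact: cintegrableZ.
  by rewrite cintegralZ// mulN1r mulrC.
have qE n t : 1 < t -> q n t = (f (z / t%:C + h n / t%:C) - f (z / t%:C)) / (h n / t%:C) / t%:C / t%:C.
  move=> t1; have t0 : t%:C != 0 :> R[i] by rewrite eq_complex/= negb_and gt_eqF// (lt_trans ltr01).
  rewrite /q /hausdorff_integrand mulrDl; field.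
  by rewrite h0 t0.
have qC n t : 1 < t -> normc (q n t) <= C * t^-1.
  move=> t1; have t0 := lt_trans ltr01 t1.
  have nt : normc t%:C = t by rewrite normc_real (ger0_norm (ltW t0)).
  rewrite qE//; set k := h n / t%:C; set u := z / t%:C.
  have k0 : 0 < normc k by rewrite normc_gt0 mulf_neq0// invr_eq0 -normc_eq0 nt gt_eqF.
  rewrite (Normc.normcM _ t%:C^-1) (Normc.normcM _ t%:C^-1) (Normc.normcM _ k^-1) !Normc.normcV nt.
  rewrite ler_pM2r ?invr_gt0//.
  have B : normc (f (u + k) - f u) / normc k <= C.
    rewrite ler_pdivrMr//; apply: (le_trans (fC _ _ _ _)).
    - rewrite /u /k -mulrDl; apply: (le_trans (normc_ratio_le _ t1)).
      by apply: (le_trans (le_normcD _ _)); rewrite lerD2l.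
    - by apply: (le_trans (normc_ratio_le _ t1)); rewrite lerDl.
    - by rewrite (addrC u) addrK.
  rewrite ler_pdivrMr//; apply: (le_trans B); rewrite ler_peMr// ltW//.
have ql (t : R) : 1 < t -> forall e' : R, 0 < e' -> \forall n \near \oo, normc (q n t - l t) <= e'.
  move=> t1 e' e'0; have t0 := lt_trans ltr01 t1.
  have nt : normc t%:C = t by rewrite normc_real (ger0_norm (ltW t0)).
  have tC0 : t%:C != 0 :> R[i] by rewrite -normc_eq0 nt gt_eqF.
  have [d d0 Hd] := fF' (z / t%:C) _ e'0.
  exists (Num.truncn d^-1) => // n /= nd.
  rewrite qE// /l; set k := h n / t%:C; set u := z / t%:C in Hd *.
  have k0 : k != 0 by rewrite mulf_neq0// invr_eq0.
  have kd : normc k < d.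
    apply: (le_lt_trans (normc_ratio_le _ t1)); have [hn _] := Hh n.
    apply: (lt_trans hn); rewrite -[ltRHS]invrK ltf_pV2 ?posrE ?invr_gt0//.
    by apply: (lt_le_trans (truncnS_gt _)); rewrite ler_nat.
  have := Hd _ kd.
  rewrite (_ : f (u + k) - f u - F' u * k = ((f (u + k) - f u) / k - F' u) * k); last by field.
  rewrite Normc.normcM ler_pM2r ?normc_gt0// => B.
  rewrite -!mulrBl (Normc.normcM _ t%:C^-1) (Normc.normcM _ t%:C^-1) !Normc.normcV nt.
  by rewrite !ler_pdivrMr//; apply: (le_trans B); rewrite -mulrA ler_peMr ?ltW// mulr_egt1.
have mR n : measurable_fun D1 (fun t => complex.Re (q n t)).
  by have [/measurable_int/measurable_EFinP] := iq n.
have mI n : measurable_fun D1 (fun t => complex.Im (q n t)).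
  by have [_ /measurable_int/measurable_EFinP] := iq n.
have [iR cR] := @dominated_cvg (fun n t => complex.Re (q n t)) (fun t => complex.Re (l t)) C
  mR
  (fun t t1 => (cvg_complex (ql t t1)).1) (fun n t t1 => le_trans (ler_normc_Re _) (qC n t t1)).
have [iI cI] := @dominated_cvg (fun n t => complex.Im (q n t)) (fun t => complex.Im (l t)) C
  mI
  (fun t t1 => (cvg_complex (ql t t1)).2) (fun n t t1 => le_trans (ler_normc_Im _) (qC n t t1)).
move/cvgrPdist_le : cR => /(_ (e / 2) ltac:(lra))[N1 _ HN1].
move/cvgrPdist_le : cI => /(_ (e / 2) ltac:(lra))[N2 _ HN2].
pose n := maxn N1 N2.
have := HN1 n (leq_maxl _ _); have := HN2 n (leq_maxr _ _) => /= e2 e1.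
have [_] := Hh n; apply/negP; rewrite -leNgt.
rewrite (_ : _ - _ = ((H (z + h n) - H z) / h n - cintegral mu D1 l) * h n); last by field.
rewrite Normc.normcM ler_pM2r ?normc_gt0// -Hq normcB.
apply: (le_trans (ler_normc_ReIm _)) => /=; lra.
Qed.

End HausdorffEntire.

(** * Gaussian integral, joint measurability, sigma-finite restrictions *)

Section MeasureTools.
Context {R : realType}.
Local Notation leb := (@lebesgue_measure R).

(** Rescaled normalisation of the normal density with variance [1 / (2 c)]. *)
Lemma integral_gauss (c : R) : 0 < c ->
  (\int[leb]_x (expR (- (c * x ^+ 2)))%:E = (Num.sqrt (pi / c))%:E)%E.
Proof.
move=> c0; pose s := Num.sqrt (2 * c)^-1.
have s2 : s ^+ 2 = (2 * c)^-1 by rewrite sqr_sqrtr// invr_ge0 mulr_ge0// ltW.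
have s0 : s != 0 by rewrite -sqrf_eq0 s2 invr_eq0 mulf_neq0// gt_eqF.
have P0 : 0 < Num.sqrt (pi / c) by rewrite sqrtr_gt0 divr_gt0// pi_gt0.
have := integral_normal_pdf 0 s.
rewrite (_ : (fun x => _) = (fun x => (Num.sqrt (pi / c))^-1%:E * (expR (- (c * x ^+ 2)))%:E)%E); last first.
  apply/funext => x; rewrite /normal_pdf (negbTE s0) -EFinM; congr (_ * _)%:E.
    rewrite /normal_peak s2; congr (Num.sqrt _)^-1; field; exact: lt0r_neq0.
  rewrite /normal_fun s2 subr0; congr expR; field; exact: lt0r_neq0.
rewrite ge0_integralZl_EFin//.
- move=> H; rewrite -[LHS]mul1e -[X in (X%:E * _)%E](divff (lt0r_neq0 P0)) EFinM -muleA H.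
  by rewrite mule1.
- apply/measurable_EFinP; apply: measurableT_comp => //.
  by apply: measurable_funN; apply: measurable_funM => //; exact: exprn_measurable.
Qed.

(** Rounding [x] down to the grid of mesh [1 / (n + 1)] turns [G] into a function whose preimages
    are countable unions of measurable rectangles; continuity in [x] makes these functions converge
    to [G]. This yields measurability for the product sigma-algebra, which Tonelli's theorem
    uses. *)
Lemma measurable_caratheodory (G : R -> R -> R) :
  (forall x, measurable_fun setT (G x)) -> (forall y, continuous (G ^~ y)) ->
  measurable_fun [set: measurableTypeR R * measurableTypeR R] (fun p => G p.1 p.2).
Proof.
move=> mG cG.
pose s n (x : R) := (Num.floor (x * n.+1%:R))%:~R / n.+1%:R : R.
apply: (@measurable_fun_cvg _ _ _ _ (fun n p => G (s n p.1) p.2)); last first.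
  move=> [x y] _ /=; apply: (continuous_cvg _ (cG y x)).
  apply/cvgrPdist_le => e e0; exists (Num.truncn e^-1) => // n /= nd.
  have n0 : 0 < n.+1%:R :> R by [].
  have : n.+1%:R^-1 <= e.
    rewrite -[leRHS]invrK lef_pV2 ?posrE ?invr_gt0//.
    by apply/ltW/(lt_le_trans (truncnS_gt _)); rewrite ler_nat.
  apply: le_trans; rewrite /s -[X in X - _](mulfK (lt0r_neq0 n0)) -mulrBl.
  rewrite normrM [X in _ * X]ger0_norm ?invr_ge0// ler_piMl ?invr_ge0//.
  have /andP[f1 f2] := floor_itv (x * n.+1%:R).
  rewrite ler_norml; apply/andP; split; move: f1 f2; rewrite intrD; lra.
move=> n _ B mB; rewrite setTI.
have n0 : 0 < n.+1%:R :> R by [].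
pose A (k : int) : set (measurableTypeR R * measurableTypeR R) :=
  `[k%:~R / n.+1%:R, (k + 1)%:~R / n.+1%:R[%classic `*` (G (k%:~R / n.+1%:R) @^-1` B).
have mA k : measurable (A k).
  apply: measurableX; first exact: measurable_itv.
  by rewrite -[X in measurable X]setTI; exact: mG.
rewrite (_ : _ @^-1` _ = \bigcup_k A (Posz k) `|` \bigcup_k A (Negz k)).
  by apply: measurableU; apply: bigcup_measurable => k _; exact: mA.
have floorE (x : R) (k : int) : k%:~R / n.+1%:R <= x -> x < (k + 1)%:~R / n.+1%:R ->
    Num.floor (x * n.+1%:R) = k.
  by move=> k1 k2; apply/floor_def; rewrite -ler_pdivrMr// k1 /= -ltr_pdivlMr.
apply/seteqP; split => [[x y] /= Bxy|[x y]].
  have Ak : A (Num.floor (x * n.+1%:R)) (x, y).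
    split => //=; rewrite in_itv/= ler_pdivrMr// ltr_pdivlMr//.
    exact: floor_itv.
  case: (Num.floor _) Ak => k Ak; [left|right]; by exists k.
by case=> -[k _ [/=]]; rewrite in_itv/= => /andP[/floorE/[apply] Hk]; rewrite /s Hk.
Qed.

(** On []0, n + 1]] the integrand [1 / t] is at least [1 / (n + 1)], so the finite integral bounds
    the mass of [D] there. The resulting sigma-finite measure stands in for [mu] whenever Tonelli's
    theorem is applied. *)
Lemma sigma_finite_restriction (mu : {measure set (measurableTypeR R) -> \bar R})
    (D : set (measurableTypeR R)) : measurable D -> D `<=` `]0, +oo[%classic ->
  (\int[mu]_(t in D) (t^-1)%:E < +oo)%E ->
  exists nu : {sigma_finite_measure set (measurableTypeR R) -> \bar R},
    (forall A, measurable A -> A `<=` D -> mu A = nu A) /\ nu (~` D) = 0.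
Proof.
move=> mD D0 iD.
have sf : sigma_finite [set: measurableTypeR R] (mrestr mu mD).
  (* The complement of [D] has measure zero for the restriction, so adding it to every piece makes
     the pieces cover the line at no cost. *)
  exists (fun n : nat => ~` D `|` (D `&` `]0, n.+1%:R]%classic)).
    apply/esym/seteqP; split => // x _; have [Dx|nDx] := pselect (D x); last by exists 0%N => //; left.
    exists (Num.truncn x) => //; right; split => //.
    have := D0 _ Dx; rewrite /= !in_itv/= andbT => ->/=.
    by rewrite ltW// truncnS_gt.
  move=> n; have mDn : measurable (D `&` `]0, n.+1%:R]%classic : set (measurableTypeR R)).
    by apply: measurableI => //; exact: measurable_itv.
  split; first by apply: measurableU => //; exact: measurableC.
  rewrite /mrestr setIUl setICl set0U setIAC setIid.
  have n0 : 0 < n.+1%:R :> R by [].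
  have : ((n.+1%:R^-1)%:E * mu (D `&` `]0%R, n.+1%:R]%classic) <= \int[mu]_(t in D) (t^-1)%:E)%E.
    have m1 : measurable_fun D (fun t : R => (t^-1)%:E).
      apply/measurable_EFinP; apply: (@measurable_funS _ _ _ _ (`]0, +oo[%classic : set (measurableTypeR R))) => //.
      apply: open_continuous_measurable_fun; first exact: interval_open.
      by move=> t; rewrite inE/= in_itv/= andbT => t0; apply: inv_continuous; rewrite gt_eqF.
    rewrite -integral_cst//; apply: (@le_trans _ _ (\int[mu]_(t in D `&` `]0%R, n.+1%:R]%classic) (t^-1)%:E)%E).
      apply: ge0_le_integral => //.
      - by move=> t _; rewrite lee_fin invr_ge0.
      - by apply: measurable_funS m1 => // ; exact: subIsetl.
      - move=> t [_]; rewrite /= in_itv/= => /andP[t0 tn].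
        by rewrite lee_fin lef_pV2.
    apply: ge0_subset_integral => //.
    move=> t /D0; rewrite /= in_itv/= andbT lee_fin invr_ge0 => /ltW//.
  move=> /le_lt_trans/(_ iD); case: (mu _) => [r||] //=; first by rewrite !ltry.
  by rewrite gt0_muley// lte_fin invr_gt0.
pose nu : {sigma_finite_measure set (measurableTypeR R) -> \bar R} :=
  HB.pack_for (SigmaFiniteMeasure.type (measurableTypeR R) R) (mrestr mu mD)
    (isSFinite.Build _ _ _ (mrestr mu mD) (sfinite_measure_sigma_finite sf))
    (isSigmaFinite.Build _ _ _ (mrestr mu mD) sf).
exists nu; split => [A mA AD|].
  by rewrite /nu /= /mrestr; congr (mu _); apply/esym/setIidl.
by rewrite /nu /= /mrestr setICl measure0.
Qed.

End MeasureTools.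

(** * Consequences of summable moments *)

Section Moments.
Context {R : realType}.
Variable mu : {measure set (measurableTypeR R) -> \bar R}.
Local Notation D0 := (`]0, +oo[%classic : set (measurableTypeR R)).
Local Notation D1 := (`]1, +oo[%classic : set (measurableTypeR R)).
Local Notation I1 := (`]0, 1]%classic : set (measurableTypeR R)).

Lemma measurable_expNr n : measurable_fun D0 (fun t : R => (t ^- n)%:E).
Proof.
apply/measurable_EFinP; apply: open_continuous_measurable_fun; first exact: interval_open.
move=> t; rewrite inE/= in_itv/= andbT => t0.
have tn0 : t ^+ n != 0 by rewrite expf_neq0// gt_eqF.
apply: (continuous_comp (f := fun t : R => t ^+ n)); first exact: exprn_continuous.
exact: inv_continuous.
Qed.

Lemma expNr_ge0 n (t : R) : D0 t -> (0 <= (t ^- n)%:E)%E.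
Proof. by rewrite /= in_itv/= andbT => t0; rewrite lee_fin invr_ge0 exprn_ge0// ltW. Qed.

Lemma hausdorff_moment_ge0 n : (0 <= hausdorff_moment mu n)%E.
Proof. by apply: integral_ge0 => t; exact: expNr_ge0. Qed.

Lemma moment_sub_le (A : set (measurableTypeR R)) n : measurable A -> A `<=` D0 ->
  (\int[mu]_(t in A) (t ^- n.+1)%:E <= hausdorff_moment mu n)%E.
Proof.
move=> mA AD; apply: ge0_subset_integral => //.
- exact: measurable_expNr.
- by move=> t; exact: expNr_ge0.
Qed.

Lemma subset_I1 : I1 `<=` D0.
Proof. by move=> t; rewrite /= !in_itv/= andbT => /andP[]. Qed.

Lemma measure_I1_le n : (mu I1 <= hausdorff_moment mu n)%E.
Proof.
have mI : measurable I1 by exact: measurable_itv.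
apply: le_trans (moment_sub_le n mI subset_I1).
rewrite -[leLHS]mul1e -integral_cst//; apply: ge0_le_integral => //.
- by apply: measurable_funS (measurable_expNr n.+1) => //; exact: subset_I1.
- move=> t; rewrite /= in_itv/= => /andP[t0 t1]; rewrite lee_fin.
  by rewrite -[leLHS]invr1 lef_pV2 ?posrE ?exprn_gt0// exprn_ile1// ltW.
Qed.

Hypothesis summable : (\sum_(0 <= n <oo) hausdorff_moment mu n < +oo)%E.

(** On []0, 1]] every [t^-(n + 1)] is at least 1, so each moment is at least [mu I1] and the sum
    dominates [n mu I1] for all [n]. The endpoint 1 is included. *)
Lemma measure_I1 : mu I1 = 0%E.
Proof.
have S0 : (0 <= \sum_(0 <= n <oo) hausdorff_moment mu n)%E.
  by apply: nneseries_ge0 => n _ _; exact: hausdorff_moment_ge0.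
have N n : ((n%:R)%:E * mu I1 <= \sum_(0 <= n <oo) hausdorff_moment mu n)%E.
  apply: le_trans (nneseries_lim_ge n _) => [|k _ _]; last exact: hausdorff_moment_ge0.
  elim: n => [|n IH]; first by rewrite mul0e big_geq.
  rewrite big_nat_recr//= -natr1 EFinD ge0_muleDl ?lee_fin//.
  by rewrite leeD// mul1e measure_I1_le.
have fI : mu I1 \is a fin_num.
  rewrite ge0_fin_numE//; apply: le_lt_trans summable.
  by have := N 1%N; rewrite mul1e.
have := fine_ge0 (measure_ge0 mu I1); move: N; rewrite -(fineK fI).
move: (fine (mu I1)) => r N r0; congr (_%:E); apply/eqP; rewrite eq_le r0 andbT.
rewrite leNgt; apply/negP => r1.
have /fineK SE : (\sum_(0 <= n <oo) hausdorff_moment mu n)%E \is a fin_num.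
  by rewrite ge0_fin_numE.
move: N; rewrite -SE => /(_ (Num.truncn (fine (\sum_(0 <= n <oo) hausdorff_moment mu n)%E / r)).+1).
rewrite -EFinM lee_fin -ler_pdivlMr//; apply/negP; rewrite -ltNge.
exact: truncnS_gt.
Qed.

Lemma moment_inv_lty (A : set (measurableTypeR R)) : measurable A -> A `<=` D0 ->
  (hausdorff_moment mu 0 < +oo)%E -> (\int[mu]_(t in A) (t^-1)%:E < +oo)%E.
Proof. by move=> mA AD; apply: le_lt_trans; exact: (moment_sub_le 0 mA AD). Qed.

Lemma moment_lty n : (hausdorff_moment mu n < +oo)%E.
Proof.
apply: le_lt_trans summable; apply: le_trans (nneseries_lim_ge n.+1 _) => [|k _ _].
  rewrite big_nat_recr//= leeDr// sume_ge0// => k _; exact: hausdorff_moment_ge0.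
exact: hausdorff_moment_ge0.
Qed.

Lemma geometric_moment (t : R) : 1 < t ->
  (\sum_(0 <= n <oo) (t ^- n.+1)%:E = ((t - 1)^-1)%:E)%E.
Proof.
move=> t1; have t0 := lt_trans ltr01 t1.
apply: cvg_lim => //; rewrite (_ : (fun _ => _) = EFin \o series (geometric t^-1 t^-1)); last first.
  apply/funext => n /=; rewrite /series/= sumEFin; congr (_%:E).
  by apply: eq_bigr => k _; rewrite /geometric /= -exprVn -exprS exprVn.
apply: cvg_EFin; first exact: nearW.
have -> : (t - 1)^-1 = t^-1 / (1 - t^-1).
  by field; rewrite subr_eq0 !gt_eqF.
by apply: cvg_geometric_series; rewrite ger0_norm ?invr_ge0 ?invf_lt1// ltW.
Qed.

(** For [t > 1] the geometric series of the [t^-(n + 1)] sums to [1 / (t - 1)]; nonnegativity allows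
    exchanging sum and integral. *)
Lemma integral_inv_sub1 :
  (\int[mu]_(t in D1) ((t - 1)^-1)%:E <= \sum_(0 <= n <oo) hausdorff_moment mu n)%E.
Proof.
have mD1 : measurable D1 by exact: measurable_itv.
under eq_integral => t.
  rewrite inE/= in_itv/= andbT => t1; rewrite -geometric_moment//; over.
rewrite integral_nneseries//.
- apply: lee_nneseries => n _; last exact: moment_sub_le _ _ (@subset_D1 R).
  by move=> _; apply: integral_ge0 => t /subset_D1; exact: expNr_ge0.
- by move=> n; apply: measurable_funS (measurable_expNr n.+1) => //; exact: subset_D1.
- by move=> n t /subset_D1; exact: expNr_ge0.
Qed.

End Moments.

(** * Sufficiency *)

Section GaussianTonelli.
Context {R : realType}.
Variable mu : {measure set (measurableTypeR R) -> \bar R}.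
Local Notation D1 := (`]1, +oo[%classic : set (measurableTypeR R)).
Local Notation leb := (@lebesgue_measure R).
Variable a : R.
Hypothesis a0 : 0 < a.

(** Extending [1 / t] by 0 below 1 keeps its values in [[0, 1[]. Then [rate] is positive on the
    whole line, and integrals over [D1] become integrals over the whole space. *)
Definition cutinv (t : R) : R := if 1 < t then t^-1 else 0.

Lemma measurable_cutinv : measurable_fun [set: measurableTypeR R] cutinv.
Proof.
have mD1 : measurable D1 by exact: measurable_itv.
rewrite (_ : cutinv = (GRing.inv : R -> R) \_ D1); last first.
  by apply/funext => t; rewrite /cutinv patchE mem_setE in_itv/= andbT.
apply/(measurable_restrictT _ mD1); apply: open_continuous_measurable_fun.
  exact: interval_open.
move=> t; rewrite inE/= in_itv/= andbT => t1; apply: inv_continuous.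
by rewrite gt_eqF// (lt_trans ltr01).
Qed.

Lemma cutinv_ge0 t : 0 <= cutinv t.
Proof. by rewrite /cutinv; case: ifP => // /(lt_trans ltr01) t0; rewrite invr_ge0 ltW. Qed.

Lemma cutinv_lt1 t : cutinv t < 1.
Proof. by rewrite /cutinv; case: ifP => // t1; rewrite invf_lt1// (lt_trans ltr01). Qed.

(** For [t > 1], [e^(-rate |z|^2)] is the growth [e^(a |z|^2 / (2 t^2))] of [f (z / t)] times the
    weight [e^(-a |z|^2 / 2)]. *)
Definition rate (t : R) : R := a / 2 * (1 - cutinv t ^+ 2).

Lemma rate_gt0 t : 0 < rate t.
Proof.
rewrite /rate mulr_gt0 ?divr_gt0// subr_gt0.
by rewrite expr_lt1 ?cutinv_ge0// cutinv_lt1.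
Qed.

Lemma measurable_rate : measurable_fun [set: measurableTypeR R] rate.
Proof.
apply: measurable_funM => //; apply: measurable_funB => //.
apply: (measurableT_comp (f := fun x : R => x ^+ 2)); first exact: exprn_measurable.
exact: measurable_cutinv.
Qed.

(** The two plane coordinates are integrated one after the other, each exchanged with the
    sigma-finite stand-in [nu] and contributing a factor [sqrt (pi / rate)]. *)
Lemma gaussian_tonelli : (\int[mu]_(t in D1) (t^-1)%:E < +oo)%E ->
  measurable_fun [set: measurableTypeR R * measurableTypeR R] (fun p =>
    \int[mu]_(t in D1) (expR (- (rate t * (p.1 ^+ 2 + p.2 ^+ 2))) * t^-1)%:E)%E /\
  (\int[leb \x leb]_p \int[mu]_(t in D1)
     (expR (- (rate t * (p.1 ^+ 2 + p.2 ^+ 2))) * t^-1)%:E =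
   \int[mu]_(t in D1) (pi / rate t * t^-1)%:E)%E.
Proof.
move=> imu; have mD1 : measurable D1 by exact: measurable_itv.
have [nu [nuE nuD]] := sigma_finite_restriction mD1 (@subset_D1 R) imu.
have tonu (g G : R -> \bar R) : (forall t, 1 < t -> G t = g t) ->
    (forall t, ~~ (1 < t) -> G t = 0%E) -> (\int[mu]_(t in D1) g t = \int[nu]_t G t)%E.
  move=> Gg G0; rewrite (eq_measure_integral nu)// integral_mkcond.
  apply: eq_integral => t _; rewrite patchE mem_setE in_itv/= andbT.
  by case: ifPn => [/Gg ->|/G0 ->].
pose F (q : (measurableTypeR R * measurableTypeR R) * measurableTypeR R) : \bar R :=
  (expR (- (rate q.2 * (q.1.1 ^+ 2 + q.1.2 ^+ 2))) * cutinv q.2)%:E.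
have F0 q : (0 <= F q)%E by rewrite lee_fin mulr_ge0 ?expR_ge0 ?cutinv_ge0.
have msq d (T : measurableType d) (g : T -> R) : measurable_fun setT g ->
    measurable_fun setT (fun x => g x ^+ 2).
  move=> mg; apply: (measurableT_comp (f := fun x : R => x ^+ 2)) => //.
have mF : measurable_fun setT F.
  apply/measurable_EFinP; apply: measurable_funM; last first.
    by apply: measurableT_comp; [exact: measurable_cutinv|exact: measurable_snd].
  apply: measurableT_comp => //; apply: measurable_funN; apply: measurable_funM.
    by apply: measurableT_comp; [exact: measurable_rate|exact: measurable_snd].
  apply: measurable_funD; apply: msq.
    by apply: measurableT_comp; exact: measurable_fst.
  by apply: measurableT_comp; [exact: measurable_snd|exact: measurable_fst].
have E1 p : (\int[mu]_(t in D1) (expR (- (rate t * (p.1 ^+ 2 + p.2 ^+ 2))) * t^-1)%:E =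
    \int[nu]_t F (p, t))%E.
  by apply: tonu => t; rewrite /F /= /cutinv; [move=> ->|move=> /negbTE ->; rewrite mulr0].
rewrite (_ : (fun p => _) = (fun p => \int[nu]_t F (p, t))%E); last exact/funext.
split; first exact: measurable_fun_fubini_tonelli_F.
rewrite fubini_tonelli1/=; [|exact: measurable_fun_fubini_tonelli_F|by move=> p; exact: integral_ge0].
rewrite /fubini_F.
have mFx x : measurable_fun setT (fun q : measurableTypeR R * measurableTypeR R => F ((x, q.1), q.2)).
  apply: (measurableT_comp mF); apply: measurable_fun_pair; last exact: measurable_snd.
  by apply: measurable_fun_pair; [exact: measurable_cst|exact: measurable_fst].
pose v t := Num.sqrt (pi / rate t) * cutinv t.
have v0 t : 0 <= v t by rewrite mulr_ge0 ?sqrtr_ge0 ?cutinv_ge0.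
have Fy x t : (\int[leb]_y F ((x, y), t) = (expR (- (rate t * x ^+ 2)) * v t)%:E)%E.
  rewrite (_ : (fun y => _) = (fun y : R => (expR (- (rate t * x ^+ 2)) * cutinv t)%:E *
      (expR (- (rate t * y ^+ 2)))%:E)%E); last first.
    by apply/funext => y; rewrite /F/= mulrDr opprD expRD -EFinM; congr (_%:E); ring.
  rewrite ge0_integralZl_EFin//.
  - by rewrite integral_gauss ?rate_gt0// -EFinM /v; congr (_%:E); ring.
  - apply/measurable_EFinP; apply: measurableT_comp => //; apply: measurable_funN.
    by apply: measurable_funM => //; exact: exprn_measurable.
  - by rewrite mulr_ge0 ?expR_ge0 ?cutinv_ge0.
transitivity (\int[leb]_x \int[nu]_t (expR (- (rate t * x ^+ 2)) * v t)%:E)%E.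
  apply: eq_integral => x _.
  rewrite (fubini_tonelli (fun q : measurableTypeR R * measurableTypeR R => F ((x, q.1), q.2)))//.
  by apply: eq_integral => t _; exact: Fy.
(* [v] is the partial integral over [y] at [x = 0], so its measurability is part of Tonelli's
   theorem for that slice. *)
have mv : measurable_fun [set: measurableTypeR R] v.
  apply/measurable_EFinP.
  have : measurable_fun setT (fun t => \int[leb]_y F ((0%R, y), t))%E.
    by apply: (@measurable_fun_fubini_tonelli_G _ _ _ _ _ leb
      (fun q : measurableTypeR R * measurableTypeR R => F ((0%R, q.1), q.2))) => //.
  rewrite (_ : (fun y => _) = EFin \o v)//; apply/funext => t /=.
  by rewrite Fy expr0n/= mulr0 oppr0 expR0 mul1r.
rewrite (fubini_tonelli (fun q : measurableTypeR R * measurableTypeR R =>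
  (expR (- (rate q.2 * q.1 ^+ 2)) * v q.2)%:E)); last 2 first.
- apply/measurable_EFinP; apply: measurable_funM; last first.
    by apply: measurableT_comp; [exact: mv|exact: measurable_snd].
  apply: measurableT_comp => //; apply: measurable_funN; apply: measurable_funM.
    by apply: measurableT_comp; [exact: measurable_rate|exact: measurable_snd].
  by apply: msq; exact: measurable_fst.
- by move=> q; rewrite lee_fin mulr_ge0 ?expR_ge0.
apply/esym/tonu => t t1 /=.
- under eq_integral do rewrite mulrC EFinM.
  rewrite ge0_integralZl_EFin//; last first.
    apply/measurable_EFinP; apply: measurableT_comp => //; apply: measurable_funN.
    by apply: measurable_funM => //; exact: exprn_measurable.
  rewrite integral_gauss ?rate_gt0// -EFinM /v mulrAC -expr2 sqr_sqrtr; last first.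
    by rewrite divr_ge0 ?pi_ge0// ltW// rate_gt0.
  by rewrite /cutinv t1.
- under eq_integral do rewrite /v /cutinv (negbTE t1) !mulr0.
  exact: integral0.
Qed.

End GaussianTonelli.

Section SufficientCondition.
Context {R : realType}.
Implicit Types (f : R[i] -> R[i]) (alpha : R).
Local Notation D0 := (`]0, +oo[%classic : set (measurableTypeR R)).
Local Notation D1 := (`]1, +oo[%classic : set (measurableTypeR R)).
Local Notation I1 := (`]0, 1]%classic : set (measurableTypeR R)).
Local Notation leb := (@lebesgue_measure R).

Lemma entireP f : entire f <-> forall w, exists D, cderiv f w D.
Proof. by split => fD w; have /derivable_cderiv := fD w. Qed.

Lemma weighted_modulusE alpha f (x y : R) : weighted_modulus alpha f (x +i* y) =
  normc (f (x +i* y)) * expR (- (alpha / 2) * (x ^+ 2 + y ^+ 2)).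
Proof. by rewrite /weighted_modulus sqr_normc. Qed.

Lemma weighted_modulus_ge0 alpha f z : 0 <= weighted_modulus alpha f z.
Proof. by rewrite mulr_ge0 ?normc_ge0 ?expR_ge0. Qed.

Lemma fockoo_growth alpha f : fockoo alpha f -> exists K : R,
  [/\ 0 <= K, fockoo_norm alpha f = K%:E &
      forall w, normc (f w) <= K * expR (alpha / 2 * normc w ^+ 2)].
Proof.
move=> [_ fN]; have wN z : ((weighted_modulus alpha f z)%:E <= fockoo_norm alpha f)%E.
  by apply: ereal_sup_ubound; exists z.
have N0 : (0 <= fockoo_norm alpha f)%E.
  by apply: le_trans (wN 0); rewrite lee_fin weighted_modulus_ge0.
have /fineK NE : fockoo_norm alpha f \is a fin_num by rewrite ge0_fin_numE.
exists (fine (fockoo_norm alpha f)); split => //; first exact: fine_ge0.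
move=> w; have := wN w; rewrite -{1}NE lee_fin /weighted_modulus mulNr expRN.
by rewrite ler_pdivrMr// expR_gt0.
Qed.

Lemma fockoo_bounded_on_balls alpha f : 0 <= alpha -> fockoo alpha f -> bounded_on_balls f.
Proof.
move=> alpha0 /fockoo_growth[K [K0 _ fK]] r.
exists (K * expR (alpha / 2 * r ^+ 2)) => [|w wr]; first by rewrite mulr_ge0 ?expR_ge0.
apply: (le_trans (fK w)); rewrite ler_wpM2l// ler_expR ler_wpM2l ?divr_ge0//.
by rewrite ler_pXn2r// nnegrE ?normc_ge0// (le_trans (normc_ge0 w)).
Qed.

Lemma continuous_normc_line f p v : (forall w, exists D, cderiv f w D) ->
  continuous (fun t : R => normc (f (p + t%:C * v))).
Proof.
move=> fD t; apply/cvgrPdist_le => e e0.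
have [D /cderiv_ccont/ccont_line/(_ _ e0)[d d0 H]] := fD (p + t%:C * v).
apply/nbhs_ballP; exists d => // s; rewrite /ball/= distrC => /H.
rewrite (addrC t) subrK normcB; apply: le_trans.
have := ler_normc_sub (f (p + t%:C * v)) (f (p + s%:C * v)).
have := ler_normc_sub (f (p + s%:C * v)) (f (p + t%:C * v)).
by rewrite (normcB (f (p + s%:C * v))) ler_norml => ? ?; apply/andP; split; lra.
Qed.

Lemma measurable_weighted_modulus alpha f : entire f ->
  measurable_fun [set: measurableTypeR R * measurableTypeR R]
    (fun p => weighted_modulus alpha f (p.1 +i* p.2)).
Proof.
move=> /entireP fD.
have ce (c : R) : continuous (fun t : R => expR (- (alpha / 2) * (t ^+ 2 + c))).
  move=> t; apply: continuous_comp; last exact: continuous_expR.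
  apply: cvgM; first exact: cvg_cst.
  by apply: cvgD; [exact: exprn_continuous|exact: cvg_cst].
apply: (measurable_caratheodory (G := fun x y => weighted_modulus alpha f (x +i* y))) => [x|y].
  apply: continuous_measurable_fun => y; rewrite /weighted_modulus.
  rewrite (_ : (fun y => _) = (fun y : R => normc (f (x%:C + y%:C * 'i%C)) *
      expR (- (alpha / 2) * (y ^+ 2 + x ^+ 2)))); last first.
    by apply/funext => t; rewrite edgeE sqr_normc/= (addrC (x ^+ 2)).
  by apply: cvgM; [exact: continuous_normc_line|exact: ce].
rewrite (_ : (fun y => _) = (fun x : R => normc (f ('i%C * y%:C + x%:C * 1)) *
    expR (- (alpha / 2) * (x ^+ 2 + y ^+ 2)))); last first.
  by apply/funext => t; rewrite edge1E /weighted_modulus sqr_normc.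
by move=> x; apply: cvgM; [exact: continuous_normc_line|exact: ce].
Qed.

Variable mu : {measure set (measurableTypeR R) -> \bar R}.
Variable alpha : R.
Hypothesis alpha_gt0 : 0 < alpha.

Lemma hausdorff_D1 f : mu I1 = 0%E -> (forall w, exists D, cderiv f w D) ->
  (forall z, cintegrable mu D1 (hausdorff_integrand f z)) ->
  (forall z, cintegrable mu D0 (hausdorff_integrand f z)) /\
  hausdorff mu f = (fun z => cintegral mu D1 (hausdorff_integrand f z)).
Proof.
move=> mu0 fD i1.
have mI1 : measurable I1 by exact: measurable_itv.
have mD0 : measurable D0 by exact: measurable_itv.
have DE : D0 `\` I1 = D1.
  apply/seteqP; split => t /=; rewrite !in_itv/= !andbT.
    by move=> [t0 /negP]; rewrite t0/= ltNge.
  move=> t1; split; first exact: lt_trans t1.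
  by apply/negP; rewrite negb_and -!ltNge t1 orbT.
have i0 z : cintegrable mu D0 (hausdorff_integrand f z).
  have [m1 m2] := measurable_integrand z fD; have [j1 j2] := i1 z.
  split; apply/(negligible_integrable mI1 mD0 _ mu0); rewrite ?DE//; exact/measurable_EFinP.
split => //; apply/funext => z; have [k1 k2] := i0 z.
rewrite /hausdorff /cintegral /Rintegral.
by rewrite (negligible_integral mI1 mD0 k1 mu0) (negligible_integral mI1 mD0 k2 mu0) DE.
Qed.

(** The constant is [alpha / (2 pi)] from the norm, times [2 K] from the complex integral estimate,
    times [2 pi / alpha * S] from the Gaussian integral. *)
Lemma fock1_norm_hausdorff_le f (K S : R) : entire f -> 0 <= K ->
  (forall w, normc (f w) <= K * expR (alpha / 2 * normc w ^+ 2)) ->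
  let H := fun z => cintegral mu D1 (hausdorff_integrand f z) in
  (\int[mu]_(t in D1) (t^-1)%:E < +oo)%E ->
  (forall z, cintegrable mu D1 (hausdorff_integrand f z)) -> entire H ->
  (\int[mu]_(t in D1) ((t - 1)^-1)%:E <= S%:E)%E ->
  (fock1_norm alpha H <= (2 * S)%:E * K%:E)%E.
Proof.
move=> fe K0 fK H imu iH He HS.
have mD1 : measurable D1 by exact: measurable_itv.
have [mG EG] := gaussian_tonelli alpha_gt0 imu.
set G := (fun p => _) in mG EG.
have ig (r2 : R) : 0 <= r2 ->
    mu.-integrable D1 (EFin \o (fun t => expR (- (rate alpha t * r2)) * t^-1)).
  move=> r20.
  have m1 : measurable_fun D1 (fun t : R => expR (- (rate alpha t * r2)) * t^-1).
    apply: measurable_funM.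
      apply: measurable_funTS; apply: measurableT_comp => //; apply: measurable_funN.
      by apply: measurable_funM => //; exact: measurable_rate.
    apply/measurable_EFinP; apply: measurable_funS (measurable_expNr 1) => //.
    exact: subset_D1.
  have m2 : measurable_fun D1 (fun t : R => t^-1).
    apply/measurable_EFinP; apply: measurable_funS (measurable_expNr 1) => //.
    exact: subset_D1.
  apply: (@le_integrable _ _ _ mu _ mD1 _ (EFin \o (fun t => t^-1))).
  - exact/measurable_EFinP.
  - move=> t; rewrite /= in_itv/= andbT => t1; have t0 := lt_trans ltr01 t1.
    rewrite lee_fin normrM ler_piMl// ger0_norm ?expR_ge0// -expR0 ler_expR oppr_le0.
    by rewrite mulr_ge0// ltW// rate_gt0.
  - apply/integrableP; split; first exact/measurable_EFinP.
    apply: le_lt_trans imu; rewrite le_eqVlt; apply/orP; left; apply/eqP.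
    apply: eq_integral => t; rewrite inE/= in_itv/= andbT => t1.
    by rewrite ger0_norm// invr_ge0 ltW// (lt_trans ltr01).
(* The weight cancels the factor [e^(alpha |z|^2 / 2)] split off the growth of [f (z / t)], leaving
   exactly the Gaussian of [gaussian_tonelli]. *)
have wG p : ((weighted_modulus alpha H (p.1 +i* p.2))%:E <= (2 * K)%:E * G p)%E.
  case: p => x y; rewrite weighted_modulusE /G /=.
  set r2 := x ^+ 2 + y ^+ 2; set z := x +i* y.
  have r20 : 0 <= r2 by rewrite addr_ge0 ?sqr_ge0.
  have zr : normc z ^+ 2 = r2 by rewrite sqr_normc.
  have B := @normc_cintegral_le _ _ _ _ _ mD1 (hausdorff_integrand f z)
    (fun t => K * expR (alpha / 2 * r2) * (expR (- (rate alpha t * r2)) * t^-1)) (iH z) _ _.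
  rewrite -[X in (_ <= _ * X)%E]fineK; last exact: (integrable_fin_num mD1 (ig _ r20)).
  rewrite -EFinM lee_fin.
  apply: (@le_trans _ _ (2 * (K * expR (alpha / 2 * r2) *
      \int[mu]_(t in D1) (expR (- (rate alpha t * r2)) * t^-1)) * expR (- (alpha / 2) * r2))).
    rewrite ler_wpM2r ?expR_ge0//; apply: (le_trans (B _ _)).
    - by apply: (integrableZl mD1 _ (ig _ r20)).
    - move=> t; rewrite /= in_itv/= andbT => t1; have t0 := lt_trans ltr01 t1.
      rewrite /hausdorff_integrand Normc.normcM Normc.normcV normc_real (ger0_norm (ltW t0)).
      rewrite mulrA ler_pM2r ?invr_gt0//; apply: (le_trans (fK _)).
      rewrite -[leRHS]mulrA ler_wpM2l// -expRD ler_expR Normc.normcM Normc.normcV normc_real.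
      rewrite (ger0_norm (ltW t0)) exprMn zr /rate /cutinv t1.
      by rewrite le_eqVlt; apply/orP; left; apply/eqP; ring.
    - by rewrite RintegralZl//; exact: ig.
  rewrite le_eqVlt; apply/orP; left; apply/eqP.
  rewrite (_ : _ * expR (- (alpha / 2) * r2) = 2 * K * (expR (alpha / 2 * r2) * expR (- (alpha / 2) * r2)) *
      \int[mu]_(t in D1) (expR (- (rate alpha t * r2)) * t^-1)); last by ring.
  by rewrite -expRD mulNr subrr expR0 mulr1.
have pa0 : 0 < alpha / (2 * pi) by rewrite divr_gt0// mulr_gt0// pi_gt0.
have G0 p : (0 <= G p)%E.
  apply: integral_ge0 => t; rewrite /= in_itv/= andbT => t1.
  by rewrite lee_fin mulr_ge0 ?expR_ge0// invr_ge0 ltW// (lt_trans ltr01).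
have le1 : (\int[leb \x leb]_p (weighted_modulus alpha H (p.1 +i* p.2))%:E <=
    (2 * K)%:E * \int[leb \x leb]_p G p)%E.
  rewrite -ge0_integralZl_EFin//; last by rewrite mulr_ge0.
  apply: ge0_le_integral => //.
  - by move=> p _; rewrite lee_fin weighted_modulus_ge0.
  - by apply/measurable_EFinP; exact: measurable_weighted_modulus.
  - by apply: emeasurable_funM => //; exact: measurable_cst.
have le2 : (\int[leb \x leb]_p G p <= (2 * pi / alpha * S)%:E)%E.
  have pa : 0 <= 2 * pi / alpha by rewrite divr_ge0 ?mulr_ge0 ?pi_ge0// ltW.
  rewrite EG EFinM; apply: le_trans (lee_wpmul2l _ HS); last by rewrite lee_fin.
  have mV (c : R) : 0 <= c + 1 -> measurable_fun D1 (fun t : R => (t + c)^-1).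
    move=> c1; apply: open_continuous_measurable_fun; first exact: interval_open.
    move=> t; rewrite inE/= in_itv/= andbT => t1.
    apply: (continuous_comp (f := fun t : R => t + c)).
      by apply: cvgD; [exact: cvg_id|exact: cvg_cst].
    by apply: inv_continuous; rewrite gt_eqF//; lra.
  have m1 : measurable_fun D1 (fun t : R => (t - 1)^-1) by apply: mV; rewrite addNr.
  rewrite -ge0_integralZl_EFin//; last 2 first.
  - by move=> t; rewrite /= in_itv/= andbT => t1; rewrite lee_fin invr_ge0 subr_ge0 ltW.
  - exact/measurable_EFinP.
  (* The surplus factor [t / (t + 1)] is below 1, which leaves the function whose integral the sum
     of the moments dominates. *)
  have tE t : D1 t -> pi / rate alpha t * t^-1 = 2 * pi / alpha * ((t - 1)^-1 * (t / (t + 1))).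
    rewrite /= in_itv/= andbT => t1; have t0 := lt_trans ltr01 t1.
    rewrite /rate /cutinv t1; field.
    by rewrite !subr_eq0 !gt_eqF// ?addr_gt0// exprn_egt1.
  have tle t : D1 t -> (pi / rate alpha t * t^-1 <= 2 * pi / alpha * (t - 1)^-1).
    move=> t1; rewrite tE// ler_wpM2l//; move: t1; rewrite /= in_itv/= andbT => t1.
    have t0 := lt_trans ltr01 t1.
    rewrite ler_piMr ?invr_ge0 ?subr_ge0 ?ltW// ltr_pdivrMr ?addr_gt0// mul1r ltrDl//.
  have mt : measurable_fun D1 (fun t : R => pi / rate alpha t * t^-1).
    have : measurable_fun D1 (fun t : R => 2 * pi / alpha * ((t - 1)^-1 * (t / (t + 1)))).
      do 3?apply: measurable_funM => //.
      by apply: mV; rewrite addr_ge0.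
    by apply: eq_measurable_fun => t; rewrite inE => /tE.
  apply: ge0_le_integral => //.
  - move=> t; rewrite /= in_itv/= andbT => t1.
    by rewrite lee_fin !mulr_ge0 ?pi_ge0 ?invr_ge0 ?(ltW (rate_gt0 _ _))// ltW// (lt_trans ltr01).
  - exact/measurable_EFinP.
  - by apply/measurable_EFinP; apply: measurable_funM.
have -> : ((2 * S)%:E * K%:E = (alpha / (2 * pi))%:E * ((2 * K)%:E * (2 * pi / alpha * S)%:E))%E.
  rewrite -!EFinM; congr (_%:E); move: (pi : R) (pi_gt0 R) => p p0; field.
  by rewrite (lt0r_neq0 alpha_gt0) (lt0r_neq0 p0).
rewrite /fock1_norm; apply: lee_wpmul2l; first by rewrite lee_fin ltW.
apply: (le_trans le1); apply: lee_wpmul2l => //.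
by rewrite lee_fin mulr_ge0.
Qed.

Lemma sufficient_condition : (\sum_(0 <= n <oo) hausdorff_moment mu n < +oo)%E ->
  hausdorff_bounded mu (fockoo alpha) (fockoo_norm alpha) (fock1 alpha) (fock1_norm alpha).
Proof.
move=> summable; have mu0 := measure_I1 summable.
have mD1 : measurable D1 by exact: measurable_itv.
have imu := moment_inv_lty mD1 (@subset_D1 R) (moment_lty summable 0).
have S0 : (0 <= \sum_(0 <= n <oo) hausdorff_moment mu n)%E.
  by apply: nneseries_ge0 => n _ _; exact: hausdorff_moment_ge0.
have HS := integral_inv_sub1 mu.
have /fineK SE : (\sum_(0 <= n <oo) hausdorff_moment mu n)%E \is a fin_num.
  by rewrite ge0_fin_numE.
rewrite -SE in HS; set S := fine _ in SE HS.
have iinv : mu.-integrable D1 (EFin \o (fun t => t^-1)).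
  apply/integrableP; split.
    apply: measurable_funS (measurable_expNr 1) => //; exact: subset_D1.
  apply: le_lt_trans imu; rewrite le_eqVlt; apply/orP; left; apply/eqP.
  apply: eq_integral => t; rewrite inE/= in_itv/= andbT => t1.
  by rewrite ger0_norm// invr_ge0 ltW// (lt_trans ltr01).
have main f : fockoo alpha f -> [/\
    forall z, cintegrable mu D0 (hausdorff_integrand f z),
    entire (hausdorff mu f) &
    (fock1_norm alpha (hausdorff mu f) <= (2 * S)%:E * fockoo_norm alpha f)%E].
  move=> ff; have [K [K0 KE fK]] := fockoo_growth ff.
  have fB := fockoo_bounded_on_balls (ltW alpha_gt0) ff.
  have [fe _] := ff; have fD := (entireP f).1 fe.
  have iH z := cintegrable_integrand iinv z fD fB.
  have [i0 HE] := hausdorff_D1 mu0 fD iH.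
  have He : entire (hausdorff mu f).
    by rewrite HE; apply/entireP; exact: cderiv_cintegral.
  split => //; rewrite KE HE; rewrite HE in He.
  exact: fock1_norm_hausdorff_le.
split.
  move=> f ff; have [i0 He Hle] := main f ff; split => //; split => //.
  by apply: (le_lt_trans Hle); have [K [K0 -> _]] := fockoo_growth ff; rewrite -EFinM ltry.
by exists (2 * S) => f /main[].
Qed.

End SufficientCondition.

(** * Estimates of Gaussian integrals *)

Section GaussianCosine.
Context {R : realType}.
Implicit Types (a x y N u : R).
Local Notation leb := (@lebesgue_measure R).

Lemma continuous_integrable (f : R -> R) (a b : R) : continuous f ->
  leb.-integrable `[a, b] (EFin \o f).
Proof.
by move=> cf; apply: continuous_compact_integrable;
  [exact: segment_compact|exact: continuous_subspaceT].
Qed.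

Lemma sin_le_id u : 0 <= u -> sin u <= u.
Proof.
move=> u0; have := Rintegral_FTC (@is_derive_sin R) (@continuous_cos R) u0.
rewrite sin0 subr0 => <-.
apply: (@le_trans _ _ (\int[leb]_(t in `[0, u]) 1)).
  apply: le_Rintegral => //.
  - exact: continuous_integrable (@continuous_cos R).
  - by apply: continuous_integrable => x; exact: cvg_cst.
rewrite Rintegral_cst//= lebesgue_measure_itv/= lte_fin mul1r.
by case: ltP => _ //=; rewrite oppr0 addr0.
Qed.

(** Integrates [sin t <= t], itself the integral of [cos t <= 1], from 0 to [|u|]. *)
Lemma cos_ge_quadratic u : 1 - u ^+ 2 / 2 <= cos u.
Proof.
wlog u0 : u / 0 <= u => [H|].
  have [|/ltW u0] := leP 0 u; first exact: H.
  by rewrite -cosN -sqrrN; apply: H; rewrite oppr_ge0.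
have cs : continuous (fun t : R => - sin t).
  by move=> t; apply: cvgN; exact: continuous_sin.
have := Rintegral_FTC (@is_derive_cos R) cs u0; rewrite cos0 => E.
have : \int[leb]_(t in `[0, u]) (- t) <= \int[leb]_(t in `[0, u]) (- sin t).
  apply: le_Rintegral => //.
  - by apply: continuous_integrable => x; apply: cvgN; exact: cvg_id.
  - exact: continuous_integrable.
  - by move=> t; rewrite /= in_itv/= => /andP[t0 _]; rewrite lerN2 sin_le_id.
rewrite E (_ : \int[leb]_(t in `[0, u]) (- t) = - (u ^+ 2 / 2)); first by lra.
have -> : (fun t : R => - t) = (fun t => -1 * t) by apply/funext => t; rewrite mulN1r.
rewrite RintegralZl//; last by apply: continuous_integrable => x; exact: cvg_id.
by rewrite Rintegral_id// expr0n subr0 mulN1r.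
Qed.

Lemma continuous_gauss a : continuous (fun x => expR (- (a * x ^+ 2))).
Proof.
move=> x; apply: continuous_comp; last exact: continuous_expR.
by apply: cvgN; apply: cvgM; [exact: cvg_cst|exact: exprn_continuous].
Qed.

Lemma continuous_gauss_cos a y :
  continuous (fun x => expR (- (a * x ^+ 2)) * cos (2 * a * x * y)).
Proof.
move=> x; apply: cvgM; first exact: continuous_gauss.
apply: (@continuous_comp _ _ _ (fun x : R => 2 * a * x * y) cos); last exact: continuous_cos.
by apply: cvgM; [apply: cvgM; [exact: cvg_cst|exact: cvg_id]|exact: cvg_cst].
Qed.

(* [(1 - a x^2) e^(-a x^2)] is half of [e^(-a x^2) + (x e^(-a x^2))']. *)
Lemma gauss_cos_ge a y N : 0 <= a -> 2 * a * y ^+ 2 <= 1 -> 0 <= N ->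
  1 / 2 * \int[leb]_(x in `[0, N]) expR (- (a * x ^+ 2)) <=
  \int[leb]_(x in `[0, N]) (expR (- (a * x ^+ 2)) * cos (2 * a * x * y)).
Proof.
move=> a0 ay N0.
pose F x := x / 2 * expR (- (a * x ^+ 2)).
pose g x := (1 / 2 - a * x ^+ 2) * expR (- (a * x ^+ 2)).
have dF x : is_derive x (1 : R) F (g x).
  have De : is_derive x (1 : R) (fun x => expR (- (a * x ^+ 2))) (- (a * (x *+ 2)) * expR (- (a * x ^+ 2))).
    apply: is_derive_eq; rewrite /GRing.scale/=; ring.
  by apply: is_derive_eq; rewrite /g /GRing.scale/=; field.
have cg : continuous g.
  move=> x; apply: cvgM; last exact: continuous_gauss.
  apply: cvgB; first exact: cvg_cst.
  by apply: cvgM; [exact: cvg_cst|exact: exprn_continuous].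
have E := Rintegral_FTC dF cg N0.
have E0 : 0 <= \int[leb]_(t in `[0, N]) g t.
  by rewrite E /F mul0r mul0r subr0 mulr_ge0 ?expR_ge0// divr_ge0.
apply: (@le_trans _ _ (\int[leb]_(x in `[0, N]) (1 / 2 * expR (- (a * x ^+ 2)) + g x))).
  rewrite RintegralD//.
  - by rewrite RintegralZl ?lerDl//; exact: continuous_integrable (@continuous_gauss a).
  - by apply: continuous_integrable => x; apply: cvgM; [exact: cvg_cst|exact: continuous_gauss].
  - exact: continuous_integrable.
apply: le_Rintegral => //.
- apply: continuous_integrable => x; apply: cvgD; last exact: cg.
  by apply: cvgM; [exact: cvg_cst|exact: continuous_gauss].
- exact: continuous_integrable (@continuous_gauss_cos a y).
- move=> x _; rewrite /g -mulrDl mulrC ler_wpM2l ?expR_ge0//.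
  apply: le_trans (cos_ge_quadratic _).
  have ax : 0 <= a * x ^+ 2 by rewrite mulr_ge0 ?sqr_ge0.
  have -> : (2 * a * x * y) ^+ 2 / 2 = a * x ^+ 2 * (2 * a * y ^+ 2) by field.
  have := ler_wpM2l ax ay; lra.
Qed.

(** On [[0, l]] the exponent is at least [-1]; the rest of the interval only adds. *)
Lemma gauss_int_ge a (l N : R) : 0 <= a -> 0 <= l <= N -> a * l ^+ 2 <= 1 ->
  l * expR (-1) <= \int[leb]_(x in `[0, N]) expR (- (a * x ^+ 2)).
Proof.
move=> a0 /andP[l0 lN] al.
have iN := @continuous_integrable _ 0 N (@continuous_gauss a).
rewrite (Rintegral_split iN l0 lN).
rewrite -[leLHS]addr0; apply: lerD; last by apply: Rintegral_ge0 => x _; exact: expR_ge0.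
apply: (@le_trans _ _ (\int[leb]_(x in `[0, l]) expR (-1))).
  rewrite Rintegral_cst//= lebesgue_measure_itv/= lte_fin mulrC.
  by case: ltP => [_|l1] /=; [rewrite oppr0 addr0|rewrite (le_anti (andb_true_intro (conj l0 l1)))].
apply: le_Rintegral => //.
- by apply: continuous_integrable => x; exact: cvg_cst.
- exact: continuous_integrable (@continuous_gauss a).
- move=> x; rewrite /= in_itv/= => /andP[x0 xl]; rewrite ler_expR lerN2.
  apply: le_trans al; rewrite ler_wpM2l// ler_pXn2r// nnegrE//; exact: le_trans xl.
Qed.

(** A finite, explicit form of [sum_k u^k (k + 1)^(-1/2) = O((1 - u)^(-1/2))], resting on [1 / sqrt
    (k + 1) <= 2 (sqrt (k + 1) - sqrt k)]. *)
Lemma sum_sqrt_inv_le u (n : nat) (s : R) : 0 < s -> u = 1 - s ^+ 2 -> 0 <= u ->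
  \sum_(k < n) u ^+ k * (Num.sqrt k.+1%:R)^-1 <= 2 / s.
Proof.
move=> s0 uE u0.
have sq (k : nat) : Num.sqrt k%:R ^+ 2 = k%:R :> R by rewrite sqr_sqrtr.
(* The strengthened bound is built for induction: with [r = sqrt (n + 1)] and [q = sqrt n], it grows
   by [u^n (2 r - 2 q)] plus the nonnegative [u^n s (1 - s r)^2]. It falls short of [2 / s] by
   [u^n (1 + (1 - s q)^2) / s]. *)
have H : \sum_(k < n) u ^+ k * (Num.sqrt k.+1%:R)^-1 <=
    2 * (1 - u ^+ n) / s + u ^+ n * (2 * Num.sqrt n%:R - s * n%:R).
  elim: n => [|n IH]; first by rewrite big_ord0 expr0 subrr mulr0 mul0r sqrtr0 !mulr0 subrr mulr0 addr0.
  rewrite big_ord_recr/=; apply: (le_trans (lerD IH (lexx _))).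
  have un : 0 <= u ^+ n by rewrite exprn_ge0.
  set q := Num.sqrt n%:R; set r := Num.sqrt n.+1%:R.
  have r0 : 0 < r by rewrite sqrtr_gt0.
  have q0 : 0 <= q by rewrite sqrtr_ge0.
  have nE : n%:R = r ^+ 2 - 1 by rewrite /r sq -natr1 addrK.
  have qE : q ^+ 2 = r ^+ 2 - 1 by rewrite -nE /q sq.
  have c : r^-1 <= 2 * r - 2 * q.
    rewrite -[r^-1]mul1r ler_pdivrMr//.
    by have := sqr_ge0 (r - q); lra.
  have n1E : n.+1%:R = r ^+ 2 by rewrite /r sq.
  rewrite n1E nE.
  have -> : 2 * (1 - u ^+ n.+1) / s + u ^+ n.+1 * (2 * r - s * r ^+ 2) =
     2 * (1 - u ^+ n) / s + u ^+ n * (2 * q - s * (r ^+ 2 - 1)) + u ^+ n * (2 * r - 2 * q) +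
     u ^+ n * (s * (1 - s * r) ^+ 2).
    by rewrite exprS; move: (u ^+ n) => w; rewrite uE; field; rewrite gt_eqF.
  have := ler_wpM2l un c.
  have := mulr_ge0 un (mulr_ge0 (ltW s0) (sqr_ge0 (1 - s * r))).
  lra.
apply: (le_trans H).
have un : 0 <= u ^+ n by rewrite exprn_ge0.
have -> : 2 * (1 - u ^+ n) / s + u ^+ n * (2 * Num.sqrt n%:R - s * n%:R) =
   2 / s - u ^+ n * ((1 + (1 - s * Num.sqrt n%:R) ^+ 2) / s).
  by rewrite -{2}(sq n); field; rewrite gt_eqF.
rewrite lerBlDr lerDl mulr_ge0// divr_ge0 ?ltW//.
by rewrite ltr_wpDr ?sqr_ge0.
Qed.

End GaussianCosine.

(** * Monomials *)

Section NecessaryMoments.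
Context {R : realType}.
Variable alpha : R.
Hypothesis alpha_gt0 : 0 < alpha.
Local Notation leb := (@lebesgue_measure R).

(** [gauss_int_ge] is used with [l] the smaller of [n] and [a^(-1/2)]. In the first case the sum is
    at most [n]; in the second it is at most [2 / sqrt (1 - w)]. The constant [1 + 2 sqrt alpha]
    covers both. The cut at [n] keeps the case [w = 1], where [a = 0], meaningful. *)
Lemma sum_le_gauss_int (w : R) (n : nat) : 0 <= w <= 1 ->
  \sum_(k < n) w ^+ k * (Num.sqrt k.+1%:R)^-1 <= expR 1 * (1 + 2 * Num.sqrt alpha) *
    \int[leb]_(x in `[0, n%:R]) expR (- (alpha / 2 * (1 - w ^+ 2) * x ^+ 2)).
Proof.
move=> /andP[w0 w1]; set a := alpha / 2 * (1 - w ^+ 2).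
have w21 : 0 <= 1 - w ^+ 2 by rewrite subr_ge0 expr_le1.
have a0 : 0 <= a by rewrite mulr_ge0// divr_ge0// ltW.
have sa0 : 0 < Num.sqrt alpha by rewrite sqrtr_gt0.
have key (l : R) : 0 <= l <= n%:R -> a * l ^+ 2 <= 1 ->
    \sum_(k < n) w ^+ k * (Num.sqrt k.+1%:R)^-1 <= (1 + 2 * Num.sqrt alpha) * l ->
    \sum_(k < n) w ^+ k * (Num.sqrt k.+1%:R)^-1 <= expR 1 * (1 + 2 * Num.sqrt alpha) *
      \int[leb]_(x in `[0, n%:R]) expR (- (a * x ^+ 2)).
  move=> ln al /le_trans; apply.
  apply: (@le_trans _ _ (expR 1 * (1 + 2 * Num.sqrt alpha) * (l * expR (-1)))).
    rewrite le_eqVlt; apply/orP; left; apply/eqP.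
    have -> : expR 1 * (1 + 2 * Num.sqrt alpha) * (l * expR (-1)) =
      expR 1 * expR (-1) * ((1 + 2 * Num.sqrt alpha) * l) by ring.
    by rewrite -expRD subrr expR0 mul1r.
  rewrite ler_wpM2l//; last exact: gauss_int_ge.
have [an|an] := leP (a * n%:R ^+ 2) 1.
  apply: (key n%:R); rewrite ?ler0n ?lexx//.
  apply: (@le_trans _ _ n%:R).
    apply: (@le_trans _ _ (\sum_(k < n) 1)); last by rewrite sumr_const card_ord.
    apply: ler_sum => k _; rewrite -[leRHS]mulr1; apply: ler_pM.
    - exact: exprn_ge0.
    - by rewrite invr_ge0 sqrtr_ge0.
    - exact: exprn_ile1.
    - by rewrite invf_le1 ?sqrtr_gt0// -[leLHS]sqrtr1 ler_sqrt// ler1n.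
  by rewrite ler_peMl// lerDl mulr_ge0 ?sqrtr_ge0.
have n0 : 0 < n%:R :> R.
  by rewrite ltr0n lt0n; apply: contraTneq an => ->; rewrite expr0n mulr0 -leNgt.
have ap : 0 < a.
  by rewrite lt_neqAle a0 andbT; apply: contraTneq an => <-; rewrite mul0r -leNgt.
have w1' : w < 1.
  rewrite lt_neqAle w1 andbT; apply: contraTneq ap => wE.
  by rewrite /a wE expr1n subrr mulr0 ltxx.
pose s := Num.sqrt (1 - w).
have s0 : 0 < s by rewrite sqrtr_gt0 subr_gt0.
have s2 : s ^+ 2 = 1 - w by rewrite sqr_sqrtr// subr_ge0.
have q0 : 0 < Num.sqrt a by rewrite sqrtr_gt0.
(* This is [1 - w^2 = (1 - w) (1 + w) <= 2 (1 - w)]. *)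
have qs : Num.sqrt a <= Num.sqrt alpha * s.
  rewrite -sqrtrM ?(ltW alpha_gt0)// ler_sqrt; last by rewrite mulr_ge0 ?subr_ge0// ltW.
  rewrite /a (_ : 1 - w ^+ 2 = (1 - w) * (1 + w)); last by ring.
  have w1n : 0 <= 1 - w by rewrite subr_ge0.
  by have := mulr_ge0 (mulr_ge0 (ltW alpha_gt0) w1n) w1n; lra.
apply: (key (Num.sqrt a)^-1).
- rewrite invr_ge0 sqrtr_ge0/= -[leRHS]invrK lef_pV2 ?posrE ?invr_gt0//.
  rewrite -(@ler_pXn2r _ 2) ?nnegrE ?invr_ge0 ?ler0n ?sqrtr_ge0//.
  by rewrite sqr_sqrtr ?exprVn ?(ltW ap)// -[leLHS]mul1r ler_pdivrMr ?exprn_gt0// ltW.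
- by rewrite exprVn sqr_sqrtr ?(ltW ap)// divff// gt_eqF.
- apply: (le_trans (@sum_sqrt_inv_le _ w n s s0 _ w0)); first by rewrite s2 subKr.
  rewrite ler_pdivlMr// mulrAC ler_pdivrMr//.
  have := sqrtr_ge0 alpha; nra.
Qed.

Variable mu : {measure set (measurableTypeR R) -> \bar R}.
Local Notation D0 := (`]0, +oo[%classic : set (measurableTypeR R)).
Hypothesis bounded : hausdorff_bounded mu (fockoo alpha) (fockoo_norm alpha)
                        (fock1 alpha) (fock1_norm alpha).

Lemma monomial_entire (m : nat) : entire (fun z : R[i] => z ^+ m).
Proof.
apply/entireP => w; elim: m => [|m [D IH]].
  by exists 0; rewrite (_ : (fun z => _) = fun=> 1)//; exact: cderiv_cst.
by eexists; rewrite (_ : (fun z => _) = fun z => z * z ^+ m);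
  [exact: (cderivM (@cderiv_id _ w) IH)|apply/funext => z; rewrite exprS].
Qed.

(** The right side is the value at the maximum [s = 2 m / alpha]. Scaling that point to [x = 1], the
    claim is the [m]-th power of [x <= e^(x - 1)]. *)
Lemma monomial_growth (m : nat) (s : R) : 0 <= s ->
  s ^+ m * expR (- (alpha / 2 * s)) <= (2 * m%:R / alpha) ^+ m * expR (- m%:R).
Proof.
move=> s0; case: m => [|m].
  by rewrite !expr0 !mul1r oppr0 ler_expR oppr_le0 mulr_ge0// divr_ge0// ltW.
have m0 : 0 < m.+1%:R :> R by [].
pose x := alpha * s / (2 * m.+1%:R).
have x0 : 0 <= x by rewrite divr_ge0 ?mulr_ge0 ?ler0n ?(ltW alpha_gt0).
have sx : s = (2 * m.+1%:R / alpha) * x.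
  by rewrite /x; field; rewrite !gt_eqF.
have : x ^+ m.+1 <= expR (alpha / 2 * s - m.+1%:R).
  have -> : alpha / 2 * s - m.+1%:R = (x - 1) * m.+1%:R.
    by rewrite /x; field; rewrite gt_eqF.
  rewrite expRM_natr ler_pXn2r ?nnegrE ?expR_ge0//.
  by have := expR_ge1Dx (x - 1); rewrite addrC subrK.
rewrite expRD => H.
have -> : s ^+ m.+1 = (2 * m.+1%:R / alpha) ^+ m.+1 * x ^+ m.+1 by rewrite -exprMn -sx.
rewrite -[leLHS]mulrA ler_wpM2l//.
  by rewrite exprn_ge0// divr_ge0 ?mulr_ge0 ?ler0n ?(ltW alpha_gt0).
by rewrite expRN ler_pdivrMr ?expR_gt0// mulrC.
Qed.

Lemma monomial_norm (m : nat) : (fockoo_norm alpha (fun z => (z ^+ (2 * m))%R) <=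
  ((2 * m%:R / alpha) ^+ m * expR (- m%:R))%:E)%E.
Proof.
apply: ge_ereal_sup => _ [z _ <-]; rewrite lee_fin /weighted_modulus normcX exprM mulNr.
by apply: monomial_growth; rewrite sqr_ge0.
Qed.

Lemma monomial_fockoo (m : nat) : fockoo alpha (fun z => z ^+ (2 * m)).
Proof.
split; first exact: monomial_entire.
by apply: (le_lt_trans (monomial_norm m)); rewrite ltry.
Qed.

(** At [z = 1] the integrand of the monomial [z^(2m)] is [t^-(2m + 1)], so well-definedness of the
    operator alone gives the finite moment. Even exponents make [|z|^(2m)] a power of [|z|^2]. *)
Lemma moment_integrable (m : nat) : mu.-integrable D0 (EFin \o (fun t => t ^- (2 * m).+1)).
Proof.
have [/(_ 1)[+ _] _] := bounded.1 _ (monomial_fockoo m).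
apply: eq_integrable; first exact: measurable_itv.
move=> t; rewrite inE/= in_itv/= andbT => t0; congr (_%:E).
rewrite /hausdorff_integrand mul1r exprVn -fmorphV -!rmorphXn -fmorphV/=.
by rewrite mulr0 subr0 exprS invfM mulrC.
Qed.

Lemma moment_fin_num (m : nat) : hausdorff_moment mu (2 * m) \is a fin_num.
Proof. by apply: (integrable_fin_num _ (moment_integrable m)); exact: measurable_itv. Qed.

Lemma hausdorff_monomial (m : nat) (z : R[i]) :
  hausdorff mu (fun z => z ^+ (2 * m)) z = z ^+ (2 * m) * (fine (hausdorff_moment mu (2 * m)))%:C.
Proof.
have mD0 : measurable D0 by exact: measurable_itv.
transitivity (cintegral mu D0 (fun t : R => z ^+ (2 * m) * (t ^- (2 * m).+1)%:C)).
  apply: eq_cintegral => t; rewrite inE/= in_itv/= andbT => t0.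
  rewrite /hausdorff_integrand exprMn exprVn -mulrA; congr (_ * _).
  by rewrite -!rmorphXn -!fmorphV -rmorphM/= exprS invfM mulrC.
have ic : cintegrable mu D0 (fun t : R => (t ^- (2 * m).+1)%:C).
  split; first exact: moment_integrable.
  rewrite (_ : _ \o _ = cst 0%E)//; exact: integrable0.
rewrite cintegralZ//; congr (_ * _); rewrite /cintegral /=.
by congr (_ +i* _); rewrite Rintegral_cst//= mul0r.
Qed.

End NecessaryMoments.

(** * The measure vanishes on the open unit interval *)

Section NullUnitInterval.
Context {R : realType}.
Variable alpha : R.
Hypothesis alpha_gt0 : 0 < alpha.
Local Notation leb := (@lebesgue_measure R).
Variable mu : {measure set (measurableTypeR R) -> \bar R}.
Local Notation D0 := (`]0, +oo[%classic : set (measurableTypeR R)).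
Hypothesis bounded : hausdorff_bounded mu (fockoo alpha) (fockoo_norm alpha)
                        (fock1 alpha) (fock1_norm alpha).

Lemma fine_moment_ge0 n : 0 <= fine (hausdorff_moment mu n).
Proof. exact/fine_ge0/hausdorff_moment_ge0. Qed.

(* The box is chosen next to [|z| = rho], where [|z|^(2m) e^(-alpha |z|^2 / 2)] is maximal. *)
Lemma fock1_norm_monomial_ge (m : nat) (rho : R) : (0 < m)%N ->
  rho = Num.sqrt (2 * m%:R / alpha) ->
  ((alpha / (2 * pi) * (fine (hausdorff_moment mu (2 * m)) * (2 * m%:R / alpha) ^+ m *
     expR (- m%:R) * expR (- (alpha / 2 * (3 + alpha / 2))) / rho))%:E <=
   fock1_norm alpha (hausdorff mu (fun z => (z ^+ (2 * m))%R)))%E.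
Proof.
move=> m0 rhoE; set H := hausdorff _ _.
have mR0 : 0 < m%:R :> R by rewrite ltr0n.
have r2 : rho ^+ 2 = 2 * m%:R / alpha.
  by rewrite rhoE sqr_sqrtr// divr_ge0 ?mulr_ge0 ?ler0n// ltW.
have r0 : 0 < rho by rewrite rhoE sqrtr_gt0 divr_gt0 ?mulr_gt0.
have He : entire H by have [_ []] := bounded.1 _ (monomial_fockoo alpha_gt0 m).
set v := fine (hausdorff_moment mu (2 * m)) * (2 * m%:R / alpha) ^+ m *
     expR (- m%:R) * expR (- (alpha / 2 * (3 + alpha / 2))).
have v0 : 0 <= v.
  by rewrite !mulr_ge0 ?expR_ge0 ?fine_moment_ge0// exprn_ge0// divr_ge0 ?mulr_ge0 ?ler0n// ltW.
rewrite /fock1_norm EFinM; apply: lee_wpmul2l.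
  by rewrite lee_fin divr_ge0 ?mulr_ge0 ?pi_ge0// ltW.
(* With width [1 / rho] and height 1, [|z|^2] exceeds [rho^2] by at most
   [2 + rho^-2 + 1 <= 3 + alpha / 2], so the weight loses only a constant factor, independent of
   [m]. *)
pose B : set (measurableTypeR R * measurableTypeR R) :=
  `[rho, rho + rho^-1]%classic `*` `[0, 1]%classic.
have mB : measurable B by apply: measurableX; exact: measurable_itv.
have aB : area_measure B = (rho^-1)%:E.
  rewrite /area_measure [LHS]product_measure1E; [|exact: measurable_itv|exact: measurable_itv].
  have L1 : leb `[rho, rho + rho^-1]%classic = (rho^-1)%:E.
    by rewrite lebesgue_measure_itv/= lte_fin ltrDl invr_gt0 r0 -EFinB addrC addKr.
  have L2 : leb `[0, 1]%classic = 1%E.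
    by rewrite lebesgue_measure_itv/= lte_fin ltr01 sube0.
  transitivity ((rho^-1)%:E * 1)%E; last by rewrite mule1.
  by congr (_ * _)%E; [exact: L1|exact: L2].
have m1 := measurable_weighted_modulus alpha He.
apply: (@le_trans _ _ (\int[area_measure]_(p in B) (weighted_modulus alpha H (p.1 +i* p.2))%:E)%E).
  rewrite (_ : (v / rho)%:E = \int[area_measure]_(p in B) v%:E)%E; last first.
    by rewrite integral_cst// aB -EFinM.
  apply: ge0_le_integral => //.
  - by apply/measurable_EFinP; exact: measurable_funTS.
  - move=> [x y] [/=]; rewrite !in_itv/= => /andP[x1 x2] /andP[y1 y2].
    rewrite lee_fin weighted_modulusE /H (hausdorff_monomial alpha_gt0 bounded).
    rewrite Normc.normcM normc_real normcX exprM sqr_normc/= (ger0_norm (fine_moment_ge0 _)).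
    set s := x ^+ 2 + y ^+ 2.
    have s1 : rho ^+ 2 <= s.
      rewrite /s -[leLHS]addr0 lerD ?sqr_ge0// ler_pXn2r// ?nnegrE ltW//; exact: lt_le_trans x1.
    have s2 : s <= rho ^+ 2 + (3 + alpha / 2).
      have x3 : x ^+ 2 <= (rho + rho^-1) ^+ 2.
        rewrite ler_pXn2r// nnegrE ?addr_ge0 ?invr_ge0 ?(ltW r0)//; exact: le_trans (ltW r0) x1.
      have y3 : y ^+ 2 <= 1 by rewrite expr_le1.
      have i2 : rho^-1 ^+ 2 <= alpha / 2.
        rewrite exprVn r2 invf_div ler_wpM2l ?(ltW alpha_gt0)// lef_pV2 ?posrE ?mulr_gt0//.
        by rewrite ler_peMr// ler1n.
      have rr : rho * rho^-1 = 1 by rewrite divff// gt_eqF.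
      by move: x3; rewrite sqrrD rr /s; lra.
    have -> : v = fine (hausdorff_moment mu (2 * m)) * ((2 * m%:R / alpha) ^+ m *
        (expR (- m%:R) * expR (- (alpha / 2 * (3 + alpha / 2))))) by rewrite /v; ring.
    rewrite [leRHS]mulrAC [leRHS]mulrC ler_wpM2l ?fine_moment_ge0//.
    apply: ler_pM.
    + by rewrite exprn_ge0// -r2 sqr_ge0.
    + by rewrite mulr_ge0 ?expR_ge0.
    + rewrite -r2 ler_pXn2r// nnegrE ?sqr_ge0//; exact: le_trans (sqr_ge0 _) s1.
    + rewrite -expRD ler_expR mulNr -opprD lerN2.
      apply: (@le_trans _ _ (alpha / 2 * (rho ^+ 2 + (3 + alpha / 2)))).
        by rewrite ler_wpM2l// divr_ge0// ltW.
      by rewrite r2 le_eqVlt; apply/orP; left; apply/eqP; field; rewrite gt_eqF.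
apply: ge0_subset_integral => //; first exact/measurable_EFinP.
by move=> p _; rewrite lee_fin weighted_modulus_ge0.
Qed.

(** The peak value [(2 m / alpha)^m e^(-m)] occurs in both norms and cancels, leaving
    [mu_(2m) <= const * rho]. As [rho] is of order [sqrt m], the linear bound is generous; it
    follows from [rho <= 1 + rho^2]. *)
Lemma moment_linear_growth : exists2 C : R, 0 <= C & forall m : nat, (0 < m)%N ->
  fine (hausdorff_moment mu (2 * m)) <= C * m.+1%:R.
Proof.
have [M HM] := bounded.2.
set c := expR (- (alpha / 2 * (3 + alpha / 2))).
have c0 : 0 < c by exact: expR_gt0.
have p0 : 0 < alpha / (2 * pi) by rewrite divr_gt0// mulr_gt0// pi_gt0.
have aC : 0 <= 1 + 2 / alpha by rewrite addr_ge0// divr_ge0// ltW.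
exists (`|M| / (alpha / (2 * pi) * c) * (1 + 2 / alpha)).
  by rewrite !mulr_ge0// invr_ge0 mulr_ge0// ltW.
move=> m m0; have mR0 : 0 < m%:R :> R by rewrite ltr0n.
have am : 0 < 2 * m%:R / alpha by rewrite divr_gt0 ?mulr_gt0.
have B := le_trans (fock1_norm_monomial_ge m0 erefl) (HM _ (monomial_fockoo alpha_gt0 m)).
have N0 : (0 <= fockoo_norm alpha (fun z : R[i] => (z ^+ (2 * m))%R))%E.
  apply: le_trans (ereal_sup_ubound _); last by exists 0.
  by rewrite lee_fin weighted_modulus_ge0.
have B2 : (M%:E * fockoo_norm alpha (fun z : R[i] => (z ^+ (2 * m))%R) <=
    (`|M| * ((2 * m%:R / alpha) ^+ m * expR (- m%:R)))%:E)%E.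
  rewrite EFinM; apply: (@le_trans _ _ (`|M|%:E * fockoo_norm alpha (fun z : R[i] => (z ^+ (2 * m))%R))%E).
    by rewrite lee_wpmul2r// lee_fin ler_norm.
  by apply: lee_wpmul2l; [rewrite lee_fin|exact: monomial_norm].
move: (le_trans B B2); rewrite lee_fin.
set rho := Num.sqrt _; set q := fine _; set t := _ ^+ m * expR _.
have t0 : 0 < t by rewrite mulr_gt0 ?expR_gt0// exprn_gt0.
have r0 : 0 < rho by rewrite sqrtr_gt0.
have rm : rho <= (1 + 2 / alpha) * m.+1%:R.
  apply: (@le_trans _ _ (1 + rho ^+ 2)).
    by have := sqr_ge0 (rho - 1); have := sqr_ge0 rho; rewrite sqrrB; lra.
  rewrite sqr_sqrtr ?(ltW am)// -natr1.
  have -> : 2 * m%:R / alpha = 2 / alpha * m%:R by ring.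
  have : 0 <= 2 / alpha by rewrite divr_ge0// ltW.
  have := ler0n R m; lra.
have -> : q * (2 * m%:R / alpha) ^+ m * expR (- m%:R) * c = q * c * t by rewrite /t; ring.
move=> K.
have : q * (alpha / (2 * pi) * c) / rho <= `|M|.
  rewrite -(ler_pM2r t0); apply: le_trans K.
  by rewrite le_eqVlt; apply/orP; left; apply/eqP; ring.
rewrite ler_pdivrMr// -ler_pdivlMr ?(mulr_gt0 p0 c0)// => /le_trans; apply.
by rewrite mulrAC -[leRHS]mulrA ler_wpM2l// divr_ge0 ?(ltW (mulr_gt0 p0 c0)).
Qed.

(** Mass [r > 0] on []0, q]] with [q < 1] forces [mu_(2m) >= r q^(-2m)], which outgrows every linear
    bound. Exhausting by [q = 1 - 1 / (n + 2)] reaches all of []0, 1[] but not the point 1. *)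
Lemma measure_lt1 : mu (`]0, 1[%classic : set (measurableTypeR R)) = 0%E.
Proof.
have [C C0 HC] := moment_linear_growth.
have H (q : R) : 0 < q < 1 -> mu (`]0, q]%classic : set (measurableTypeR R)) = 0%E.
  move=> /andP[q0 q1]; set A := (X in mu X).
  have mA : measurable A by exact: measurable_itv.
  have AD : A `<=` D0 by move=> t; rewrite /A /= !in_itv/= andbT => /andP[].
  have dq : 0 < q^-1 - 1 by rewrite subr_gt0 invf_gt1.
  have L m : (((q^-1 ^+ m) ^+ 2)%:E * mu A <= hausdorff_moment mu (2 * m))%E.
    apply: le_trans (moment_sub_le mu (2 * m) mA AD); rewrite -integral_cst//.
    apply: ge0_le_integral => //.
    - by move=> t _; rewrite lee_fin sqr_ge0.
    - by apply: measurable_funS (measurable_expNr (2 * m).+1) => //; exact: measurable_itv.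
    - move=> t; rewrite /A /= in_itv/= => /andP[t0 tq]; rewrite lee_fin -exprM mulnC exprVn.
      rewrite lef_pV2 ?posrE ?exprn_gt0// exprS.
      apply: (@le_trans _ _ (t ^+ (2 * m))).
        by rewrite ler_piMl ?exprn_ge0 ?(ltW t0)// (le_trans tq)// ltW.
      by apply: lerXn2r => //; rewrite nnegrE ltW.
  have fA : mu A \is a fin_num.
    rewrite ge0_fin_numE//; have := L 0%N; rewrite expr0 expr1n mul1e => /le_lt_trans; apply.
    by have := moment_fin_num alpha_gt0 bounded 0; rewrite ge0_fin_numE ?hausdorff_moment_ge0.
  have m0 := fine_ge0 (measure_ge0 mu A).
  rewrite -(fineK fA); congr (_%:E); apply/eqP; rewrite eq_le m0 andbT leNgt; apply/negP => r0.
  set r := fine _ in m0 r0; pose dl := q^-1 - 1.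
  have K (m : nat) : (0 < m)%N -> r * dl ^+ 2 * m%:R <= 2 * C.
    move=> mp; have mR : 0 < m%:R :> R by rewrite ltr0n.
    have := L m; rewrite -(fineK fA) -(fineK (moment_fin_num alpha_gt0 bounded m)) -EFinM lee_fin -/r.
    move=> /le_trans/(_ (HC _ mp)) E.
    (* Bernoulli's inequality; squared, it gives quadratic growth in [m], enough to beat the linear
       bound. *)
    have bern : 1 + m%:R * dl <= q^-1 ^+ m.
      elim: m {mp mR E} => [|m IH]; first by rewrite mul0r addr0 expr0.
      rewrite exprS -natr1 (_ : q^-1 = 1 + dl); last by rewrite /dl addrC subrK.
      have dl0 : 0 <= dl by exact: ltW.
      have := ler_wpM2l (addr_ge0 ler01 dl0) IH; rewrite -/dl.
      have := ler0n R m; have := mulr_ge0 (ler0n R m) (mulr_ge0 dl0 dl0).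
      rewrite (_ : q^-1 = 1 + dl); last by rewrite /dl addrC subrK.
      lra.
    have md : m%:R * dl <= q^-1 ^+ m by apply: le_trans bern; rewrite lerDr.
    have md2 : (m%:R * dl) ^+ 2 <= (q^-1 ^+ m) ^+ 2.
      by rewrite ler_pXn2r// nnegrE ?mulr_ge0 ?exprn_ge0 ?invr_ge0// ltW.
    have Y : (m%:R * dl) ^+ 2 * r <= C * m.+1%:R.
      by apply: le_trans E; rewrite ler_wpM2r.
    have X : C * m.+1%:R <= 2 * C * m%:R.
      by rewrite (mulrC 2) -mulrA ler_wpM2l// -natrM ler_nat mul2n -addnn -addn1 leq_add2l.
    rewrite -(ler_pM2r mR); apply: le_trans (le_trans Y X).
    by rewrite le_eqVlt; apply/orP; left; apply/eqP; ring.
  have rd : 0 < r * dl ^+ 2 by rewrite mulr_gt0// exprn_gt0.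
  have := K (Num.truncn (2 * C / (r * dl ^+ 2))).+1 isT.
  rewrite mulrC -ler_pdivlMr//; apply/negP; rewrite -ltNge.
  exact: truncnS_gt.
rewrite (_ : `]0, 1[%classic = \bigcup_n (`]0, 1 - n.+2%:R^-1]%classic : set (measurableTypeR R))); last first.
  apply/seteqP; split => [t|t [n _]] /=; rewrite !in_itv/=.
    move=> /andP[t0 t1]; exists (Num.truncn (1 - t)^-1) => //; rewrite /= in_itv/= t0/=.
    rewrite lerBrDr -lerBrDl -[leRHS]invrK lef_pV2 ?posrE ?invr_gt0 ?subr_gt0//.
    by apply/ltW/(lt_le_trans (truncnS_gt _)); rewrite ler_nat.
  move=> /andP[-> tn]; apply: (le_lt_trans tn); rewrite ltrBlDr ltrDl invr_gt0//.
have mA (n : nat) : measurable (`]0, 1 - n.+2%:R^-1]%classic : set (measurableTypeR R)).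
  exact: measurable_itv.
apply/negligibleP; first exact: bigcupT_measurable.
apply: negligible_bigcup => n; apply/negligibleP => //; apply: H.
have n2 : n.+2%:R^-1 < 1 :> R by rewrite invf_lt1// ltr1n.
by rewrite subr_gt0 n2/= ltrBlDr ltrDl invr_gt0.
Qed.

End NullUnitInterval.

(** * Slices of the Gaussian *)

Section SliceKernel.
Context {R : realType}.
Variable alpha : R.
Hypothesis alpha_gt0 : 0 < alpha.
Local Notation D0 := (`]0, +oo[%classic : set (measurableTypeR R)).
Local Notation D := (`[1, +oo[%classic : set (measurableTypeR R)).

(** Closed counterpart of [cutinv]: an atom of [mu] at 1 has not been excluded, so the value 1 is
    kept there. *)
Definition inv1 (t : R) : R := if 1 <= t then t^-1 else 0.

Lemma inv1_ge0 t : 0 <= inv1 t.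
Proof. by rewrite /inv1; case: ifP => // /(lt_le_trans ltr01) t0; rewrite invr_ge0 ltW. Qed.

Lemma inv1_le1 t : inv1 t <= 1.
Proof. by rewrite /inv1; case: ifP => // t1; rewrite invf_le1// (lt_le_trans ltr01). Qed.

Lemma measurable_inv1 : measurable_fun [set: measurableTypeR R] inv1.
Proof.
have mD : measurable D by exact: measurable_itv.
rewrite (_ : inv1 = (GRing.inv : R -> R) \_ D); last first.
  by apply/funext => t; rewrite /inv1 patchE mem_setE in_itv/= andbT.
apply/(measurable_restrictT _ mD); apply: (@measurable_funS _ _ _ _ D0) => //.
  by move=> t; rewrite /= !in_itv/= !andbT => /(lt_le_trans ltr01).
apply/measurable_EFinP; exact: (measurable_expNr 1).
Qed.

(** Its weighted modulus is [e^(-alpha y^2)]: bounded, but without decay along the real axis, which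
    makes it a sharp test function. *)
Definition gauss_exp (z : R[i]) : R[i] := cexp ((alpha / 2)%:C * (z * z)).

Lemma gauss_expE (x y : R) : gauss_exp (x +i* y) =
  (expR (alpha / 2 * (x ^+ 2 - y ^+ 2)))%:C *
    (cos (alpha * x * y) +i* sin (alpha * x * y)).
Proof.
rewrite /gauss_exp /cexp /=.
have -> : alpha / 2 * (x * x - y * y) - 0 * (x * y + y * x) = alpha / 2 * (x ^+ 2 - y ^+ 2) by ring.
have -> : alpha / 2 * (x * y + y * x) + 0 * (x * x - y * y) = alpha * x * y by field.
by [].
Qed.

Lemma gauss_exp_entire : entire gauss_exp.
Proof.
apply/entireP => w; eexists.
apply: (@cderiv_comp _ cexp (fun z => (alpha / 2)%:C * (z * z))); first exact: cderiv_cexp.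
by apply: cderivM; [exact: cderiv_cst|apply: cderivM; exact: cderiv_id].
Qed.

Lemma gauss_exp_fockoo : fockoo alpha gauss_exp.
Proof.
split; first exact: gauss_exp_entire.
apply: (@le_lt_trans _ _ 1%E); last by rewrite ltry.
apply: ge_ereal_sup => _ [[x y] _ <-]; rewrite lee_fin weighted_modulusE gauss_expE.
rewrite Normc.normcM normc_real (ger0_norm (expR_ge0 _)) normcE/= cos2Dsin2 sqrtr1 mulr1.
rewrite -expRD -[leRHS]expR0 ler_expR.
have := mulr_ge0 (ltW alpha_gt0) (sqr_ge0 y); lra.
Qed.

(** The rotated and weighted integrand of [slice_integrand], in the variable [w = 1 / t]. The same
    [a = alpha (1 - w^2) / 2] governs the decay in [x] and the oscillation [cos (2 a x y)], which is
    the form [gauss_cos_ge] handles. *)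
Definition slice_kernel (x y w : R) : R :=
  expR (- (alpha / 2 * (1 - w ^+ 2) * x ^+ 2)) * expR (- (alpha / 2 * (1 + w ^+ 2) * y ^+ 2)) *
  cos (2 * (alpha / 2 * (1 - w ^+ 2)) * x * y) * w.

(** Adding [w] therefore makes the kernel nonnegative, as Tonelli's theorem asks. *)
Lemma slice_kernel_ge x y w : 0 <= w <= 1 -> - w <= slice_kernel x y w.
Proof.
move=> /andP[w0 w1]; rewrite /slice_kernel -[leLHS]mulN1r ler_wpM2r//.
have w2 : 0 <= 1 - w ^+ 2 by rewrite subr_ge0 expr_le1.
have a2 : 0 <= alpha / 2 by rewrite divr_ge0// ltW.
have e1 : expR (- (alpha / 2 * (1 - w ^+ 2) * x ^+ 2)) <= 1.
  by rewrite -[leRHS]expR0 ler_expR oppr_le0 (mulr_ge0 (mulr_ge0 a2 w2) (sqr_ge0 x)).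
have e2 : expR (- (alpha / 2 * (1 + w ^+ 2) * y ^+ 2)) <= 1.
  have w3 : 0 <= 1 + w ^+ 2 by rewrite addr_ge0 ?sqr_ge0.
  by rewrite -[leRHS]expR0 ler_expR oppr_le0 (mulr_ge0 (mulr_ge0 a2 w3) (sqr_ge0 y)).
have : `|expR (- (alpha / 2 * (1 - w ^+ 2) * x ^+ 2)) * expR (- (alpha / 2 * (1 + w ^+ 2) * y ^+ 2)) *
  cos (2 * (alpha / 2 * (1 - w ^+ 2)) * x * y)| <= 1.
  rewrite !normrM !(ger0_norm (expR_ge0 _)) -[leRHS]mulr1 ler_pM ?mulr_ge0 ?expR_ge0//.
    by rewrite -[leRHS]mulr1 ler_pM ?expR_ge0.
  by rewrite ler_norml cos_geN1 cos_le1.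
by rewrite ler_norml => /andP[].
Qed.

(** The argument of [gauss_exp (z / t)] is [alpha x y / t^2]; rotating by [- alpha x y] leaves
    [- alpha x y (1 - t^-2)], which vanishes at [t = 1], where the Gaussian decay in [x] is lost. *)
Lemma slice_integrand (x y t : R) : 0 < t ->
  complex.Re ((cos (- (alpha * x * y)) +i* sin (- (alpha * x * y))) *
    hausdorff_integrand gauss_exp (x +i* y) t) * expR (- (alpha / 2) * (x ^+ 2 + y ^+ 2)) =
  slice_kernel x y t^-1.
Proof.
move=> t0; rewrite /hausdorff_integrand.
have -> : (x +i* y) / t%:C = (x / t) +i* (y / t).
  by rewrite -fmorphV; apply/eqP; rewrite eq_complex /=; apply/andP; split; apply/eqP; ring.
rewrite gauss_expE -fmorphV.
set p := alpha * x * y; set w := t^-1.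
have -> : alpha * (x * w) * (y * w) = p * w ^+ 2 by rewrite /p; ring.
rewrite /slice_kernel.
have -> : 2 * (alpha / 2 * (1 - w ^+ 2)) * x * y = - (- p + p * w ^+ 2) by rewrite /p; field.
rewrite (cosN (- p + _)) cosD -expRD.
have -> : - (alpha / 2 * (1 - w ^+ 2) * x ^+ 2) - alpha / 2 * (1 + w ^+ 2) * y ^+ 2 =
  alpha / 2 * ((x * w) ^+ 2 - (y * w) ^+ 2) - alpha / 2 * (x ^+ 2 + y ^+ 2) by ring.
rewrite mulNr expRD /=; ring.
Qed.

End SliceKernel.

Section SliceTonelli.
Context {R : realType}.
Variable alpha : R.
Hypothesis alpha_gt0 : 0 < alpha.
Local Notation leb := (@lebesgue_measure R).
Variable mu : {measure set (measurableTypeR R) -> \bar R}.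
Local Notation D0 := (`]0, +oo[%classic : set (measurableTypeR R)).
Local Notation A0 := (`]0, 1[%classic : set (measurableTypeR R)).
Local Notation D := (`[1, +oo[%classic : set (measurableTypeR R)).
Hypothesis mu0 : mu A0 = 0%E.
Hypothesis moment0 : (hausdorff_moment mu 0 < +oo)%E.

(** The null set []0, 1[] is discarded and the rest of [mu] made sigma-finite. The first clause
    serves integrands of either sign, the second turns moments into integrals of powers of
    [inv1]. *)
Lemma inv1_restriction : exists nu : {sigma_finite_measure set (measurableTypeR R) -> \bar R},
  (forall g G : R -> R, mu.-integrable D0 (EFin \o g) ->
    (forall t, 1 <= t -> G t = g t) -> (forall t, ~~ (1 <= t) -> G t = 0) ->
    (\int[nu]_t (G t)%:E = \int[mu]_(t in D0) (g t)%:E)%E) /\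
  (forall k, \int[nu]_t (inv1 t ^+ k.+1)%:E = hausdorff_moment mu k)%E.
Proof.
have mA : measurable A0 by exact: measurable_itv.
have mD : measurable D by exact: measurable_itv.
have mD0 : measurable D0 by exact: measurable_itv.
have DD0 : D `<=` D0.
  by move=> t; rewrite /= !in_itv/= !andbT => /(lt_le_trans ltr01).
have DE : D0 `\` A0 = D.
  apply/seteqP; split => t /=; rewrite !in_itv/= !andbT.
    by move=> [t0 /negP]; rewrite t0/= -leNgt.
  move=> t1; split; first exact: lt_le_trans t1.
  by apply/negP; rewrite negb_and -!leNgt t1 orbT.
have UE : D0 = A0 `|` D.
  by rewrite -DE setDUK// => t; rewrite /= !in_itv/= andbT => /andP[].
have [nu [nuE _]] := sigma_finite_restriction mD DD0 (moment_inv_lty mD DD0 moment0).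
have toD (g G : R -> R) : (forall t, 1 <= t -> G t = g t) -> (forall t, ~~ (1 <= t) -> G t = 0) ->
    (\int[nu]_t (G t)%:E = \int[mu]_(t in D) (g t)%:E)%E.
  move=> Gg G0; apply/esym; rewrite (eq_measure_integral nu)// integral_mkcond.
  apply: eq_integral => t _; rewrite patchE mem_setE in_itv/= andbT.
  by case: ifPn => [/Gg ->|/G0 ->].
exists nu; split=> [g G ig Gg G0|k].
  by rewrite (toD g G)// (negligible_integral mA mD0 ig mu0) DE.
rewrite (toD (fun t => t ^- k.+1)); last 2 first.
- by move=> t t1; rewrite /inv1 t1 exprVn.
- by move=> t t1; rewrite /inv1 (negbTE t1) expr0n.
rewrite /hausdorff_moment UE ge0_integral_setU//.
- rewrite null_set_integral ?add0e//.
  by apply: measurable_funS (measurable_expNr k.+1) => //; rewrite UE; exact: subsetUl.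
- by rewrite -UE; exact: measurable_expNr.
- by rewrite -UE => t; exact: expNr_ge0.
- by apply/eqP/seteqP; split => // t; rewrite -DE => -[? []].
Qed.

Let f := gauss_exp alpha.
Hypothesis fint : forall z, cintegrable mu D0 (hausdorff_integrand f z).

Lemma integrable_slice_kernel (x y : R) :
  mu.-integrable D0 (EFin \o (fun t => slice_kernel alpha x y t^-1)).
Proof.
have mD0 : measurable D0 by exact: measurable_itv.
pose c : R[i] := cos (- (alpha * x * y)) +i* sin (- (alpha * x * y)).
have [ir _] := cintegrableZ mD0 c (fint (x +i* y)).
have := integrableZl mD0 (expR (- (alpha / 2) * (x ^+ 2 + y ^+ 2))) ir.
apply: eq_integrable => // t; rewrite inE/= in_itv/= andbT => t0.
by rewrite -slice_integrand// -EFinM mulrC.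
Qed.

(* Rotating [hausdorff mu f z] by the phase [e^(-i alpha x y)] makes its
   integrand almost positive near the real axis. *)
Lemma weighted_hausdorff_ge (x y : R) :
  \int[mu]_(t in D0) slice_kernel alpha x y t^-1 <=
  weighted_modulus alpha (hausdorff mu f) (x +i* y).
Proof.
have mD0 : measurable D0 by exact: measurable_itv.
pose c : R[i] := cos (- (alpha * x * y)) +i* sin (- (alpha * x * y)).
have c1 : normc c = 1 by rewrite normcE/= cos2Dsin2 sqrtr1.
have [ir _] := cintegrableZ mD0 c (fint (x +i* y)).
rewrite weighted_modulusE.
have -> : normc (hausdorff mu f (x +i* y)) = normc (c * hausdorff mu f (x +i* y)).
  by rewrite Normc.normcM c1 mul1r.
rewrite /hausdorff -cintegralZ//.
set E := expR _.
pose h (t : R) := c * hausdorff_integrand f (x +i* y) t.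
apply: (@le_trans _ _ (complex.Re (cintegral mu D0 h) * E)).
  rewrite -[complex.Re (cintegral mu D0 h)]/(\int[mu]_(t in D0) complex.Re (h t)).
  rewrite mulrC -RintegralZl//.
  rewrite le_eqVlt; apply/orP; left; apply/eqP; apply: eq_Rintegral => t.
  by rewrite inE/= in_itv/= andbT => t0; rewrite -(slice_integrand alpha x y t0) [LHS]mulrC.
rewrite ler_wpM2r ?expR_ge0//; apply: le_trans (ler_normc_Re _); exact: ler_norm.
Qed.

(** [alpha y^2 <= 1] is used twice: it keeps the Gaussian factor in [y] above [e^(-1)], and it gives
    [2 a y^2 <= 1], so the cosine costs only a factor 2. [sum_le_gauss_int] then brings in the
    series. *)
Lemma slice_kernel_int_ge (y w : R) (n : nat) : 0 <= w <= 1 -> alpha * y ^+ 2 <= 1 ->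
  w * (expR (-1) / 2 / (expR 1 * (1 + 2 * Num.sqrt alpha)) *
    \sum_(k < n) w ^+ k * (Num.sqrt k.+1%:R)^-1) <=
  \int[leb]_(x in `[0, n%:R]) slice_kernel alpha x y w.
Proof.
move=> w01 ay; have /andP[w0 w1] := w01.
set a := alpha / 2 * (1 - w ^+ 2).
have w2 : 0 <= w ^+ 2 <= 1 by rewrite sqr_ge0 expr_le1.
have /andP[w20 w21] := w2.
have a0 : 0 <= a by rewrite mulr_ge0 ?subr_ge0// divr_ge0// ltW.
set b := expR (- (alpha / 2 * (1 + w ^+ 2) * y ^+ 2)).
have ay0 := mulr_ge0 (ltW alpha_gt0) (sqr_ge0 y).
have b1 : expR (-1) <= b.
  rewrite ler_expR lerN2; apply: le_trans ay.
  by have := ler_wpM2l ay0 w21; lra.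
have ay2 : 2 * a * y ^+ 2 <= 1.
  by apply: le_trans ay; rewrite /a; have := mulr_ge0 ay0 w20; lra.
have n0 : 0 <= n%:R :> R by [].
have C0 : 0 < expR 1 * (1 + 2 * Num.sqrt alpha) :> R.
  by rewrite mulr_gt0 ?expR_gt0// ltr_wpDr// mulr_ge0 ?sqrtr_ge0.
have S := @sum_le_gauss_int _ _ alpha_gt0 w n w01.
rewrite -/a in S.
have G := gauss_cos_ge a0 ay2 n0.
have -> : \int[leb]_(x in `[0, n%:R]) slice_kernel alpha x y w =
   w * (b * \int[leb]_(x in `[0, n%:R]) (expR (- (a * x ^+ 2)) * cos (2 * a * x * y))).
  rewrite mulrA -RintegralZl//.
    by apply: eq_Rintegral => x _; rewrite /slice_kernel -/a -/b; ring.
  exact: continuous_integrable (@continuous_gauss_cos _ a y).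
rewrite ler_wpM2l//.
set J := \int[leb]_(x in _) expR _ in S G; set T := \sum_(k < n) _ in S *.
have J0 : 0 <= J by apply: Rintegral_ge0 => x _; exact: expR_ge0.
apply: (@le_trans _ _ (expR (-1) * (1 / 2 * J))).
  rewrite [leRHS](_ : _ = expR (-1) / 2 * J); last by ring.
  rewrite -mulrA ler_wpM2l ?divr_ge0 ?expR_ge0// mulrC ler_pdivrMr// mulrC//.
by apply: ler_pM; rewrite ?expR_ge0// mulr_ge0.
Qed.

Lemma continuous_slice_kernel (y w : R) : continuous (fun x => slice_kernel alpha x y w).
Proof.
have -> : (fun x => slice_kernel alpha x y w) = (fun x =>
    expR (- (alpha / 2 * (1 - w ^+ 2) * x ^+ 2)) * cos (2 * (alpha / 2 * (1 - w ^+ 2)) * x * y) *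
    (expR (- (alpha / 2 * (1 + w ^+ 2) * y ^+ 2)) * w)).
  by apply/funext => x; rewrite /slice_kernel; ring.
by move=> x; apply: cvgM; [exact: continuous_gauss_cos|exact: cvg_cst].
Qed.

Lemma measurable_slice_kernel (y : R) :
  measurable_fun [set: measurableTypeR R * measurableTypeR R]
    (fun q => slice_kernel alpha q.1 y (inv1 q.2)).
Proof.
have mw : measurable_fun [set: measurableTypeR R * measurableTypeR R] (fun q => inv1 q.2).
  by apply: measurableT_comp; [exact: measurable_inv1|exact: measurable_snd].
have mx : measurable_fun [set: measurableTypeR R * measurableTypeR R] (fun q => q.1).
  exact: measurable_fst.
have msq (g : measurableTypeR R * measurableTypeR R -> R) : measurable_fun setT g ->
    measurable_fun setT (fun x => g x ^+ 2).
  by move=> mg; apply: (measurableT_comp (f := fun x : R => x ^+ 2)).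
have ma : measurable_fun [set: measurableTypeR R * measurableTypeR R]
    (fun q => alpha / 2 * (1 - inv1 q.2 ^+ 2)).
  apply: measurable_funM; first exact: measurable_cst.
  by apply: measurable_funB; [exact: measurable_cst|exact: msq].
rewrite /slice_kernel; apply: measurable_funM => //; apply: measurable_funM.
  apply: measurable_funM; apply: measurableT_comp => //; apply: measurable_funN.
    by apply: measurable_funM => //; exact: msq.
  apply: measurable_funM; last exact: measurable_cst.
  apply: measurable_funM; first exact: measurable_cst.
  by apply: measurable_funD; [exact: measurable_cst|exact: msq].
apply: (measurableT_comp (f := cos)).
  exact: continuous_measurable_fun (@continuous_cos R).
apply: measurable_funM; last exact: measurable_cst.
apply: measurable_funM => //; apply: measurable_funM => //; exact: measurable_cst.
Qed.

Lemma integral_indic (I : set (measurableTypeR R)) (h : R -> R) :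
  (\int[leb]_x (\1_I x * h x)%:E = \int[leb]_(x in I) (h x)%:E)%E.
Proof.
rewrite [RHS]integral_mkcond; apply: eq_integral => x _.
by rewrite patchE indicE; case: ifPn; rewrite ?mul1r ?mul0r.
Qed.

(** One nonnegative double integral is computed in two orders: integrating in [t] first gives at
    most the weighted modulus, integrating in [x] first gives at least the partial sum of moments.
    Both sides carry the same extra [n mu_0]. *)
Lemma slice_bound (y : R) (n : nat) : entire (hausdorff mu f) -> alpha * y ^+ 2 <= 1 ->
  ((expR (-1) / 2 / (expR 1 * (1 + 2 * Num.sqrt alpha)))%:E *
    \sum_(k < n) (((Num.sqrt k.+1%:R)^-1)%:E * hausdorff_moment mu k) <=
  \int[leb]_(x in `[0%R, n%:R]) (weighted_modulus alpha (hausdorff mu f) (x +i* y))%:E)%E.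
Proof.
move=> He ay; have [nu [toint momE]] := inv1_restriction.
have mD0 : measurable D0 by exact: measurable_itv.
set c := expR (-1) / 2 / _.
have c0 : 0 <= c.
  by rewrite /c !divr_ge0 ?mulr_ge0 ?expR_ge0// addr_ge0// mulr_ge0 ?sqrtr_ge0.
pose I : set (measurableTypeR R) := `[0, n%:R]%classic.
have mI : measurable I by exact: measurable_itv.
pose W x := weighted_modulus alpha (hausdorff mu f) (x +i* y).
have W0 x : 0 <= W x by exact: weighted_modulus_ge0.
have m00 := hausdorff_moment_ge0 mu 0.
have /fineK m0E : hausdorff_moment mu 0 \is a fin_num by rewrite ge0_fin_numE.
set m0 := fine _ in m0E.
have m0_ge0 : 0 <= m0 by exact: fine_ge0.
have ii : mu.-integrable D0 (EFin \o (fun t => t^-1)).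
  apply/integrableP; split; first exact: (measurable_expNr 1).
  apply: le_lt_trans moment0; rewrite le_eqVlt; apply/orP; left; apply/eqP.
  apply: eq_integral => t; rewrite inE/= in_itv/= andbT => t0.
  by rewrite ger0_norm// invr_ge0 ltW.
have w01 (t : R) : 0 <= inv1 t <= 1 by rewrite inv1_ge0 inv1_le1.
(* The indicator restricts [x] to [[0, n]] while keeping both integrations over the whole line. *)
pose P (q : measurableTypeR R * measurableTypeR R) : \bar R :=
  (\1_I q.1 * (slice_kernel alpha q.1 y (inv1 q.2) + inv1 q.2))%:E.
have P0 q : (0 <= P q)%E.
  have := slice_kernel_ge alpha_gt0 q.1 y (w01 q.2).
  by rewrite -subr_ge0 opprK lee_fin => H; rewrite mulr_ge0.
have mP : measurable_fun setT P.
  apply/measurable_EFinP; apply: measurable_funM.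
    have mI1 : measurable_fun [set: measurableTypeR R] (\1_I : measurableTypeR R -> R).
      exact: measurable_indic.
    exact: (measurableT_comp mI1 measurable_fst).
  apply: measurable_funD; first exact: measurable_slice_kernel.
  by apply: measurableT_comp; [exact: measurable_inv1|exact: measurable_snd].
have swap := fubini_tonelli (m1 := leb) (m2 := nu) P mP P0.
have lI : leb I = n%:R%:E.
  by rewrite lebesgue_measure_itv/= lte_fin sube0; case: ltP => // n0; congr (_%:E); apply/le_anti; rewrite n0 ler0n.
have mW : measurable_fun [set: measurableTypeR R] W.
  exact: (measurable_fun_pair1 y (measurable_weighted_modulus alpha He)).
have left : (\int[leb]_x \int[nu]_t P (x, t) <= \int[leb]_(x in I) (W x)%:E + (n%:R * m0)%:E)%E.
  have -> : (\int[leb]_(x in I) (W x)%:E + (n%:R * m0)%:E = \int[leb]_(x in I) (W x + m0)%:E)%E.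
    under [RHS]eq_integral do rewrite EFinD.
    rewrite ge0_integralD//.
    - by rewrite integral_cst//= lI -EFinM mulrC.
    - by move=> x _; rewrite lee_fin.
    - by apply/measurable_EFinP; exact: measurable_funTS.
  rewrite -integral_indic; apply: ge0_le_integral => //.
  - by move=> x _; exact: integral_ge0.
  - exact: measurable_fun_fubini_tonelli_F.
  - apply/measurable_EFinP; apply: measurable_funM; first exact: measurable_indic.
    by apply: measurable_funD => //; exact: measurable_cst.
  move=> x _; rewrite /P /=.
  have isk := integrable_slice_kernel x y.
  have ig : mu.-integrable D0 (EFin \o (fun t => \1_I x * (slice_kernel alpha x y t^-1 + t^-1))).
    have := integrable_lincomb mD0 (\1_I x) (\1_I x) isk ii.
    by apply: eq_integrable => // t _ /=; rewrite mulrDr.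
  rewrite (toint _ _ ig); last 2 first.
  - by move=> t t1; rewrite /inv1 t1.
  - by move=> t t1; rewrite /inv1 (negbTE t1) /slice_kernel mulr0 addr0 mulr0.
  rewrite -[leLHS](fineK (integrable_fin_num mD0 ig)) lee_fin.
  rewrite -/(Rintegral mu D0 _).
  have -> : \int[mu]_(t in D0) (\1_I x * (slice_kernel alpha x y t^-1 + t^-1)) =
      \1_I x * \int[mu]_(t in D0) slice_kernel alpha x y t^-1 + \1_I x * m0.
    by rewrite -Rintegral_lincomb//; apply: eq_Rintegral => t _; rewrite mulrDr.
  by rewrite -mulrDr ler_wpM2l// lerD2r weighted_hausdorff_ge.
have right : (c%:E * (\sum_(k < n) (((Num.sqrt k.+1%:R)^-1)%:E * hausdorff_moment mu k)) + (n%:R * m0)%:E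
    <= \int[nu]_t \int[leb]_x P (x, t))%E.
  have mwk k : measurable_fun [set: measurableTypeR R] (fun t : R => (inv1 t ^+ k.+1)%:E).
    apply/measurable_EFinP; apply: (measurableT_comp (f := fun x : R => x ^+ k.+1)) => //.
    exact: measurable_inv1.
  have wk0 k (t : R) : (0 <= (inv1 t ^+ k.+1)%:E)%E by rewrite lee_fin exprn_ge0// inv1_ge0.
  have s0 k : 0 <= (Num.sqrt k.+1%:R)^-1 :> R by rewrite invr_ge0 sqrtr_ge0.
  pose S (t : R) : \bar R := (\sum_(k < n) ((Num.sqrt k.+1%:R)^-1)%:E * (inv1 t ^+ k.+1)%:E)%E.
  have mS : measurable_fun [set: measurableTypeR R] S.
    by apply: emeasurable_sum => k; apply: emeasurable_funM => //; exact: measurable_cst.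
  have S0 t : (0 <= S t)%E by apply: sume_ge0 => k _; rewrite mule_ge0// lee_fin.
  have -> : (c%:E * (\sum_(k < n) (((Num.sqrt k.+1%:R)^-1)%:E * hausdorff_moment mu k)) + (n%:R * m0)%:E =
      \int[nu]_t (c%:E * S t + n%:R%:E * (inv1 t ^+ 1)%:E))%E.
    rewrite ge0_integralD//.
    - rewrite !ge0_integralZl_EFin// momE EFinM m0E; congr (_ * _ + _)%E.
      rewrite ge0_integral_sum//.
      + by apply: eq_bigr => k _; rewrite ge0_integralZl_EFin// momE.
      + by move=> k; apply: emeasurable_funM => //; exact: measurable_cst.
      + by move=> k t _; rewrite mule_ge0// lee_fin.
    - by move=> t _; rewrite mule_ge0.
    - by apply: emeasurable_funM => //; exact: measurable_cst.
    - by move=> t _; rewrite mule_ge0// lee_fin.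
    - by apply: emeasurable_funM => //; exact: measurable_cst.
  apply: ge0_le_integral => //.
  - by move=> t _; rewrite adde_ge0// mule_ge0// lee_fin.
  - by apply: emeasurable_funD; apply: emeasurable_funM => //; exact: measurable_cst.
  - exact: measurable_fun_fubini_tonelli_G.
  move=> t _; rewrite /P /= integral_indic.
  have isk : leb.-integrable I (EFin \o (fun x => slice_kernel alpha x y (inv1 t))).
    exact: continuous_integrable (@continuous_slice_kernel y (inv1 t)).
  have iw : leb.-integrable I (EFin \o (fun _ : R => inv1 t)).
    by apply: continuous_integrable => x; exact: cvg_cst.
  have isw : leb.-integrable I (EFin \o (fun x => slice_kernel alpha x y (inv1 t) + inv1 t)).
    by have := integrableD mI isk iw; apply: eq_integrable.
  rewrite -[leRHS](fineK (integrable_fin_num mI isw)).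
  rewrite -/(Rintegral leb I _) RintegralD// Rintegral_cst//= lI /=.
  have := slice_kernel_int_ge n (w01 t) ay; rewrite -/c -/I => H.
  have -> : (c%:E * S t + n%:R%:E * (inv1 t ^+ 1)%:E =
     (inv1 t * (c * \sum_(k < n) inv1 t ^+ k * (Num.sqrt k.+1%:R)^-1) + inv1 t * n%:R)%:E)%E.
    rewrite EFinD; congr (_ + _)%E; last by rewrite -EFinM expr1 mulrC.
    rewrite /S; under eq_bigr do rewrite -EFinM.
    rewrite sumEFin -EFinM mulrCA; congr (c * _)%:E; rewrite mulr_sumr.
    by apply: eq_bigr => k _; rewrite exprS; ring.
  by rewrite lee_fin lerD2r.
move: right; rewrite -swap => /le_trans/(_ left).
(* The added term [n mu_0] is finite, hence can be cancelled. *)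
by rewrite leeD2rE.
Qed.

End SliceTonelli.

(** * From horizontal slices to the area integral *)

Section NecessaryCondition.
Context {R : realType}.
Variables (mu : {measure set (measurableTypeR R) -> \bar R}) (alpha : R).
Hypothesis alpha_gt0 : 0 < alpha.
Local Notation leb := (@lebesgue_measure R).

(** Tonelli's theorem with [y] outermost, keeping only the slices with [0 <= y <= L]. *)
Lemma strip_bound (g : R[i] -> R[i]) (a : \bar R) (L s : R) : entire g -> 0 <= L -> (0 <= a)%E ->
  (forall y : R, 0 <= y <= L ->
    (a <= \int[leb]_(x in `[0%R, s]) (weighted_modulus alpha g (x +i* y))%:E)%E) ->
  (L%:E * a <= \int[area_measure]_p (weighted_modulus alpha g (p.1 +i* p.2))%:E)%E.
Proof.
move=> eg L0 a0 H.
pose F (p : measurableTypeR R * measurableTypeR R) := (weighted_modulus alpha g (p.1 +i* p.2))%:E.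
have mF : measurable_fun setT F by apply/measurable_EFinP; exact: measurable_weighted_modulus.
have F0 p : (0 <= F p)%E by rewrite lee_fin weighted_modulus_ge0.
rewrite (fubini_tonelli2 (m1 := leb) (m2 := leb) F)//.
have mG : measurable_fun setT (fubini_G leb F) by exact: measurable_fun_fubini_tonelli_G.
have G0 y : (0 <= fubini_G leb F y)%E by exact: integral_ge0.
pose J : set (measurableTypeR R) := `[0, L]%classic.
have mJ : measurable J by exact: measurable_itv.
apply: (@le_trans _ _ (\int[leb]_(y in J) fubini_G leb F y)%E); last first.
  by apply: ge0_subset_integral.
have -> : (L%:E * a = \int[leb]_(y in J) a)%E.
  rewrite integral_cst//= lebesgue_measure_itv/= lte_fin sube0 muleC.
  by congr (_ * _)%E; case: ltP => // L1; congr (_%:E); apply/le_anti; rewrite L0 L1.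
apply: ge0_le_integral => //; first exact: measurable_funTS.
move=> y; rewrite /J /= in_itv/= => yL; apply: le_trans (H _ yL) _.
apply: ge0_subset_integral => //.
  have := measurable_fun_pair1 y (measurable_weighted_modulus alpha eg).
  by move=> /measurable_EFinP.
by move=> x _; rewrite lee_fin weighted_modulus_ge0.
Qed.

Lemma necessary_condition :
  hausdorff_bounded mu (fockoo alpha) (fockoo_norm alpha) (fock1 alpha) (fock1_norm alpha) ->
  (\sum_(0 <= n <oo) hausdorff_moment mu n * (n.+1%:R `^ (- 2^-1))%:E < +oo)%E.
Proof.
move=> bounded.
have mu0 := measure_lt1 alpha_gt0 bounded.
have moment0 : (hausdorff_moment mu 0 < +oo)%E.
  have := moment_fin_num alpha_gt0 bounded 0.
  by rewrite muln0 ge0_fin_numE// hausdorff_moment_ge0.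
have [fint [Hentire norm_lty]] := bounded.1 _ (gauss_exp_fockoo alpha_gt0).
set H := hausdorff mu (gauss_exp alpha) in Hentire norm_lty.
set I := (\int[area_measure]_p (weighted_modulus alpha H (p.1 +i* p.2))%:E)%E in norm_lty.
have I_lty : (I < +oo)%E.
  rewrite ltNge leye_eq; apply/negP => /eqP IE; move: norm_lty.
  by rewrite /fock1_norm -/I IE gt0_muley// lte_fin divr_gt0// mulr_gt0// pi_gt0.
have sqrt_gt0 : 0 < Num.sqrt alpha by rewrite sqrtr_gt0.
pose c : R := expR (-1) / 2 / (expR 1 * (1 + 2 * Num.sqrt alpha)).
have c_gt0 : 0 < c.
  apply: divr_gt0; first by rewrite divr_gt0 ?expR_gt0.
  by apply: mulr_gt0; [exact: expR_gt0|rewrite addr_gt0// mulr_gt0].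
pose P n := (\sum_(k < n) ((Num.sqrt k.+1%:R)^-1)%:E * hausdorff_moment mu k)%E.
have P_ge0 n : (0 <= P n)%E.
  by apply: sume_ge0 => k _; rewrite mule_ge0 ?hausdorff_moment_ge0// lee_fin invr_ge0 sqrtr_ge0.
have P_le n : (P n <= (((Num.sqrt alpha)^-1 * c)^-1)%:E * I)%E.
  rewrite lee_pdivlMl ?mulr_gt0 ?invr_gt0// EFinM -muleA.
  (* The height [alpha^(-1/2)] is the largest with [alpha y^2 <= 1] throughout the strip. It does
     not depend on [n], so the partial sums are bounded uniformly. *)
  apply: (@strip_bound H _ _ n%:R) => //.
  - by rewrite mule_ge0// lee_fin ltW.
  move=> y /andP[y0 yL]; apply: slice_bound => //.
  apply: (@le_trans _ _ (alpha * (Num.sqrt alpha)^-1 ^+ 2)).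
    by rewrite ler_wpM2l ?(ltW alpha_gt0)// ler_sqr// nnegrE// invr_ge0 ltW.
  by rewrite exprVn sqr_sqrtr ?(ltW alpha_gt0)// divff// gt_eqF.
have term n : (hausdorff_moment mu n * (n.+1%:R `^ (- 2^-1))%:E =
    ((Num.sqrt n.+1%:R)^-1)%:E * hausdorff_moment mu n)%E.
  by rewrite powRN -powR12_sqrt// muleC.
apply: (@le_lt_trans _ _ (((Num.sqrt alpha)^-1 * c)^-1%:E * I)%E).
  apply: lime_le.
    apply: is_cvg_nneseries => n _ _.
    by rewrite mule_ge0 ?hausdorff_moment_ge0// lee_fin powR_ge0.
  apply: nearW => n; apply: le_trans (P_le n).
  by rewrite big_mkord; under eq_bigr do rewrite term.
by rewrite lte_mul_pinfty// lee_fin invr_ge0 mulr_ge0 ?invr_ge0// ltW.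
Qed.

End NecessaryCondition.

Theorem theorem5p2 (R : realType) (alpha : R) (alpha_gt0 : 0 < alpha)
    (mu : {measure set (measurableTypeR R) -> \bar R}) :
  ((\sum_(0 <= n <oo) hausdorff_moment mu n < +oo)%E ->
   hausdorff_bounded mu (fockoo alpha) (fockoo_norm alpha)
                        (fock1 alpha) (fock1_norm alpha)) /\
  (hausdorff_bounded mu (fockoo alpha) (fockoo_norm alpha)
                        (fock1 alpha) (fock1_norm alpha) ->
   (\sum_(0 <= n <oo)
      hausdorff_moment mu n * (n.+1%:R `^ (- 2^-1))%:E < +oo)%E).
Proof. by split; [exact: sufficient_condition|exact: necessary_condition]. Qed.
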